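(* For every $f\in\mathrm{LE}$, the function $x\mapsto f\circ x$ from $\mathrm{LE}^{>\mathbb{R}}$ to $\mathrm{LE}$ has the intermediate value property: for all $x,y\in\mathrm{LE}^{>\mathbb{R}}$ and $w\in\mathrm{LE}$, if $f\circ x\le w\le f\circ y$, then there is $z\in\mathrm{LE}$ between $x$ and $y$ (that is, $\min\{x,y\}\le z\le\max\{x,y\}$) such that $f\circ z=w$.
   Context: Fields of transseries. Let $\mathfrak{M}$ be a multiplicatively written ordered abelian group, whose elements are called monomials. $\mathbb{R}(\!(\mathfrak{M})\!)_{\mathbf{On}}$ denotes the ordered field of all formal series $f=\sum_{i<\alpha} r_i\mathfrak{m}_i$ with $\alpha$ an ordinal, $r_i \in \mathbb{R}\setminus\{0\}$, $\mathfrak{m}_i\in\mathfrak{M}$ and $\mathfrak{m}_i>\mathfrak{m}_j$ whenever $i<j$, with the usual Hahn series operations and order ($f\neq 0$ is positive iff $r_0>0$). The support of $f$ is $\{\mathfrak{m}_i : i<\alpha\}$ and, for $f \ne 0$, $r_0\mathfrak{m}_0$ is the leading term. A family of series is summable if the union of the supports is a set in which every non-empty subset has a maximum, and each monomial lies in only finitely many of the supports; its (infinite) sum is then computed monomial by monomial. Such a field is a field of transseries if $\mathfrak{M}$ is equipped with an isomorphism of ordered groups $\log:(\mathfrak{M},\cdot)\to (\mathbb{J}_{\mathfrak{M}},+)$, where $\mathbb{J}_{\mathfrak{M}}=\mathbb{R}(\!(\mathfrak{M}^{>1})\!)_{\mathbf{On}}$ is the group of series with support in $\mathfrak{M}^{>1}$,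 such that $\log(\mathfrak{m})^n<\mathfrak{m}$ for all $\mathfrak{m}\in \mathfrak{M}^{>1}$ and $n\in\mathbb{N}$. ($\mathfrak{M}$ is then a proper class.) The inverse of $\log$ is $\exp$, and $e^\gamma=\exp(\gamma)$. One extends $\log$ to all positive series: for $f=r\mathfrak{m}(1+\varepsilon)$ with $r\mathfrak{m}$ the leading term of $f$, $r>0$, $\varepsilon$ infinitesimal, $\log(f)=\log(\mathfrak{m})+\log(r)+\sum_{n\ge1}(-1)^{n+1}\varepsilon^n/n$; $\exp$ extends to all series as the inverse of this map. $\log^{\circ n}$ is the $n$-fold composition of $\log$. A monomial $\mathfrak{m}>1$ is log-atomic if $\log^{\circ n}(\mathfrak{m})\in\mathfrak{M}$ for all $n\in\mathbb{N}$. Omega-series. Let $T$ be a log-atomic element of some field of transseries. $\mathbb{R}\langle\!\langle T\rangle\!\rangle$ (omega-series in $T$) is the smallest subclass of that field containing $\mathbb{R}$ and $T$ and closed under $\exp$, $\log$ (of positive elements) and sums $\sum_{i<\alpha}r_i\mathfrak{m}_i$ of terms whose monomials $\mathfrak{m}_i$ lie in it. It has the form $\mathbb{R}(\!(\mathfrak{O})\!)_{\mathbf{On}}$ for a subgroup $\mathfrak{O}\le\mathfrak{M}$; write $\mathbb{J}=\mathbb{R}(\!(\mathfrak{O}^{>1})\!)_{\mathbf{On}}$. For every $x\in\mathbb{R}\langle\!\langle T\rangle\!\rangle$ with $x>\mathbb{R}$ (i.e. $x>r$ for all $r\in\mathbb{R}$) there is a unique map $f\mapsto f\circ x$ from $\mathbb{R}\langle\!\langle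 T\rangle\!\rangle$ to itself with $T\circ x=x$, $e^\gamma\circ x=e^{\gamma\circ x}$ for $\gamma\in\mathbb{J}$, and $(\sum_{i<\alpha} r_i\mathfrak{m}_i)\circ x=\sum_{i<\alpha} r_i(\mathfrak{m}_i\circ x)$; it is an embedding of ordered fields preserving infinite sums, $\exp$ and $\log$. LE-series. The field $\mathrm{LE}$ of logarithmic-exponential series, regarded as a subfield of $\mathbb{R}\langle\!\langle T\rangle\!\rangle$, is defined as follows. Let $T^a=e^{a\log(T)}$ for $a\in\mathbb{R}$, $G_0=\{T^a:a\in\mathbb{R}\}$, and inductively let $K_n$ be the field of all series in $\mathbb{R}\langle\!\langle T\rangle\!\rangle$ with support in $G_n$, $J_n$ the group of series with support in $G_n^{>1}$, and $G_{n+1}=\{T^ae^{\gamma}: a\in\mathbb{R},\gamma\in J_n\}$. Let $E=\bigcup_{n\in\mathbb{N}}K_n$ and $\mathrm{LE}=\bigcup_{k\in\mathbb{N}}\{f\circ\log^{\circ k}(T): f\in E\}$. $\mathrm{LE}^{>\mathbb{R}}$ is the set of $x\in\mathrm{LE}$ with $x>\mathbb{R}$. $\mathrm{LE}$ is closed under composition, i.e. $f\circ x\in\mathrm{LE}$ for $f\in\mathrm{LE}$, $x\in\mathrm{LE}^{>\mathbb{R}}$. *)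

(* Defs.v *)
From HB Require Import structures.
From mathcomp Require Import all_boot all_order all_algebra.
From mathcomp Require Import all_classical all_reals all_analysis.
Set Implicit Arguments.
Unset Strict Implicit.
Unset Printing Implicit Defensive.
Import Order.TTheory GRing.Theory Num.Theory.
Local Open Scope classical_set_scope.
Local Open Scope ring_scope.

HB.mixin Record isOrderedAbelianGroup (d : Order.disp_t) (M : Type)
    of Group M & Order.Total d M := {
  omulgC : forall a b : M, (a * b = b * a)%g;
  ole_mul2l : forall c a b : M, (a <= b)%O -> ((c * a)%g <= (c * b)%g)%O
}.

#[short(type="oabGroupType")]
HB.structure Definition OrderedAbelianGroup (d : Order.disp_t) :=
  {M of isOrderedAbelianGroup d M & Group M & Order.Total d M}.

(* Sets and proper classes.  A class is a subset of a type living in an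
   arbitrary (large) universe; it is a set when it is covered by the image of a
   type in the bottom universe Set.  The distinction cannot be dropped: when all
   reverse well-ordered supports are allowed, no non-trivial M admits an
   isomorphism of ordered groups onto the series with support in M^{>1}
   (F.-V. Kuhlmann, S. Kuhlmann and S. Shelah). *)
Definition small {T : Type} (A : set T) : Prop :=
  exists (I : Set) (e : I -> T), A `<=` range e.

Section Series.
Context {d : Order.disp_t} {R : realType} {M : oabGroupType d}.
Implicit Types (f g x y : M -> R) (m n : M) (A B : set M).

(* A is the set of values of a strictly decreasing sequence (m_i)_{i < alpha},
   alpha an ordinal. *)
Definition well_based A : Prop :=
  small A /\ forall B, B `<=` A -> B !=set0 ->
    exists2 m, B m & forall n, B n -> (n <= m)%O.

(* Series are represented by their coefficient functions M -> R.  Beware that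
   the pointwise product and order of functions are not those of series. *)
Definition supp f : set M := [set m | f m != 0].

Definition hahn : set (M -> R) := [set f | well_based (supp f)].

Definition term (r : R) m : M -> R := fun n => if n == m then r else 0.

Definition mono m : M -> R := term 1 m.

Definition const (r : R) : M -> R := term r 1%g.

(* Cauchy product; on hahn, all the sums are finite. *)
Definition hmul f g : M -> R :=
  fun m => \sum_(a \in [set: M]) f a * g (a^-1 * m)%g.

Definition hscale (r : R) f : M -> R := fun m => r * f m.

Definition hpow f (k : nat) : M -> R := iter k (hmul f) (const 1).

Definition is_lead f m : Prop := supp f m /\ forall n, supp f n -> (n <= m)%O.

Definition hpos f : Prop := exists2 m, is_lead f m & 0 < f m.

Definition hlt f g : Prop := hpos (g \- f).

Definition hle f g : Prop := f = g \/ hlt f g.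

Definition hmin f g : M -> R := if `[< hle f g >] then f else g.

Definition hmax f g : M -> R := if `[< hle f g >] then g else f.

(* x > r for all real numbers r. *)
Definition above_reals x : Prop := forall r : R, hlt (const r) x.

Definition summable_family (I : choiceType) (F : I -> M -> R) : Prop :=
  well_based (\bigcup_i supp (F i)) /\
  forall m, finite_set [set i | supp (F i) m].

Definition hsum (I : choiceType) (F : I -> M -> R) : M -> R :=
  fun m => \sum_(i \in [set: I]) F i m.

(* Series with support in M^{>1}. *)
Definition purely_infinite : set (M -> R) :=
  [set f | hahn f /\ forall m, supp f m -> (1%g < m)%O].

Definition transseries_field (log : M -> M -> R) : Prop :=
  [/\ set_bij [set: M] purely_infinite log,
      (forall m n, log (m * n)%g = log m \+ log n),
      (forall m n, (m <= n)%O <-> hle (log m) (log n)) &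
      (forall m (k : nat), (1%g < m)%O -> hlt (hpow (log m) k) (mono m))].

Definition leading_mono f : M := xget 1%g [set m | is_lead f m].

Definition leading_coef f : R := f (leading_mono f).

(* eps in the decomposition f = r m (1 + eps) with leading term r m. *)
Definition infinitesimal_part f : M -> R :=
  hmul (term (leading_coef f)^-1 (leading_mono f)^-1%g) f \- const 1.

Section Transseries.
Variable log : M -> M -> R.

(* The extension of log to positive series; the summation index is n - 1. *)
Definition Log f : M -> R :=
  log (leading_mono f) \+ const (ln (leading_coef f)) \+
  hsum (fun k : nat => hscale ((-1) ^+ k / k.+1%:R)
                              (hpow (infinitesimal_part f) k.+1)).

Definition Exp f : M -> R :=
  xget (const 0) [set g | [/\ hahn g, hpos g & Log g = f]].

(* The inverse of log on monomials: expm gamma = e^gamma for gamma purely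
   infinite. *)
Definition expm (gamma : M -> R) : M := xget 1%g [set m | log m = gamma].

Definition log_atomic m : Prop :=
  (1%g < m)%O /\ forall k : nat, exists n, iter k Log (mono m) = mono n.

Variable T : M.

Inductive omega : set (M -> R) :=
| omega_const (r : R) : omega (const r)
| omega_T : omega (mono T)
| omega_exp f : omega f -> omega (Exp f)
| omega_log f : omega f -> hpos f -> omega (Log f)
| omega_sum f : hahn f -> (forall m, supp f m -> omega (mono m)) -> omega f.

Definition omegaJ : set (M -> R) := omega `&` purely_infinite.

(* comp f x is f o x; only its values for f, x omega-series with x > R matter. *)
Definition is_composition (comp : (M -> R) -> (M -> R) -> M -> R) : Prop :=
  forall x, omega x -> above_reals x ->
  [/\ forall f, omega f -> omega (comp f x),
      comp (mono T) x = x,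
      forall gamma, omegaJ gamma ->
        comp (mono (expm gamma)) x = Exp (comp gamma x) &
      forall f, omega f ->
        let F := fun m => hscale (f m) (comp (mono m) x) in
        summable_family F /\ comp f x = hsum F].

Definition powT (a : R) : M := expm (hscale a (log T)).

Definition series_in (G : set M) : set (M -> R) :=
  [set f | omega f /\ supp f `<=` G].

Fixpoint LEgroup (k : nat) : set M :=
  if k is k'.+1 then
    [set m | exists (a : R) (gamma : M -> R),
       series_in (LEgroup k' `&` [set n | (1%g < n)%O]) gamma /\
       m = (powT a * expm gamma)%g]
  else range powT.

Definition LE_E : set (M -> R) := \bigcup_k series_in (LEgroup k).

Definition LE (comp : (M -> R) -> (M -> R) -> M -> R) : set (M -> R) :=
  \bigcup_(k : nat) [set comp f (iter k Log (mono T)) | f in LE_E].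

End Transseries.
End Series.

(* Main.v *)
Require Import Defs.
From HB Require Import structures.
From mathcomp Require Import all_boot all_order all_algebra.
From mathcomp Require Import all_classical all_reals all_analysis.
From mathcomp Require Import ring lra.

(* Infinitesimal elements e of E are contracting: if x < y are above all reals,
   then e o y - e o x is negligible with respect to y - x.  Hence T + e is
   strictly increasing, and it takes every value w above all reals, since
   u = - e o (w + u) has a solution u: its right-hand side maps the
   infinitesimals supported in a suitable G_n o log^k(T) to themselves, and in a
   set-sized group of monomials a contraction has a fixed point.

   For f in E above all reals, consider the conjugate log o f o exp.  It has the
   same monotonicity and surjectivity properties as f, and conjugating
   sufficiently often makes the leading monomial an iterated exponential of T;
   applying log then reduces to the leading monomial T, where two further
   conjugations give T + e with e infinitesimal.  Arbitrary f are reduced to this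
   case by opposites, inverses, subtracting real constants and composing with
   log^k(T). *)

Set Implicit Arguments.
Unset Strict Implicit.
Unset Printing Implicit Defensive.
Import Order.TTheory GRing.Theory Num.Theory.
Local Open Scope classical_set_scope.
Local Open Scope ring_scope.

(** Composition is given only through [is_composition], so neither a derivative nor a Taylor
    expansion is at hand, and increments between two points x < y are estimated directly. A monomial
    q = T^a e^g is treated through log q = a log T + g, where g has a lower level: by induction on
    the level, increments of logarithms control those of monomials, and strong linearity passes from
    monomials to series. The delicate point is that the increment of q^-1 is negligible whatever the
    size of y - x; the induction compares the relative decreases of q^-1 and s^-1, with s the
    leading monomial of g, and rests on s^2 < q. The second obstacle is that the monomials form a
    proper class: a limit of approximations has a set as support only inside a set-sized group,
    which the map to be iterated must preserve. Composition may raise levels, yet one fixed level is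
    enough. What u adds at the top level is smaller than every monomial of the level below, so
    exponentials of its effect are power series in such monomials and create no further level. *)

Section OrderedGroup.
Context {d : Order.disp_t} {M : oabGroupType d}.
Implicit Types (a b c m n : M) (A B C : set M).

(** * Ordered abelian groups and reverse well-ordered subsets *)

Lemma lemM2l c a b : (c * a <= c * b)%g%O = (a <= b)%O.
Proof.
apply/idP/idP; last exact: ole_mul2l.
by move=> /(ole_mul2l c^-1)%g; rewrite !mulKg.
Qed.

Lemma lemM2r c a b : (a * c <= b * c)%g%O = (a <= b)%O.
Proof. by rewrite ![(_ * c)%g]omulgC lemM2l. Qed.

Lemma ltmM2l c a b : (c * a < c * b)%g%O = (a < b)%O.
Proof. by rewrite !ltNge lemM2l. Qed.

Lemma ltmM2r c a b : (a * c < b * c)%g%O = (a < b)%O.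
Proof. by rewrite !ltNge lemM2r. Qed.

Lemma lemM a b a' b' : (a <= b)%O -> (a' <= b')%O -> (a * a' <= b * b')%g%O.
Proof. by move=> h h'; apply: (@le_trans _ _ (b * a')%g); rewrite ?lemM2l ?lemM2r. Qed.

Lemma ltmM a b a' b' : (a < b)%O -> (a' <= b')%O -> (a * a' < b * b')%g%O.
Proof. by move=> h h'; apply: (@lt_le_trans _ _ (b * a')%g); rewrite ?lemM2l ?ltmM2r. Qed.

Lemma ltmM' a b a' b' : (a <= b)%O -> (a' < b')%O -> (a * a' < b * b')%g%O.
Proof. by move=> h h'; rewrite (omulgC a) (omulgC b); apply: ltmM. Qed.

Lemma ltmV a b : (a^-1 < b^-1)%g%O = (b < a)%O.
Proof. by rewrite -[LHS](ltmM2l a) -[LHS](ltmM2r b) mulgV mul1g mulgVK. Qed.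

Lemma lemV a b : (a^-1 <= b^-1)%g%O = (b <= a)%O.
Proof. by rewrite !leNgt ltmV. Qed.

Lemma ltm1V a : (1 < a^-1)%g%O = (a < 1)%g%O.
Proof. by rewrite -{1}invg1 ltmV. Qed.

Lemma ltmV1 a : (a^-1 < 1)%g%O = (1 < a)%g%O.
Proof. by rewrite -{1}invg1 ltmV. Qed.

(* Reverse well-ordered. *)
Definition rwo A := forall B, B `<=` A -> B !=set0 ->
  exists2 m, B m & forall n, B n -> (n <= m)%O.

Lemma rwo_sub A B : A `<=` B -> rwo B -> rwo A.
Proof. by move=> AB rB C CA; apply: rB; apply: subset_trans AB. Qed.

Lemma rwoU A B : rwo A -> rwo B -> rwo (A `|` B).
Proof.
move=> rA rB C CAB C0.
have [CA|/eqP/set0P CA] := pselect (C `&` A = set0).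
  apply: (rB C) => // x Cx; case: (CAB _ Cx) => // Ax.
  by have : (C `&` A) x by []; rewrite CA.
have [m [Cm Am] hm] := rA _ (@subIsetr _ C A) CA.
have [CB|/eqP/set0P CB] := pselect (C `&` B = set0).
  exists m => // x Cx; case: (CAB _ Cx) => // Hx; first exact: hm.
  by have : (C `&` B) x by []; rewrite CB.
have [m' [Cm' Bm'] hm'] := rB _ (@subIsetr _ C B) CB.
have [mm|mm] := leP m m'.
  by exists m' => // x Cx; case: (CAB _ Cx) => Hx;
    [apply: le_trans mm; apply: hm|apply: hm'].
by exists m => // x Cx; case: (CAB _ Cx) => Hx;
  [apply: hm|apply: le_trans (ltW mm); apply: hm'].
Qed.

Lemma rwo1 a : rwo [set a].
Proof.
move=> C CA [c Cc]; exists c => // n Cn.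
by rewrite (CA _ Cc) (CA _ Cn).
Qed.

Lemma seq_lt (s : nat -> M) : (forall i, s i < s i.+1)%O ->
  forall i j, (i < j)%N -> (s i < s j)%O.
Proof.
move=> hs i; elim=> // j IH; rewrite ltnS leq_eqVlt => /orP[/eqP->//|/IH h].
exact: lt_trans h (hs j).
Qed.

Lemma no_seq_rwo A :
  (forall s : nat -> M, (forall i, A (s i)) -> ~ (forall i, s i < s i.+1)%O) ->
  rwo A.
Proof.
move=> hA C CA [c0 Cc0]; apply: contrapT => nomax.
have next (x : M) : exists y, C x -> C y /\ (x < y)%O.
  have [Cx|nCx] := pselect (C x); last by exists x.
  apply: contrapT => /forallNP h; apply: nomax; exists x => // n Cn.
  rewrite leNgt; apply/negP => xn; apply: (h n) => _; split => //.
have [g hg] := choice next.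
have Cs i : C (iter i g c0) by elim: i => //= i /hg [].
apply: (hA (fun i => iter i g c0)) => [i|i]; first exact: CA.
by have [] := hg _ (Cs i).
Qed.

Lemma rwo_no_seq A (s : nat -> M) : rwo A -> (forall i, A (s i)) ->
  ~ (forall i, s i < s i.+1)%O.
Proof.
move=> rA As hs; have [||m [i _ <-] hm] := rA (range s).
- by move=> _ [i _ <-].
- by exists (s 0%N), 0%N.
- have := hm (s i.+1); rewrite leNgt hs => /(_ _)/negP; apply => //; by exists i.+1.
Qed.

Definition is_record (s : nat -> M) i := forall j, (i <= j)%N -> (s j <= s i)%O.

(** The maximum of the tail starting at [i] is attained at a record, so records are cofinal, and
    along them the sequence decreases weakly. This replaces the extraction of monotone
    subsequences. *)
Lemma record_ex A (s : nat -> M) : rwo A -> (forall i, A (s i)) ->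
  forall i, exists2 j, (i <= j)%N & is_record s j.
Proof.
move=> rA As i; have [||m [j ij <-] hm] := rA [set s j | j in [set j | (i <= j)%N]].
- by move=> _ [j _ <-].
- by exists (s i), i => /=.
by exists j => // k jk; apply: hm; exists k => //=; apply: leq_trans jk.
Qed.

Definition mulset A B : set M := [set x | exists a b, [/\ A a, B b & x = (a * b)%g]].

(* Along the records of the first factor the second one increases. *)
Lemma rwo_mul A B : rwo A -> rwo B -> rwo (mulset A B).
Proof.
move=> rA rB; apply: no_seq_rwo => s hs hlt.
have {hs}[ab hab] := choice (fun i => let: ex_intro a (ex_intro b h) := hs i in
  ex_intro (fun p : M * M => [/\ A p.1, B p.2 & s i = (p.1 * p.2)%g]) (a, b) h).
have Aa i : A (ab i).1 by case: (hab i).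
have rec := record_ex rA Aa.
have [||m [i ri <-] hm] := rB [set (ab i).2 | i in is_record (fun i => (ab i).1)].
- by move=> _ [i _ <-]; case: (hab i).
- by have [j _ rj] := rec 0%N; exists (ab j).2, j.
have [j ij rj] := rec i.+1.
have := hm (ab j).2 (ex_intro2 _ _ j rj erefl); apply/negP; rewrite -ltNge.
have : (s i < s j)%O by apply: seq_lt.
have [_ _ ->] := hab i; have [_ _ ->] := hab j.
rewrite !ltNge; apply: contraNN => h; apply: lemM => //.
by apply: ri; apply: ltnW.
Qed.

(** If [A] were infinite, its least element would have infinitely many elements of [A] above it.
    Take the greatest such element x: its immediate successor has only finitely many elements above
    it, hence so has x. *)
Lemma rwo_rev_finite A : rwo A ->
  (forall B, B `<=` A -> B !=set0 -> exists2 m, B m & forall n, B n -> (m <= n)%O) ->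
  finite_set A.
Proof.
move=> rA mA; apply: contrapT => infA.
pose S x := finite_set (A `&` [set y | (x <= y)%O]).
have [|m Am hm] := mA A (fun _ h => h).
  by apply/set0P/eqP => A0; apply: infA; rewrite A0; apply: finite_set0.
have nS : (A `&` [set x | ~ S x]) m.
  split => // Sm; apply: infA; apply: sub_finite_set Sm => x Ax; split => //=.
  exact: hm.
have [||x [Ax nSx] hx] := rA (A `&` [set x | ~ S x]); [by move=> ? []|by exists m|].
have [E|/eqP/set0P E] := pselect (A `&` [set y | (x < y)%O] = set0).
  apply: nSx; apply: (@sub_finite_set _ _ [set x]); last exact: finite_set1.
  move=> y [Ay]; rewrite /= le_eqVlt => /orP[/eqP//|xy].
  by have : (A `&` [set y | (x < y)%O]) y by []; rewrite E.
have [|y [Ay xy] hy] := mA _ _ E; first by move=> ? [].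
have Sy : S y.
  by apply: contrapT => nSy; have := hx y (conj Ay nSy); rewrite leNgt xy.
apply: nSx; apply: (@sub_finite_set _ _ ((A `&` [set z | (y <= z)%O]) `|` [set x])).
  move=> z [Az]; rewrite /= le_eqVlt => /orP[/eqP->|xz]; [by right|left; split => //].
  exact: hy.
by rewrite finite_setU; split => //; apply: finite_set1.
Qed.

(** The fibre inherits maxima from [A], and minima from [B] because a |-> a^-1 m reverses the
    order. *)
Lemma mul_fibre_finite A B m : rwo A -> rwo B ->
  finite_set [set a | A a /\ B (a^-1 * m)%g].
Proof.
move=> rA rB; apply: rwo_rev_finite; first by apply: rwo_sub rA => a [].
move=> C CA [c0 Cc0].
have [||n [c Cc <-] hn] := rB [set (c^-1 * m)%g | c in C].
- by move=> _ [c /CA[_ h] <-].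
- by exists (c0^-1 * m)%g, c0.
exists c => // n' Cn'; have := hn _ (ex_intro2 _ _ n' Cn' erefl).
by rewrite lemM2r lemV.
Qed.

Fixpoint powset A k : set M := if k is k'.+1 then mulset A (powset A k') else [set 1%g].

(** It plays the role of the N-th power of the ideal generated by [A]: series with support in it are
    the remainders of truncated power series. *)
Definition powfrom A N : set M := [set m | exists2 k, (N <= k)%N & powset A k m].

Lemma powset_add A k l m n : powset A k m -> powset A l n -> powset A (k + l) (m * n)%g.
Proof.
elim: k m => [|k IH] m /=; first by move=> ->; rewrite mul1g.
move=> [a [b [Aa Pb ->]]] Pn; exists a, (b * n)%g; split => //; first exact: IH.
by rewrite mulgA.
Qed.

Lemma powset_sub A (B : set M) : A `<=` B -> B 1%g ->
  (forall a b, B a -> B b -> B (a * b)%g) -> forall k, powset A k `<=` B.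
Proof.
move=> AB B1 BM; elim=> [|k IH] x /=; first by move=> ->.
by move=> [a [b [/AB Ba /IH Bb ->]]]; apply: BM.
Qed.

Lemma powfrom_mul A k l m n : powfrom A k m -> powfrom A l n -> powfrom A (k + l) (m * n)%g.
Proof.
move=> [k' hk Pm] [l' hl Pn]; exists (k' + l')%N; first exact: leq_add.
exact: powset_add.
Qed.

Lemma powset_lt1 A k m : (forall a, A a -> a < 1%g)%O -> powset A k m -> (m <= 1%g)%O.
Proof.
move=> A1; elim: k m => [|k IH] m /=; first by move=> ->.
move=> [a [b [/A1 a1 /IH b1 ->]]]; rewrite -[leRHS]mulg1; apply: lemM => //.
exact: ltW.
Qed.

(* Neumann's lemma, by a minimal bad sequence: among the increasing sequences
   of products take one whose terms successively have minimal length; dropping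
   the first factors along their records gives a shorter one. *)
Lemma neumann A : rwo A -> (forall a, A a -> a < 1%g)%O -> rwo (powfrom A 0).
Proof.
move=> rA A1; pose P := powfrom A 0; rewrite -/P.
(* Membership in [U] means that a subset of [P] without maximum lies above [x], so that an infinite
   increasing sequence in [P] can start at [x]. *)
pose U : set M := [set x | P x /\ exists B, [/\ B `<=` P, B !=set0,
   forall b, B b -> (x <= b)%O & forall b, B b -> exists2 b', B b' & (b < b')%O]].
have [U0|/eqP/set0P[u0 Uu0]] := pselect (U = set0).
  move=> C CP [c0 Cc0]; apply: contrapT => nomax.
  have : U c0.
    split; first exact: CP.
    exists (C `&` [set x | (c0 <= x)%O]); split.
    - by move=> x [/CP].
    - by exists c0; split => /=.
    - by move=> b [].
    - move=> b [Cb cb]; apply: contrapT => h; apply: nomax; exists b => // n Cn.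
      rewrite leNgt; apply/negP => bn; apply: h; exists n => //; split => //=.
      exact: le_trans cb (ltW bn).
  by rewrite U0.
have Ulen (x : M) (Q : set M) : U x -> Q x -> exists k y, [/\ U y, Q y, powset A k y &
    forall l z, U z -> Q z -> powset A l z -> (k <= l)%N].
  move=> Ux Qx; pose L k := `[< exists y, [/\ U y, Q y & powset A k y] >].
  have exL : exists k, L k.
    by have [[k _ Pk] _] := Ux; exists k; apply/asboolP; exists x.
  case: (ex_minnP exL) => k /asboolP[y [Uy Qy Py]] hk.
  by exists k, y; split => // l z Uz Qz Pz; apply: hk; apply/asboolP; exists z.
have Unext x : U x -> exists2 y, U y & (x < y)%O.
  move=> [Px [B [BP [b0 Bb0] xB Binc]]].
  have [b Bb b0b] := Binc _ Bb0.
  exists b; last exact: le_lt_trans (xB _ Bb0) b0b.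
  split; first exact: BP.
  exists (B `&` [set z | (b <= z)%O]); split.
  - by move=> z [/BP].
  - by exists b; split => /=.
  - by move=> z [].
  - move=> z [/Binc[b' Bb' zb'] bz]; exists b' => //; split => //=.
    exact: le_trans bz (ltW zb').
pose good (x : M) (p : nat * M) := [/\ U p.2, (x < p.2)%O, powset A p.1 p.2 &
    forall l z, U z -> (x < z)%O -> powset A l z -> (p.1 <= l)%N].
have next (p : nat * M) : exists q, U p.2 -> good p.2 q.
  have [Up|] := pselect (U p.2); last by exists p.
  have [y Uy xy] := Unext _ Up.
  by have [k [z hz]] := Ulen y [set z | (p.2 < z)%O] Uy xy; exists (k, z).
have [g hg] := choice next.
have [k0 [y0 [Uy0 _ Py0 hy0]]] := Ulen u0 setT Uu0 I.
pose s i := iter i g (k0, y0).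
have Us i : U (s i).2 by elim: i => //= i /hg[].
have sS i : good (s i).2 (s i.+1) by apply: hg.
have Ps i : powset A (s i).1 (s i).2 by case: i => [//|i]; case: (sS i).
have slt i j : (i < j)%N -> ((s i).2 < (s j).2)%O.
  by apply: (@seq_lt (fun i => (s i).2)) => k; case: (sS k).
have sk i : exists ab : M * M, [/\ A ab.1, powset A (s i).1.-1 ab.2,
    (s i).2 = (ab.1 * ab.2)%g & (0 < (s i).1)%N].
  (* The length is not 0: such a term would be 1, and the next term, a product of elements below 1,
     could not exceed it. *)
  case E : (s i).1 (Ps i) => [|k] /=; last by move=> [a [b [? ? ?]]]; exists (a, b).
  move=> E1; have [[k _ Pk] _] := Us i.+1.
  have := powset_lt1 A1 Pk; rewrite leNgt -[X in (X < _)%O]E1.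
  by rewrite slt.
have [ab hab] := choice sk.
have Aa i : A (ab i).1 by case: (hab i).
have rec := record_ex rA Aa.
have [i _ ri] := rec 0%N.
have vs j : (ab j).2 = ((ab j).1^-1 * (s j).2)%g by case: (hab j) => _ _ -> _; rewrite mulKg.
have sv j : ((s j).2 < (ab j).2)%O.
  have [Aj _ -> _] := hab j; rewrite -[ltRHS]mul1g ltmM2r; exact: A1.
have Uv : U (ab i).2.
  split; first by exists (s i).1.-1 => //; case: (hab i).
  exists [set (ab j).2 | j in [set j | (i <= j)%N /\ is_record (fun i => (ab i).1) j]].
  have mono j k : (j < k)%N -> is_record (fun i => (ab i).1) j -> ((ab j).2 < (ab k).2)%O.
    move=> jk rj; rewrite !vs; apply: ltmM'; last exact: slt.
    by rewrite lemV; apply: rj; apply: ltnW.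
  split.
  - by move=> _ [j _ <-]; exists (s j).1.-1 => //; case: (hab j).
  - by exists (ab i).2, i => /=.
  - move=> _ [j [ij rj] <-]; move: ij; rewrite leq_eqVlt => /orP[/eqP->//|ij].
    by apply/ltW/mono.
  - move=> _ [j [ij rj] <-]; have [k jk rk] := rec j.+1.
    exists (ab k).2; last exact: mono.
    by exists k => //; split => //; apply: leq_trans ij (ltnW jk).
have [_ Pi _ i0] := hab i.
have : ((s i).1 <= (s i).1.-1)%N.
  case: i {ri} Uv Pi i0 => [|i] Uv Pi i0; first by apply: hy0 Pi.
  have [_ _ _ h] := sS i; apply: (h _ _ Uv _ Pi).
  by apply: lt_trans (sv i.+1); apply: slt.
by case: (s i).1 i0 => // n _; rewrite ltnn.
Qed.

(** By [neumann] there would be a greatest counterexample x. Dividing x by a possible first factor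
    makes it larger, so the quotient has a bound on its lengths; there are finitely many first
    factors, and the maximum of their bounds plus one bounds the lengths of x. *)
Lemma neumann_finite A m : rwo A -> (forall a, A a -> a < 1%g)%O ->
  exists N, forall k, (N <= k)%N -> ~ powset A k m.
Proof.
move=> rA A1; have rP := neumann rA A1; apply: contrapT => hm.
pose Bad := [set x | powfrom A 0 x /\ ~ exists N, forall k, (N <= k)%N -> ~ powset A k x].
have Bm : Bad m.
  split => //; apply: contrapT => nP; apply: hm; exists 0%N => k _ Pk.
  by apply: nP; exists k.
have [||x [Px nx] hx] := rP Bad; [by move=> ? []|by exists m|].
have fin := mul_fibre_finite x rA rP.
have /choice[g hg] (a : M) : exists N, A a -> powfrom A 0 (a^-1 * x)%g ->
    forall k, (N <= k)%N -> ~ powset A k (a^-1 * x)%g.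
  have [[Aa Pa]|h] := pselect (A a /\ powfrom A 0 (a^-1 * x)%g); last first.
    by exists 0%N => Aa Pa; case: h.
  have : ~ Bad (a^-1 * x)%g.
    move=> /hx; rewrite leNgt -[X in (X < _)%O]mul1g ltmM2r ltm1V.
    by rewrite A1.
  by move=> /not_andP[//|/contrapT[N hN]]; exists N.
apply: nx; have [s hs] := (finite_seqP _).1 fin.
exists (\max_(a <- s) g a).+1 => -[//|k]; rewrite ltnS => hk /= [a [b [Aa Pb E]]].
have bE : b = (a^-1 * x)%g by rewrite E mulKg.
apply: (hg a Aa _ k) => //; rewrite -?bE //; first by exists k.
apply: leq_trans hk; apply: (@leq_bigmax_seq _ s xpredT g a) => //.
have : [set a | A a /\ powfrom A 0 (a^-1 * x)%g] a by split => //; rewrite -bE; exists k.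
by rewrite hs.
Qed.

End OrderedGroup.

(** * Set-sized and well-based sets *)

Section Small.
Context {T : Type}.
Implicit Types A B : set T.

Lemma small_sub A B : A `<=` B -> small B -> small A.
Proof. by move=> AB [I [e he]]; exists I, e; apply: subset_trans he. Qed.

Lemma smallU A B : small A -> small B -> small (A `|` B).
Proof.
move=> [I [e he]] [J [f hf]]; exists (I + J)%type, (fun x => match x with inl i => e i | inr j => f j end).
move=> x [/he[i _ <-]|/hf[j _ <-]]; [by exists (inl i)|by exists (inr j)].
Qed.

Lemma small1 (x : T) : small [set x].
Proof. by exists unit, (fun=> x) => _ ->; exists tt. Qed.

End Small.

Section SmallMul.
Context {d : Order.disp_t} {M : oabGroupType d}.
Implicit Types A B : set M.

Lemma small_mul A B : small A -> small B -> small (mulset A B).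
Proof.
move=> [I [e he]] [J [f hf]]; exists (I * J)%type, (fun x => (e x.1 * f x.2)%g).
by move=> x [a [b [/he[i _ <-] /hf[j _ <-] ->]]]; exists (i, j).
Qed.

Lemma small_powfrom A : small A -> small (powfrom A 0).
Proof.
move=> [I [e he]]; exists (seq I), (foldr (fun i y => (e i * y)%g) 1%g).
move=> x [k _]; elim: k x => [|k IH] x /=; first by move=> ->; exists [::].
by move=> [a [b [/he[i _ <-] /IH[s _ <-] ->]]]; exists (i :: s).
Qed.

Lemma well_based_sub A B : A `<=` B -> well_based B -> well_based A.
Proof. by move=> AB [sB rB]; split; [apply: small_sub sB|apply: rwo_sub rB]. Qed.

Lemma well_basedU A B : well_based A -> well_based B -> well_based (A `|` B).
Proof. by move=> [sA rA] [sB rB]; split; [apply: smallU|apply: rwoU]. Qed.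

Lemma well_based1 m : well_based [set m : M].
Proof. by split; [apply: small1|apply: rwo1]. Qed.

Lemma well_based_mul A B : well_based A -> well_based B -> well_based (mulset A B).
Proof. by move=> [sA rA] [sB rB]; split; [apply: small_mul|apply: rwo_mul]. Qed.

End SmallMul.

Lemma finite_seq_uniq {I : eqType} (A : set I) : finite_set A ->
  exists2 s : seq I, uniq s & forall i, i \in s <-> A i.
Proof.
move=> /(finite_seqP _).1[s ->]; exists (undup s); first exact: undup_uniq.
by move=> i; rewrite mem_undup.
Qed.

Lemma fsum_seq {I : choiceType} {V : nmodType} (G : I -> V) (s : seq I) : uniq s ->
  (forall i, i \notin s -> G i = 0) -> \sum_(i \in [set: I]) G i = \sum_(i <- s) G i.
Proof.
move=> us hs; rewrite (fsbigE s) //=; last by move=> i _; apply: hs.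
by apply: eq_bigl => i; rewrite in_setT.
Qed.

(** * Sums and products of coefficient functions *)

Section Raw.
Context {d : Order.disp_t} {R : realType} {M : oabGroupType d}.
Implicit Types (f g h : M -> R) (m n a b : M).

Lemma not_supp f m : ~ supp f m -> f m = 0.
Proof. by rewrite /supp /= => /negP; rewrite negbK => /eqP. Qed.

Lemma hmul_seq f g m (s : seq M) : uniq s ->
  (forall a, supp f a -> supp g (a^-1 * m)%g -> a \in s) ->
  hmul f g m = \sum_(a <- s) f a * g (a^-1 * m)%g.
Proof.
move=> us hs; apply: fsum_seq => // a; apply: contraNeq.
by rewrite mulf_eq0 negb_or => /andP[fa ga]; apply: hs.
Qed.

Lemma fibre_ex f g m : rwo (supp f) -> rwo (supp g) ->
  exists2 s : seq M, uniq s & forall a, a \in s <-> supp f a /\ supp g (a^-1 * m)%g.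
Proof. by move=> hf hg; apply: finite_seq_uniq; apply: mul_fibre_finite. Qed.

Lemma supp_hmul f g : supp (hmul f g) `<=` mulset (supp f) (supp g).
Proof.
move=> m; apply: contraPP => nm; rewrite /supp /= (@hmul_seq _ _ _ [::]) ?big_nil ?eqxx //.
move=> a fa ga; exfalso; apply: nm; exists a, (a^-1 * m)%g; split => //.
by rewrite mulVKg.
Qed.

Lemma hahn_mul f g : hahn f -> hahn g -> hahn (hmul f g).
Proof. by move=> hf hg; apply: well_based_sub (@supp_hmul f g) _; apply: well_based_mul. Qed.

Lemma supp_add f g : supp (f \+ g) `<=` supp f `|` supp g.
Proof.
move=> m; rewrite /supp /=; have [->|] := eqVneq (f m) 0; last by left.
by rewrite add0r; right.
Qed.

Lemma hahn_add f g : hahn f -> hahn g -> hahn (f \+ g).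
Proof. by move=> hf hg; apply: well_based_sub (@supp_add f g) _; apply: well_basedU. Qed.

Lemma supp_term c n : supp (@term d R M c n) `<=` [set n].
Proof. by move=> m; rewrite /supp /= /term; case: (eqVneq m n) => // _; rewrite eqxx. Qed.

Lemma hahn_term c n : hahn (@term d R M c n).
Proof. apply: well_based_sub (@supp_term c n) _; exact: well_based1. Qed.

Lemma hmul_term c n f m : hmul (term c n) f m = c * f (n^-1 * m)%g.
Proof.
rewrite (@hmul_seq _ _ _ [:: n]) // ?big_seq1 /term ?eqxx // => a /supp_term -> _.
by rewrite mem_head.
Qed.

End Raw.

(** Bundling the proof of [hahn] allows the structures of ring, field and ordered field to be
    attached without interference from the pointwise operations on functions. *)
Record HS {d : Order.disp_t} (R : realType) (M : oabGroupType d) :=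
  mkHS { hv :> M -> R ; hvP : hahn hv }.

(** * The commutative ring of series *)

Section HSring.
Context {d : Order.disp_t} {R : realType} {M : oabGroupType d}.
Local Notation H := (HS R M).
Implicit Types (f g h : H) (m n a b : M).

Lemma hsP f g : (forall m, f m = g m) -> f = g.
Proof.
case: f g => f hf [g hg] /= fg; have E : f = g by apply/funext.
by case: _ / E hg => hg; rewrite (Prop_irrelevance hf hg).
Qed.

HB.instance Definition _ := gen_eqMixin H.
HB.instance Definition _ := gen_choiceMixin H.

Lemma hahn0 : hahn (fun _ : M => 0 : R).
Proof. by apply: well_based_sub (well_based1 1%g) => m; rewrite /supp /= eqxx. Qed.

Lemma hahn_opp (f : M -> R) : hahn f -> hahn (\- f).
Proof. by apply: well_based_sub => m; rewrite /supp /= oppr_eq0. Qed.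

Definition hs0 : H := mkHS hahn0.
Definition hsopp f : H := mkHS (hahn_opp (hvP f)).
Definition hsadd f g : H := mkHS (hahn_add (hvP f) (hvP g)).

Fact hsaddA : associative hsadd. Proof. by move=> f g h; apply: hsP => m /=; rewrite addrA. Qed.
Fact hsaddC : commutative hsadd. Proof. by move=> f g; apply: hsP => m /=; rewrite addrC. Qed.
Fact hsadd0 : left_id hs0 hsadd. Proof. by move=> f; apply: hsP => m /=; rewrite add0r. Qed.
Fact hsaddN : left_inverse hs0 hsopp hsadd.
Proof. by move=> f; apply: hsP => m /=; rewrite addNr. Qed.

HB.instance Definition _ := GRing.isZmodule.Build H hsaddA hsaddC hsadd0 hsaddN.

Definition tm (c : R) n : H := mkHS (hahn_term c n).
Definition hs1 : H := tm 1 1%g.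
Definition hsmul f g : H := mkHS (hahn_mul (hvP f) (hvP g)).

Lemma hs_rwo f : rwo (supp f). Proof. by case: (hvP f). Qed.
Arguments hs_rwo : clear implicits.

Fact hsmulC : commutative hsmul.
Proof.
move=> f g; apply: hsP => m /=.
have [s us hs] := fibre_ex m (hs_rwo f) (hs_rwo g).
rewrite (hmul_seq us); last by move=> a fa ga; apply/hs.
rewrite (@hmul_seq _ _ _ _ _ _ [seq (a^-1 * m)%g | a <- s]).
- by rewrite big_map; apply: eq_bigr => a _; rewrite invgM invgK mulrC [(m^-1 * a)%g]omulgC mulgVK.
- by rewrite map_inj_uniq // => a b /mulIg /invg_inj.
- move=> a ga fa; apply/mapP; exists (a^-1 * m)%g; last by rewrite invgM invgK -mulgA [(a * m)%g]omulgC mulKg.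
  by apply/hs; split => //; rewrite invgM invgK [(m^-1 * a)%g]omulgC mulgVK.
Qed.

Fact hsmul1 : left_id hs1 hsmul.
Proof. by move=> f; apply: hsP => m /=; rewrite hmul_term mul1r invg1 mul1g. Qed.

Fact hsmulDl : left_distributive hsmul hsadd.
Proof.
move=> f f' g; apply: hsP => m /=.
have [s us hs] := @finite_seq_uniq _ _ (mul_fibre_finite m (rwoU (hs_rwo f) (hs_rwo f')) (hs_rwo g)).
rewrite !(hmul_seq us).
- by rewrite -big_split /=; apply: eq_bigr => a _; rewrite mulrDl.
- by move=> a fa ga; apply/hs; split => //; right.
- by move=> a fa ga; apply/hs; split => //; left.
- by move=> a fa ga; apply/hs; split => //; apply: supp_add.
Qed.

Fact hsmulA : associative hsmul.
Proof.
move=> f g h; apply: hsP => m /=.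
have rfg := rwo_mul (hs_rwo f) (hs_rwo g); have rgh := rwo_mul (hs_rwo g) (hs_rwo h).
have [sb ub hb] := @finite_seq_uniq _ _ (mul_fibre_finite m rfg (hs_rwo h)).
have [sa ua ha] := @finite_seq_uniq _ _ (mul_fibre_finite m (hs_rwo f) rgh).
rewrite (@hmul_seq _ _ _ f _ _ sa) //; last first.
  by move=> a fa /supp_hmul ga; apply/ha.
rewrite (@hmul_seq _ _ _ _ h _ sb) //; last first.
  by move=> b /supp_hmul fb hb'; apply/hb.
(* Both sides are expanded over [sa], the possible first factors, and [sb], the possible products of
   the first two factors. *)
transitivity (\sum_(a <- sa) \sum_(b <- sb) f a * g (a^-1 * b)%g * h (b^-1 * m)%g).
  rewrite big_seq [RHS]big_seq; apply: eq_bigr => a /ha[fa _].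
  rewrite (@hmul_seq _ _ _ _ _ _ [seq (a^-1 * b)%g | b <- sb]).
  - rewrite big_map mulr_sumr; apply: eq_bigr => b _.
    by rewrite mulrA invgM invgK -mulgA mulVKg.
  - by rewrite map_inj_uniq // => b c /mulgI.
  - move=> c gc hc; apply/mapP; exists (a * c)%g; last by rewrite mulKg.
    apply/hb; split; first by exists a, c.
    by rewrite invgM -mulgA.
rewrite exchange_big /= big_seq [RHS]big_seq; apply: eq_bigr => b /hb[_ hb'].
rewrite (@hmul_seq _ _ _ _ _ _ sa) //; first by rewrite mulr_suml.
move=> a fa gb; apply/ha; split => //.
by exists (a^-1 * b)%g, (b^-1 * m)%g; split => //; rewrite -mulgA mulVKg.
Qed.

Fact hs1_neq0 : hs1 != 0 :> H.
Proof.
apply/eqP => /(congr1 (fun f : H => f 1%g)) /=; rewrite /term eqxx.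
by apply/eqP; apply: oner_neq0.
Qed.

HB.instance Definition _ := GRing.Zmodule_isComNzRing.Build H
  hsmulA hsmulC hsmul1 hsmulDl hs1_neq0.

Definition kst (c : R) : H := tm c 1%g.
Definition mn (m : M) : H := tm 1 m.

Lemma hvD f g m : (f + g) m = f m + g m. Proof. by []. Qed.
Lemma hvB f g m : (f - g) m = f m - g m. Proof. by []. Qed.
Lemma hv0 m : (0 : H) m = 0. Proof. by []. Qed.
Lemma hvsum I (r : seq I) (P : pred I) (F : I -> H) m :
  (\sum_(i <- r | P i) F i) m = \sum_(i <- r | P i) F i m.
Proof. exact: (big_morph (fun f : H => f m)). Qed.
Lemma hv_tm c n m : tm c n m = if m == n then c else 0. Proof. by []. Qed.
Lemma hv_tmM c n f m : (tm c n * f) m = c * f (n^-1 * m)%g.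
Proof. exact: hmul_term. Qed.
Lemma hv_kstM c f m : (kst c * f) m = c * f m.
Proof. by rewrite hv_tmM invg1 mul1g. Qed.

Lemma hv_exp f k : hv (f ^+ k) = hpow f k.
Proof. by elim: k => [//|k IH]; rewrite exprS /= IH. Qed.

Fact kst_is_zmod : zmod_morphism kst.
Proof. by move=> a b; apply: hsP => m; rewrite hvB !hv_tm; case: eqP => // _; rewrite subr0. Qed.
Fact kst_is_monoid : monoid_morphism kst.
Proof.
split=> // a b; apply: hsP => m; rewrite hv_kstM !hv_tm; case: eqP => // _.
by rewrite mulr0.
Qed.
HB.instance Definition _ := GRing.isZmodMorphism.Build R H kst kst_is_zmod.
HB.instance Definition _ := GRing.isMonoidMorphism.Build R H kst kst_is_monoid.

Lemma mnM m n : mn (m * n)%g = mn m * mn n.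
Proof.
apply: hsP => p; rewrite hv_tmM !hv_tm mul1r.
by rewrite -(inj_eq (@mulgI _ m) _ n) mulVKg.
Qed.

Lemma mn1 : mn 1%g = 1. Proof. by []. Qed.

Lemma tmE c n : tm c n = kst c * mn n.
Proof. by apply: hsP => m; rewrite hv_kstM !hv_tm; case: eqP => _; rewrite ?mulr1 ?mulr0. Qed.

Lemma kst_inj : injective kst.
Proof. by move=> a b /(congr1 (fun f : H => f 1%g)); rewrite !hv_tm eqxx. Qed.

Lemma mn_inj : injective mn.
Proof.
move=> a b /(congr1 (fun f : H => f a)); rewrite !hv_tm eqxx.
by case: eqP => // _ /eqP; rewrite oner_eq0.
Qed.

Definition inS (P : set M) f : Prop := forall m, supp f m -> P m.

Lemma inS_sub (P Q : set M) f : P `<=` Q -> inS P f -> inS Q f.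
Proof. by move=> PQ h m /h/PQ. Qed.
Lemma inS0 P : inS P 0. Proof. by move=> m; rewrite /supp /= eqxx. Qed.
Lemma inSD P f g : inS P f -> inS P g -> inS P (f + g).
Proof. by move=> hf hg m /supp_add[/hf|/hg]. Qed.
Lemma inSN P f : inS P f -> inS P (- f).
Proof. by move=> hf m; rewrite /supp /= oppr_eq0; apply: hf. Qed.
Lemma inSB P f g : inS P f -> inS P g -> inS P (f - g).
Proof. by move=> hf hg; apply: inSD => //; apply: inSN. Qed.
Lemma inSM (P Q S : set M) f g : (forall a b, P a -> Q b -> S (a * b)%g) ->
  inS P f -> inS Q g -> inS S (f * g).
Proof. by move=> PQ hf hg m /supp_hmul[a [b [/hf Pa /hg Qb ->]]]; apply: PQ. Qed.
Lemma inS_tm (P : set M) c m : P m -> inS P (tm c m).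
Proof. by move=> Pm n /supp_term ->. Qed.
Lemma inS_kst (P : set M) c : P 1%g -> inS P (kst c).
Proof. exact: inS_tm. Qed.
Lemma inSZ P c f : inS P f -> inS P (kst c * f).
Proof. by move=> hf m; rewrite /supp /= hmul_term invg1 mul1g mulf_eq0 negb_or => /andP[_ /hf]. Qed.
Lemma inS_supp f : inS (supp f) f. Proof. by []. Qed.
Lemma inSX f k : inS (powset (supp f) k) (f ^+ k).
Proof.
elim: k => [|k IH]; first exact: inS_tm.
by rewrite exprS; apply: (inSM _ (@inS_supp f) IH) => a b Pa Pb; exists a, b.
Qed.
Arguments inSX : clear implicits.
Lemma inSXP (P : set M) f k : P 1%g -> (forall a b, P a -> P b -> P (a * b)%g) ->
  inS P f -> inS P (f ^+ k).
Proof. by move=> P1 PM hf; apply: (inS_sub _ (inSX f k)); apply: powset_sub. Qed.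
Lemma inS_sum P I (r : seq I) (Q : pred I) (F : I -> H) :
  (forall i, Q i -> inS P (F i)) -> inS P (\sum_(i <- r | Q i) F i).
Proof.
move=> hF; elim/big_ind: _ => //; [exact: inS0|by move=> *; apply: inSD].
Qed.

Lemma inS_set0 f : inS set0 f -> f = 0.
Proof. by move=> h; apply: hsP => m; apply: contrapT => fm; apply: (h m); apply/eqP. Qed.

Definition restr (P : set M) f : M -> R := fun m => if `[< P m >] then f m else 0.

Lemma hahn_restr P f : hahn (restr P f).
Proof.
by apply: well_based_sub (hvP f) => m; rewrite /supp /= /restr; case: ifP => // _; rewrite eqxx.
Qed.

Definition rst P f : H := mkHS (hahn_restr P f).

Lemma hv_rst P f m : rst P f m = if `[< P m >] then f m else 0. Proof. by []. Qed.
Lemma inS_rst P f : inS P (rst P f).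
Proof. by move=> m; rewrite /supp /= /restr; case: asboolP => // _; rewrite eqxx. Qed.
Lemma inS_rst2 P Q f : inS Q f -> inS Q (rst P f).
Proof. by move=> hf m; rewrite /supp /= /restr; case: asboolP => [_ /hf//|_]; rewrite eqxx. Qed.
Lemma rst_split P f : f = rst P f + rst (~` P) f.
Proof.
apply: hsP => m; rewrite hvD !hv_rst; case: asboolP => h; case: asboolP => h' //.
- by rewrite addr0.
- by rewrite add0r.
Qed.
End HSring.
Arguments hs_rwo {d R M} f.
Arguments inSX {d R M} f k.

(** * Summable families and strong linearity *)

Section Summation.
Context {d : Order.disp_t} {R : realType} {M : oabGroupType d}.
Local Notation H := (HS R M).
Implicit Types (f g h : H) (m n a b : M).

Definition ssummable {I : choiceType} (F : I -> H) := summable_family (fun i => hv (F i)).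

Lemma hahn_hsum {I : choiceType} (F : I -> M -> R) : summable_family F -> hahn (hsum F).
Proof.
move=> [wF _]; apply: well_based_sub wF => m; apply: contraPP => nm.
by rewrite /supp /= /hsum (@fsum_seq _ _ _ [::]) ?big_nil ?eqxx // => i _; apply: not_supp => Fi; apply: nm; exists i.
Qed.

(** The default value 0 has its support in every set, so [inS_sumI] holds without a summability
    condition. *)
Definition ssum_def {I : choiceType} (F : I -> H) : H :=
  if pselect (ssummable F) is left s then mkHS (hahn_hsum s) else 0.

(* Here and below, definitions are sealed so that a failing comparison of two
   series does not unfold them. *)
Fact ssum_sealed (I : choiceType) : {s : (I -> H) -> H | s = @ssum_def I}. Proof. by exists ssum_def. Qed.
Definition ssum {I : choiceType} : (I -> H) -> H := sval (ssum_sealed I).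
Fact ssumE {I : choiceType} (F : I -> H) : ssum F = ssum_def F.
Proof. by rewrite /ssum (svalP (ssum_sealed I)). Qed.

Section One.
Context {I : choiceType}.
Implicit Types F G : I -> H.

Lemma hv_sum F : ssummable F -> hv (ssum F) = hsum (fun i => hv (F i)).
Proof. by rewrite ssumE /ssum_def; case: pselect. Qed.

Lemma sum_seq F m (s : seq I) : ssummable F -> uniq s ->
  (forall i, supp (F i) m -> i \in s) -> ssum F m = \sum_(i <- s) F i m.
Proof.
move=> sF us hs; rewrite hv_sum //; apply: fsum_seq => // i; apply: contraNeq.
exact: hs.
Qed.

Lemma summable_seq F m : ssummable F ->
  exists2 s : seq I, uniq s & forall i, i \in s <-> supp (F i) m.
Proof. by move=> [_ /(_ m) fin]; apply: finite_seq_uniq. Qed.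

Lemma inS_sumI P F : (forall i, inS P (F i)) -> inS P (ssum F).
Proof.
move=> hF m; have [sF|nF] := pselect (ssummable F); last first.
  by rewrite ssumE /ssum_def; case: pselect => // _; apply: inS0.
have [[|i s] us hs] := summable_seq m sF; last by move=> _; apply: (hF i); apply/hs; rewrite mem_head.
by rewrite /supp /= (@sum_seq _ _ [::]) ?big_nil ?eqxx // => j /hs.
Qed.

Lemma summable_sub F (A : set M) : well_based A -> (forall i, inS A (F i)) ->
  (forall m, finite_set [set i | supp (F i) m]) -> ssummable F.
Proof. by move=> wA FA fin; split => //; apply: well_based_sub wA => m [i _ /FA]. Qed.

Lemma summableD F G : ssummable F -> ssummable G -> ssummable (fun i => F i + G i).
Proof.
move=> [wF fF] [wG fG]; apply: (summable_sub (well_basedU wF wG)).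
  by move=> i m /supp_add[?|?]; [left|right]; exists i.
move=> m; apply: (@sub_finite_set _ _ ([set i | supp (F i) m] `|` [set i | supp (G i) m])).
  by move=> i /supp_add.
by rewrite finite_setU; split; [apply: fF|apply: fG].
Qed.

Lemma sumD F G : ssummable F -> ssummable G -> ssum (fun i => F i + G i) = ssum F + ssum G.
Proof.
move=> sF sG; apply: hsP => m; rewrite hvD.
have [_ fF] := sF; have [_ fG] := sG.
have fU : finite_set ([set i | supp (F i) m] `|` [set i | supp (G i) m]).
  by rewrite finite_setU; split; [apply: fF|apply: fG].
have [s us hs] := finite_seq_uniq fU.
rewrite !(@sum_seq _ m s) //.
- by rewrite -big_split.
- by move=> i Gi; apply/hs; right.
- by move=> i Gi; apply/hs; left.
- exact: summableD.
- by move=> i /supp_add h; apply/hs.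
Qed.

Lemma summableM h F : ssummable F -> ssummable (fun i => h * F i).
Proof.
move=> sF; have [wF fF] := sF.
apply: (summable_sub (well_based_mul (hvP h) wF)).
  by move=> i m /supp_hmul[a [b [ha Fb ->]]]; exists a, b; split => //; exists i.
move=> m.
apply: (@sub_finite_set _ _ (\bigcup_(a in [set a | supp h a /\ (\bigcup_i supp (F i)) (a^-1 * m)%g])
    [set i | supp (F i) (a^-1 * m)%g])).
  move=> i /supp_hmul[a [b [ha Fb ->]]]; exists a; rewrite /= mulKg //.
  by split => //; exists i.
by apply: bigcup_finite => //; apply: mul_fibre_finite; [apply: hs_rwo|case: wF].
Qed.

Lemma sumM h F : ssummable F -> ssum (fun i => h * F i) = h * ssum F.
Proof.
move=> sF; apply: hsP => m; have [[_ rF] fF] := sF.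
have [s us hs] := @finite_seq_uniq _ _ (mul_fibre_finite m (hs_rwo h) rF).
have fin : finite_set (\bigcup_(a in [set` s]) [set i | supp (F i) (a^-1 * m)%g]).
  by apply: bigcup_finite => // ; apply: finite_seq.
have [t ut ht] := finite_seq_uniq fin.
rewrite (@sum_seq _ _ t) //; last 2 first.
- exact: summableM.
- move=> i /supp_hmul[a [b [ha Fb E]]]; have Em : (a^-1 * m)%g = b by rewrite E mulKg.
  apply/ht; exists a; last by rewrite /= Em.
  by apply/hs; split => //; rewrite Em; exists i.
have E i : (h * F i) m = \sum_(a <- s) h a * F i (a^-1 * m)%g.
  by apply: hmul_seq => // a ha Fa; apply/hs; split => //; exists i.
under eq_bigr => i _ do rewrite E.
rewrite exchange_big /= -[RHS]/(hmul h (ssum F) m) (@hmul_seq _ _ _ _ _ _ s) //; last first.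
  by move=> a ha Fa; apply/hs; split => //; apply: (inS_sumI (P := \bigcup_i supp (F i))) Fa => i x Fx; exists i.
rewrite big_seq [RHS]big_seq; apply: eq_bigr => a sa.
rewrite (@sum_seq _ _ t) ?mulr_sumr // => i Fi.
by apply/ht; exists a.
Qed.

Lemma sum_fin F (s : seq I) : uniq s -> (forall i, i \notin s -> F i = 0) ->
  ssummable F /\ ssum F = \sum_(i <- s) F i.
Proof.
move=> us hs; have sF : ssummable F.
  apply: (@summable_sub _ (\bigcup_(i in [set` s]) supp (F i))).
  - elim: s {us hs} => [|i s IH].
      by apply: well_based_sub (well_based1 1%g) => m [].
    apply: well_based_sub (well_basedU (hvP (F i)) IH) => m [j /=].
    by rewrite inE => /orP[/eqP->|js] Fj; [left|right; exists j].
  - move=> i m Fi; exists i => //=; apply: contrapT => /negP /hs Fi0.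
    by move: Fi; rewrite Fi0; apply: (@inS0 _ R M set0).
  - move=> m; apply: (@sub_finite_set _ _ [set` s]); last exact: finite_seq.
    move=> i Fi /=; apply: contrapT => /negP /hs Fi0.
    by move: Fi; rewrite /= Fi0; apply: (@inS0 _ R M set0).
split => //; apply: hsP => m; rewrite hvsum; apply: sum_seq => // i Fi.
apply: contrapT => /negP /hs Fi0.
by move: Fi; rewrite Fi0; apply: (@inS0 _ R M set0).
Qed.

Lemma sum1 F i : (forall j, j != i -> F j = 0) -> ssummable F /\ ssum F = F i.
Proof.
move=> h; rewrite -[F i](@big_seq1 _ 0 +%R _ i F); apply: sum_fin => // j.
by rewrite mem_seq1 => /h.
Qed.

Lemma eq_sum F G : (forall i, F i = G i) -> ssum F = ssum G.
Proof. by move=> FG; congr ssum; apply/funext. Qed.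

Lemma sumB F G : ssummable F -> ssummable G -> ssum (fun i => F i - G i) = ssum F - ssum G.
Proof.
move=> sF sG.
have sN : ssummable (fun i => -1 * G i) by apply: summableM.
rewrite -mulN1r -sumM // -sumD //.
by apply: eq_sum => i; rewrite mulN1r.
Qed.

Lemma summableB F G : ssummable F -> ssummable G -> ssummable (fun i => F i - G i).
Proof.
move=> sF sG; have := summableD sF (summableM (- 1) sG).
by congr ssummable; apply/funext => i; rewrite mulN1r.
Qed.

End One.

Lemma summable_mn f : ssummable (fun m => kst (f m) * mn m).
Proof.
have sub m : inS [set m] (kst (f m) * mn m) by rewrite -tmE; apply: inS_tm.
apply: (summable_sub (hvP f)) => [i m|m].
  move=> h; have := sub _ _ h => /= ->; move: h; rewrite -tmE /supp /= /term.
  by case: (m =P i) => // _; rewrite eqxx.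
apply: (@sub_finite_set _ _ [set m]); last exact: finite_set1.
by move=> n h; exact: esym (sub n m h).
Qed.

Lemma sum_mn f : f = ssum (fun m => kst (f m) * mn m).
Proof.
apply: hsP => m; rewrite (@sum_seq _ _ _ [:: m]) //; last 2 first.
- exact: summable_mn.
- by move=> i; rewrite -tmE => /supp_term ->; rewrite mem_head.
by rewrite big_seq1 -tmE hv_tm eqxx.
Qed.

(** Each coefficient of either side is the same finite double sum, taken over the two projections of
    the finite set of pairs that contribute to the monomial. *)
Lemma exch_sum {I J : choiceType} (F : I -> J -> H) (A : set M) : well_based A ->
  (forall i j, inS A (F i j)) ->
  (forall m, finite_set [set p : I * J | supp (F p.1 p.2) m]) ->
  [/\ forall i, ssummable (F i), ssummable (fun i => ssum (F i)) &
    ssum (fun i => ssum (F i)) = ssum (fun j => ssum (F ^~ j))].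
Proof.
move=> wA FA fin.
have fin1 i m : finite_set [set j | supp (F i j) m].
  have := finite_image snd (fin m); apply: sub_finite_set => j Fj.
  by exists (i, j).
have fin2 j m : finite_set [set i | supp (F i j) m].
  have := finite_image fst (fin m); apply: sub_finite_set => i Fi.
  by exists (i, j).
have s1 i : ssummable (F i) by apply: (summable_sub wA).
have s2 j : ssummable (F ^~ j) by apply: (summable_sub wA).
have nz1 i m : supp (ssum (F i)) m -> exists j, supp (F i j) m.
  apply: contraPP => /forallNP h; rewrite /supp /= (@sum_seq _ _ _ [::]) ?big_nil ?eqxx //.
  by move=> j /h.
have nz2 j m : supp (ssum (F ^~ j)) m -> exists i, supp (F i j) m.
  apply: contraPP => /forallNP h; rewrite /supp /= (@sum_seq _ _ _ [::]) ?big_nil ?eqxx //.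
  by move=> i /h.
have s3 : ssummable (fun i => ssum (F i)).
  apply: (summable_sub wA) => [i|m]; first exact: inS_sumI.
  have := finite_image fst (fin m); apply: sub_finite_set => i /nz1[j Fij].
  by exists (i, j).
have s4 : ssummable (fun j => ssum (F ^~ j)).
  apply: (summable_sub wA) => [j|m]; first exact: inS_sumI.
  have := finite_image snd (fin m); apply: sub_finite_set => j /nz2[i Fij].
  by exists (i, j).
split => //; apply: hsP => m.
have [s us hs] := finite_seq_uniq (finite_image fst (fin m)).
have [t ut ht] := finite_seq_uniq (finite_image snd (fin m)).
have ms i j : supp (F i j) m -> i \in s by move=> h; apply/hs; exists (i, j).
have mt i j : supp (F i j) m -> j \in t by move=> h; apply/ht; exists (i, j).
rewrite (@sum_seq _ _ _ s) //; last by move=> i /nz1[j /ms].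
rewrite (@sum_seq _ _ _ t) //; last by move=> i /nz2[j /mt].
transitivity (\sum_(i <- s) \sum_(j <- t) F i j m).
  by apply: eq_bigr => i _; apply: sum_seq => // j /mt.
rewrite exchange_big /=; apply: eq_bigr => j _.
by rewrite (@sum_seq _ _ _ s) // => i /ms.
Qed.

End Summation.

(** * The formal identity exp(log(1 + X)) = 1 + X *)

Section FormalExpLog.
Context {R : realType}.

Definition expc (k : nat) : R := k`!%:R^-1.
Definition lnc (k : nat) : R := if k is k'.+1 then (-1) ^+ k' / k'.+1%:R else 0.

(* The truncations F of exp(log(1 + X)) satisfy (1 + X) F' = F modulo X^n. *)
Lemma exp_ln_poly n : let L := \poly_(k < n.+1) lnc k in
  let F : {poly R} := \sum_(k < n.+1) expc k *: L ^+ k in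
  forall i, (i < n.+1)%N -> F`_i = (i < 2)%:R.
Proof.
move=> L F.
have dL : L^`() = \sum_(i < n) (- 'X) ^+ i.
  apply/polyP => i; rewrite coef_deriv coef_poly coef_sum ltnS.
  have E (j : 'I_n) : ((- 'X) ^+ j : {poly R})`_i = if j == i :> nat then (-1) ^+ i else 0.
    have -> : (- 'X : {poly R}) ^+ j = ((-1) ^+ j)%:P * 'X^j by rewrite rmorphXn rmorphN1 [(- 'X : {poly R}) ^+ j]exprNn.
    rewrite coefCM coefXn eq_sym.
    by case: eqP => [->|_]; rewrite ?mulr1 ?mulr0.
  under eq_bigr => j _ do rewrite E.
  case: ltnP => hi.
    rewrite -big_mkcond (big_pred1 (Ordinal hi)) => [|j]; last by [].
    by rewrite -mulr_natr divfK // pnatr_eq0.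
  by rewrite mul0rn big1 // => j _; case: eqP => // ji; have := ltn_ord j; rewrite ji ltnNge hi.
have hL : (1 + 'X) * L^`() = 1 - (- 'X) ^+ n.
  by rewrite dL -[RHS]opprB subrX1 -mulNr opprB opprK.
have L0 : exists L1, L = 'X * L1.
  have /factor_theorem[q hq] : root L 0 by rewrite /root horner_coef0 coef_poly.
  by exists q; rewrite hq polyC0 subr0 mulrC.
have dF : F^`() = L^`() * (F - expc n *: L ^+ n).
  rewrite {2}/F big_ord_recr /= addrK /F big_ord_recl /= expr0 derivD derivZ -polyC1 derivC scaler0 add0r.
  rewrite raddf_sum /= mulr_sumr; apply: eq_bigr => k _.
  rewrite derivZ deriv_exp /= -scaler_nat scalerA -scalerAr; congr (_ *: _).
  by rewrite /expc /bump /= add1n factS natrM invfM mulrAC mulVf ?mul1r // pnatr_eq0.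
have key : (1 + 'X) * F^`() = F - ((- 'X) ^+ n * F + (1 - (- 'X) ^+ n) * (expc n *: L ^+ n)).
  by rewrite dF mulrA hL; ring.
(* The error terms in [key] are divisible by X^n. Comparing lower coefficients gives (i + 1) F_(i+1)
   = (1 - i) F_i, so F_0 = 1 forces F_1 = 1 and the vanishing of the following ones. *)
have rec i : (i < n)%N -> F`_i.+1 *+ i.+1 + F`_i *+ i = F`_i.
  move=> hi; have := congr1 (fun p : {poly R} => p`_i) key.
  have -> : ((1 + 'X) * F^`())`_i = F`_i.+1 *+ i.+1 + F`_i *+ i.
    by rewrite mulrDl mul1r coefD coefXM !coef_deriv; case: (i).
  move=> ->; rewrite coefB coefD.
  have [L1 ->] := L0; rewrite exprMn scalerAr [_ * ('X^n * _)]mulrCA coefXnM hi.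
  by rewrite [(- 'X) ^+ n]exprNn -mulrA mulrCA coefXnM hi addr0 subr0.
have F0 : F`_0 = 1.
  rewrite /F coef_sum big_ord_recl /= big1 ?addr0 ?coefZ ?expr0 ?coefC /expc ?fact0 ?mulr1 ?invr1 //.
  move=> k _; have [L1 ->] := L0.
  by rewrite exprMn coefZ coefXnM /= mulr0.
elim=> [_|i IH hi]; first by rewrite F0.
have := rec i hi; rewrite (IH (ltnW hi)).
case: i {IH} hi => [|[|i]] hi /=; rewrite ?mulr1n ?mulr0n ?mul0rn ?addr0 //.
  by move=> /(canRL (addrK _)); rewrite subrr => /eqP; rewrite mulrn_eq0 /= => /eqP.
by move=> /eqP; rewrite mulrn_eq0 /= => /eqP.
Qed.

End FormalExpLog.

(** * Power series evaluated at infinitesimals *)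

Section PowerSeries.
Context {d : Order.disp_t} {R : realType} {M : oabGroupType d}.
Local Notation H := (HS R M).
Implicit Types (f g h : H) (m n a b : M) (c : nat -> R).

Lemma kstM (r s : R) : kst (r * s) = kst r * kst s :> H. Proof. exact: rmorphM. Qed.
Lemma kstD (r s : R) : kst (r + s) = kst r + kst s :> H. Proof. exact: rmorphD. Qed.
Lemma kstN (r : R) : kst (- r) = - kst r :> H. Proof. exact: rmorphN. Qed.
Lemma kst0 : kst 0 = 0 :> H. Proof. exact: rmorph0. Qed.
Lemma kst1 : kst 1 = 1 :> H. Proof. exact: rmorph1. Qed.
Lemma kst_nat k : kst k%:R = k%:R :> H. Proof. exact: rmorph_nat. Qed.

Definition Mlt1 : set M := [set m | (m < 1%g)%O].
Definition Mgt1 : set M := [set m | (1%g < m)%O].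

Definition ps_def c f : H := ssum (fun k => kst (c k) * f ^+ k).
Fact ps_sealed : {p : (nat -> R) -> H -> H | p = ps_def}. Proof. by exists ps_def. Qed.
Definition ps : (nat -> R) -> H -> H := sval ps_sealed.
Fact psE c f : ps c f = ssum (fun k => kst (c k) * f ^+ k).
Proof. by rewrite /ps (svalP ps_sealed). Qed.

Lemma powfrom_le (A : set M) k l : (k <= l)%N -> powfrom A l `<=` powfrom A k.
Proof. by move=> kl m [j lj Pj]; exists j => //; apply: leq_trans lj. Qed.

Lemma inS_powfromX (A : set M) f k : inS (powfrom A 1) f -> inS (powfrom A k) (f ^+ k).
Proof.
move=> hf; elim: k => [|k IH]; first by apply: inS_tm; exists 0%N.
by rewrite exprS; apply: inSM hf IH => a b; apply: powfrom_mul.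
Qed.

Lemma inS_powfrom_supp f : inS (powfrom (supp f) 1) f.
Proof.
by move=> m fm; exists 1%N => //; exists m, 1%g; rewrite mulg1.
Qed.

(** The two halves of summability are [neumann] and [neumann_finite] for the support of [f]. *)
Lemma ps_summable c f : inS Mlt1 f -> ssummable (fun k => kst (c k) * f ^+ k).
Proof.
move=> hf; have [sf rf] := hvP f.
apply: (@summable_sub _ _ _ _ _ (powfrom (supp f) 0)).
- by split; [apply: small_powfrom|apply: neumann].
- by move=> k; apply: inSZ => m fm; exists k => //; apply: inSX.
- move=> m; have [N hN] := neumann_finite m rf hf.
  apply: (@sub_finite_set _ _ `I_N); last exact: finite_II.
  move=> k hk; rewrite /= ltnNge; apply/negP => Nk; apply: (hN k Nk).
  exact: (inSZ (inSX f k)) hk.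
Qed.

Lemma ps_trunc c f N (A : set M) : inS Mlt1 f -> inS (powfrom A 1) f ->
  inS (powfrom A N) (ps c f - \sum_(k < N) kst (c k) * f ^+ k).
Proof.
move=> f1 fA; pose G k := if (k < N)%N then kst (c k) * f ^+ k else 0.
have [|sG EG] := @sum_fin _ _ _ _ G (iota 0 N) (iota_uniq 0 N).
  by move=> k; rewrite mem_iota /= add0n /G => /negPf ->.
have -> : \sum_(k < N) kst (c k) * f ^+ k = ssum G.
  rewrite EG -[X in iota 0 X]subn0 -/(index_iota 0 N) big_mkord; apply: eq_bigr => k _.
  by rewrite /G ltn_ord.
rewrite psE -sumB //; last exact: ps_summable.
apply: inS_sumI => k; rewrite /G; case: ltnP => hk; first by rewrite subrr; apply: inS0.
rewrite subr0; apply: inSZ; apply: (inS_sub (powfrom_le hk)).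
exact: inS_powfromX.
Qed.

Arguments ps_trunc : clear implicits.
Lemma inS_powfrom_eq0 (A : set M) f : rwo A -> A `<=` Mlt1 ->
  (forall N, inS (powfrom A N) f) -> f = 0.
Proof.
move=> rA A1 h; apply: inS_set0 => m fm; have [N hN] := neumann_finite m rA A1.
by have [k /hN] := h N m fm.
Qed.

(** By [neumann_finite] no monomial lies in [powfrom A N] for all N. Identities between power series
    thus reduce to identities between their truncations. *)
Lemma powfrom_eq (A : set M) f g : rwo A -> A `<=` Mlt1 ->
  (forall N, inS (powfrom A N) (f - g)) -> f = g.
Proof. by move=> rA A1 h; apply/eqP; rewrite -subr_eq0; apply/eqP; apply: (@inS_powfrom_eq0 A). Qed.

Lemma inS_ps (P : set M) c f : P 1%g -> (forall a b, P a -> P b -> P (a * b)%g) ->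
  inS P f -> inS P (ps c f).
Proof. by move=> P1 PM hf; rewrite psE; apply: inS_sumI => k; apply: inSZ; apply: inSXP. Qed.

Lemma inS_ps0 (P : set M) c f : c 0%N = 0 -> (forall a b, P a -> P b -> P (a * b)%g) ->
  inS P f -> inS P (ps c f).
Proof.
move=> c0 PM hf; rewrite psE; apply: inS_sumI => -[|k]; first by rewrite c0 rmorph0 mul0r; apply: inS0.
apply: inSZ; elim: k => [|k IH]; first by rewrite expr1.
by rewrite exprS; apply: inSM hf IH.
Qed.

Lemma inS_lt1_ps c f : c 0%N = 0 -> inS Mlt1 f -> inS Mlt1 (ps c f).
Proof.
move=> c0; apply: inS_ps0 => // a b a1 b1; rewrite /Mlt1 /= -[ltRHS]mulg1.
by apply: ltmM => //; apply: ltW.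
Qed.

Lemma cong_mul (A : set M) N f f' g g' : inS (powfrom A 0) f -> inS (powfrom A 0) g' ->
  inS (powfrom A N) (f - f') -> inS (powfrom A N) (g - g') -> inS (powfrom A N) (f * g - f' * g').
Proof.
move=> hf hg hff hgg; have -> : f * g - f' * g' = f * (g - g') + (f - f') * g' by ring.
apply: inSD; [apply: inSM hf hgg|apply: inSM hff hg] => a b Pa Pb.
  by rewrite -[N]add0n; apply: powfrom_mul.
by rewrite -[N]addn0; apply: powfrom_mul.
Qed.

Lemma inS_powfrom0_ps (A : set M) c f : inS (powfrom A 0) f -> inS (powfrom A 0) (ps c f).
Proof.
apply: inS_ps; first by exists 0%N.
by move=> a b; apply: powfrom_mul.
Qed.

Lemma ps_exp0 : ps expc (0 : H) = 1.
Proof.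
have [|_] := @sum1 _ _ _ _ (fun k => kst (expc k : R) * (0 : H) ^+ k) 0%N.
  by move=> [//|k] _; rewrite exprS mul0r mulr0.
by rewrite psE => ->; rewrite expr0 mulr1 /expc fact0 invr1 rmorph1.
Qed.

Lemma ps_expD f g : inS Mlt1 f -> inS Mlt1 g -> ps expc (f + g) = ps expc f * ps expc g.
Proof.
move=> hf hg; pose A := supp f `|` supp g.
have A1 : A `<=` Mlt1 by move=> m [/hf|/hg].
have rA : rwo A by apply: rwoU; apply: hs_rwo.
have Af : inS (powfrom A 1) f by move=> m fm; exists 1%N => //; exists m, 1%g; rewrite mulg1; split => //; left.
have Ag : inS (powfrom A 1) g by move=> m fm; exists 1%N => //; exists m, 1%g; rewrite mulg1; split => //; right.
apply: (powfrom_eq rA A1) => N.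
have hfg := ps_trunc expc _ N A (inSD hf hg) (inSD Af Ag).
have up u : inS (powfrom A 1) u -> inS (powfrom A 0) u by apply: inS_sub; apply: powfrom_le.
(* The auxiliary variable, evaluated at 1, keeps track of degrees: the coefficients of [p * q] below
   N are the binomial expansions of (f + g)^k / k!, and the others have support in [powfrom A N]. *)
pose p : {poly H} := \poly_(k < N) (kst (expc k) * f ^+ k).
pose q : {poly H} := \poly_(k < N) (kst (expc k) * g ^+ k).
have hp : p.[1] = \sum_(k < N) kst (expc k) * f ^+ k.
  by rewrite horner_poly; apply: eq_bigr => k _; rewrite expr1n mulr1.
have hq : q.[1] = \sum_(k < N) kst (expc k) * g ^+ k.
  by rewrite horner_poly; apply: eq_bigr => k _; rewrite expr1n mulr1.
have h1 : inS (powfrom A N) (ps expc f * ps expc g - p.[1] * q.[1]).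
  apply: cong_mul; rewrite ?hp ?hq; try exact: ps_trunc.
  - by apply: inS_powfrom0_ps; apply: up.
  - apply: inS_sum => k _; apply: inSZ; apply: (inS_sub (powfrom_le (leq0n k))); exact: inS_powfromX.
have h2 : inS (powfrom A N) (p.[1] * q.[1] - \sum_(k < N) kst (expc k) * (f + g) ^+ k).
  rewrite -hornerM (@horner_coef_wide _ (N + N)); last first.
    by apply: leq_trans (size_polyMleq _ _) _; apply: leq_trans (leq_pred _) _; apply: leq_add; apply: size_poly.
  rewrite big_split_ord /= addrAC; apply: inSD.
    rewrite [X in X - _](_ : _ = \sum_(k < N) kst (expc k) * (f + g) ^+ k) ?subrr; first exact: inS0.
    apply: eq_bigr => k _; rewrite expr1n mulr1 coefM exprDn mulr_sumr [LHS](reindex_inj rev_ord_inj) /=.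
    apply: eq_bigr => i _; rewrite subSS !coef_poly.
    have ik : (i <= k)%N by rewrite -ltnS.
    rewrite subKn // !ifT; last 2 first.
    - exact: leq_ltn_trans ik _.
    - exact: leq_ltn_trans (leq_subr _ _) _.
    rewrite mulrACA -kstM -[in RHS]mulr_natr [RHS]mulrA [RHS]mulrAC -kst_nat -kstM; congr (kst _ * _).
    rewrite /expc -(bin_fact ik) !natrM !invfM.
    have /lt0r_neq0 b0 : (0 : R) < 'C(k, i)%:R by rewrite ltr0n bin_gt0.
    by rewrite mulrAC mulVf // mul1r mulrC.
  apply: inS_sum => k _; rewrite expr1n mulr1 coefM; apply: inS_sum => i _.
  apply: (inS_sub (@powfrom_le A N (i + (N + k - i)) _)).
    by rewrite subnKC ?leq_addr // -ltnS.
  rewrite !coef_poly; apply: (@inSM _ _ _ (powfrom A i) (powfrom A (N + k - i))).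
  - by move=> a b; apply: powfrom_mul.
  - by case: ifP => _; [apply: inSZ; apply: inS_powfromX|apply: inS0].
  - by case: ifP => _; [apply: inSZ; apply: inS_powfromX|apply: inS0].
rewrite -(subrKA (\sum_(k < N) kst (expc k) * (f + g) ^+ k)); apply: inSD => //.
by rewrite -opprB; apply: inSN; rewrite -(subrKA (p.[1] * q.[1])); apply: inSD.
Qed.

Lemma cong_pow (A : set M) N f f' k : inS (powfrom A 0) f -> inS (powfrom A 0) f' ->
  inS (powfrom A N) (f - f') -> inS (powfrom A N) (f ^+ k - f' ^+ k).
Proof.
move=> hf hf' h; elim: k => [|k IH]; first by rewrite subrr; apply: inS0.
rewrite !exprS; apply: cong_mul => //.
apply: inSXP => //; first by exists 0%N.
by move=> a b; apply: powfrom_mul.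
Qed.

(** The polynomial identity [exp_ln_poly] is mapped into [H] and evaluated at [f]; what remains of
    exp(log(1 + X)) - (1 + X) has degree above N. *)
Lemma ps_exp_ln f : inS Mlt1 f -> ps expc (ps lnc f) = 1 + f.
Proof.
move=> hf; pose A := supp f.
have rA : rwo A by apply: hs_rwo.
have Af : inS (powfrom A 1) f by apply: inS_powfrom_supp.
have L1 : inS Mlt1 (ps lnc f) by apply: inS_lt1_ps.
have AL : inS (powfrom A 1) (ps lnc f).
  by have := ps_trunc lnc _ 1%N A hf Af; rewrite big_ord1 rmorph0 mul0r subr0.
apply: (powfrom_eq rA hf) => N.
apply: (inS_sub (powfrom_le (leqnSn N))).
pose L := \poly_(k < N.+1) (lnc k : R).
pose F : {poly R} := \sum_(k < N.+1) expc k *: L ^+ k.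
have up k u : inS (powfrom A k) u -> inS (powfrom A 0) u by apply: inS_sub; apply: powfrom_le.
have EL : (map_poly kst L).[f] = \sum_(k < N.+1) kst (lnc k) * f ^+ k.
  rewrite (@horner_coef_wide _ N.+1) ?size_map_poly ?size_poly //.
  by apply: eq_bigr => k _; rewrite coef_map coef_poly ltn_ord.
have L0 : inS (powfrom A 0) (map_poly kst L).[f].
  by rewrite EL; apply: inS_sum => k _; apply: inSZ; apply: up; apply: inS_powfromX.
have hL : inS (powfrom A N.+1) (ps lnc f - (map_poly kst L).[f]) by rewrite EL; apply: ps_trunc.
have hE := ps_trunc expc _ N.+1 A L1 AL.
have EF : (map_poly kst F).[f] = \sum_(k < N.+1) kst (expc k) * (map_poly kst L).[f] ^+ k.
  rewrite rmorph_sum /= horner_sum; apply: eq_bigr => k _.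
  by rewrite linearZ /= hornerZ rmorphXn /= horner_exp.
have hF : inS (powfrom A N.+1) ((map_poly kst F).[f] - \sum_(k < N.+1) kst (expc k) * ps lnc f ^+ k).
  rewrite EF -sumrB; apply: inS_sum => k _; rewrite -mulrBr; apply: inSZ.
  by apply: cong_pow => //; [apply: up AL|rewrite -opprB; apply: inSN].
have h1 : inS (powfrom A N.+1) ((map_poly kst F).[f] - (1 + f)).
  have -> : 1 + f = (map_poly kst (1 + 'X)).[f].
    by rewrite rmorphD /= rmorph1 map_polyX hornerD hornerX hornerC.
  rewrite -hornerN -hornerD -rmorphB horner_coef; apply: inS_sum => k _.
  rewrite coef_map coefB coefD coef1 coefX.
  case: (ltnP k N.+1) => hk; last first.
    by apply: inSZ; apply: (inS_sub (powfrom_le hk)); apply: inS_powfromX.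
  rewrite exp_ln_poly //.
  have -> : ((k < 2)%:R - ((k == 0 :> nat)%:R + (k == 1 :> nat)%:R) : R) = 0.
    case: (nat_of_ord k) => [|[|j]]; rewrite ?eqxx ?ltnS ?ltn0 /=.
    - by rewrite addr0 subrr.
    - by rewrite add0r subrr.
    - by rewrite addr0 subr0.
  by rewrite /= kst0 mul0r; apply: inS0.
rewrite -(subrKA (\sum_(k < N.+1) kst (expc k) * ps lnc f ^+ k)); apply: inSD => //.
rewrite -(subrKA (map_poly kst F).[f]); apply: inSD => //.
by rewrite -opprB; apply: inSN.
Qed.

(** Factoring out one power matches [lnc], which starts at index 1, with the sum in [Log], whose
    index is lower by one. *)
Lemma ps_shift c f : inS Mlt1 f -> ps c f = kst (c 0%N) + f * ps (fun k => c k.+1) f.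
Proof.
move=> hf; have rA : rwo (supp f) by apply: hs_rwo.
have Af := @inS_powfrom_supp f.
apply: (powfrom_eq rA hf) => N; apply: (inS_sub (powfrom_le (leqnSn N))).
have h := ps_trunc c f N.+1 _ hf Af; have h' := ps_trunc (fun k => c k.+1) f N _ hf Af.
have {}h' : inS (powfrom (supp f) N.+1) (f * (ps (fun k => c k.+1) f - \sum_(k < N) kst (c k.+1) * f ^+ k)).
  by apply: inSM Af h' => a b; rewrite -add1n; apply: powfrom_mul.
move: h; rewrite big_ord_recl expr0 mulr1 /= => h.
have := inSB h h'; congr (inS _ _); rewrite mulrBr mulr_sumr.
have -> : \sum_(i < N) kst (c (bump 0 i)) * f ^+ bump 0 i = \sum_(i < N) f * (kst (c i.+1) * f ^+ i).
  by apply: eq_bigr => i _; rewrite /bump /= add1n exprS mulrCA.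
ring.
Qed.

Lemma ps_geom f : inS Mlt1 f -> (1 + f) * ps (fun k => (-1) ^+ k) f = 1.
Proof.
move=> hf; have rA : rwo (supp f) by apply: hs_rwo.
have Af := @inS_powfrom_supp f.
have up k u : inS (powfrom (supp f) k) u -> inS (powfrom (supp f) 0) u by apply: inS_sub; apply: powfrom_le.
apply: (powfrom_eq rA hf) => N.
pose G := \sum_(k < N) kst ((-1) ^+ k) * f ^+ k.
have E : (1 + f) * G = 1 - (- f) ^+ N.
  rewrite -[RHS]opprB subrX1 -mulNr opprB opprK; congr (_ * _).
  by apply: eq_bigr => k _; rewrite rmorphXn rmorphN1 [(- f) ^+ k]exprNn.
have -> : (1 + f) * ps (fun k => (-1) ^+ k) f - 1 =
  ((1 + f) * ps (fun k => (-1) ^+ k) f - (1 + f) * G) - (- f) ^+ N by rewrite E; ring.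
apply: inSB; last by apply: inS_powfromX; apply: inSN.
apply: cong_mul; rewrite ?subrr; try exact: inS0; try exact: ps_trunc.
- by apply: inSD; [apply: inS_tm; exists 0%N|apply: up Af].
- by apply: inS_sum => k _; apply: inSZ; apply: up; apply: inS_powfromX.
Qed.

End PowerSeries.
Arguments ps_trunc {d R M} c f N A.

(** * Leading terms, inverses and the order: the ordered field of series *)

Section Leading.
Context {d : Order.disp_t} {R : realType} {M : oabGroupType d}.
Local Notation H := (HS R M).
Implicit Types (f g h : H) (m n a b : M) (c r : R).

Definition lm f : M := leading_mono f.
Definition lc f : R := f (lm f).

Lemma is_lead_uniq (f : M -> R) m n : is_lead f m -> is_lead f n -> m = n.
Proof. by move=> [fm hm] [fn hn]; apply/le_anti; rewrite hm ?hn. Qed.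

Lemma lead_ex f : f != 0 -> exists m, is_lead f m.
Proof.
move=> f0; have [|m fm hm] := hs_rwo f _ (@subset_refl _ (supp f)); last by exists m.
by apply/set0P/eqP => E; case/eqP: f0; apply: inS_set0; rewrite -E.
Qed.

Lemma lmP f : f != 0 -> is_lead f (lm f).
Proof. by move=> /lead_ex[m hm]; apply: xgetPex; exists m. Qed.

Lemma lm_eq f m : is_lead f m -> lm f = m.
Proof. by move=> hm; apply: (is_lead_uniq _ hm); apply: xgetPex; exists m. Qed.

Lemma lc_neq0 f : f != 0 -> lc f != 0.
Proof. by move=> /lmP[]. Qed.

Lemma lm_max f m : supp f m -> (m <= lm f)%O.
Proof.
move=> fm; have [f0|/lmP[_]] := eqVneq f 0; last by apply.
by move: fm; rewrite f0 /supp /= eqxx.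
Qed.

Lemma supp_neq0 f m : supp f m -> f != 0.
Proof. by apply: contraPneq => ->; rewrite /supp /= eqxx. Qed.

Lemma gt_lm0 f m : (lm f < m)%O -> f m = 0.
Proof. by move=> h; apply: not_supp => /lm_max; rewrite leNgt h. Qed.

Lemma is_lead_tm c m : c != 0 -> is_lead (tm c m : H) m.
Proof.
by move=> c0; split => [|n /supp_term ->//]; rewrite /supp /= /term eqxx.
Qed.

Lemma lm_tm c m : c != 0 -> lm (tm c m : H) = m.
Proof. by move=> c0; apply: lm_eq; apply: is_lead_tm. Qed.

Lemma lc_tm c m : c != 0 -> lc (tm c m : H) = c.
Proof. by move=> c0; rewrite /lc lm_tm // hv_tm eqxx. Qed.

Lemma lm_mn m : lm (mn m : H) = m. Proof. by rewrite lm_tm // oner_neq0. Qed.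
Lemma lc_mn m : lc (mn m : H) = 1. Proof. by rewrite lc_tm // oner_neq0. Qed.
Lemma lm_kst c : c != 0 -> lm (kst c : H) = 1%g. Proof. exact: lm_tm. Qed.
Lemma lc_kst c : c != 0 -> lc (kst c : H) = c. Proof. exact: lc_tm. Qed.

Lemma hvM_lm f g : f != 0 -> g != 0 -> (f * g) (lm f * lm g)%g = lc f * lc g.
Proof.
move=> f0 g0; rewrite -[LHS]/(hmul f g _) (@hmul_seq _ _ _ _ _ _ [:: lm f]) //.
  by rewrite big_seq1 mulKg.
move=> a /lm_max fa /lm_max; rewrite -[leRHS]mul1g mulgA lemM2r -(mulVg a) lemM2l => ga.
by rewrite inE; apply/eqP/le_anti/andP.
Qed.

Lemma is_leadM f g : f != 0 -> g != 0 -> is_lead (f * g) (lm f * lm g)%g.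
Proof.
move=> f0 g0; split; first by change ((f * g) (lm f * lm g)%g != 0); rewrite hvM_lm // mulf_neq0 ?lc_neq0.
by move=> n /supp_hmul[a [b [/lm_max fa /lm_max gb ->]]]; apply: lemM.
Qed.

Lemma hs_mulf_eq0 f g : f != 0 -> g != 0 -> f * g != 0.
Proof. by move=> f0 g0; have [+ _] := is_leadM f0 g0; apply: supp_neq0. Qed.

Lemma lmM f g : f != 0 -> g != 0 -> lm (f * g) = (lm f * lm g)%g.
Proof. by move=> f0 g0; apply: lm_eq; apply: is_leadM. Qed.

Lemma lcM f g : f != 0 -> g != 0 -> lc (f * g) = lc f * lc g.
Proof. by move=> f0 g0; rewrite {1}/lc lmM // hvM_lm. Qed.

Lemma lmN f : lm (- f) = lm f.
Proof.
have [->|f0] := eqVneq f 0; first by rewrite oppr0.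
have [fm hm] := lmP f0; apply: lm_eq; split; first by rewrite /supp /= oppr_eq0.
by move=> n; rewrite /supp /= oppr_eq0; apply: hm.
Qed.

Lemma lcN f : lc (- f) = - lc f. Proof. by rewrite /lc lmN. Qed.

Definition eps f : H := tm (lc f)^-1 (lm f)^-1%g * f - 1.

Lemma eps_lt1 f : f != 0 -> inS Mlt1 (eps f).
Proof.
move=> f0 m; rewrite /supp /= hmul_term /term invgK; have [->|m1] := eqVneq m 1%g.
  by rewrite mulg1 mulVf ?subrr ?eqxx // lc_neq0.
rewrite subr0 mulf_eq0 negb_or => /andP[_ /lm_max]; rewrite -[leRHS]mulg1 lemM2l => h.
by rewrite /Mlt1 /= lt_neqAle m1.
Qed.

Lemma epsE f : f != 0 -> f = tm (lc f) (lm f) * (1 + eps f).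
Proof.
move=> f0; rewrite addrC subrK; apply: hsP => m; rewrite !hv_tmM.
by rewrite mulrA mulfV ?lc_neq0 // mul1r invgK mulVKg.
Qed.

Definition hsinv f : H :=
  if f == 0 then 0 else tm (lc f)^-1 (lm f)^-1%g * ps (fun k => (-1) ^+ k) (eps f).

Fact hsinv_sealed : {i : H -> H | i = hsinv}. Proof. by exists hsinv. Qed.
Definition hsinvs : H -> H := sval hsinv_sealed.
Fact hsinvsE : hsinvs = hsinv. Proof. exact: (svalP hsinv_sealed). Qed.

Fact hsmulVf f : f != 0 -> hsinvs f * f = 1.
Proof.
move=> f0; rewrite hsinvsE /hsinv (negPf f0) [X in _ * X = _](epsE f0) mulrACA.
rewrite [ps _ _ * _]mulrC ps_geom ?mulr1; last exact: eps_lt1.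
apply: hsP => m; rewrite hv_tmM !hv_tm invgK -[X in _ == X]mulg1 (inj_eq (@mulgI _ _)).
by case: eqP => _; rewrite ?mulr0 // mulVf // lc_neq0.
Qed.

Fact hsinv0 : hsinvs 0 = 0.
Proof. by rewrite hsinvsE /hsinv eqxx. Qed.

HB.instance Definition _ := GRing.ComNzRing_isField.Build H hsmulVf hsinv0.

Lemma inS_inv (P : set M) f : P 1%g -> (forall a b, P a -> P b -> P (a * b)%g) ->
  (forall a, P a -> P a^-1%g) -> inS P f -> inS P f^-1.
Proof.
move=> P1 PM PV hf; rewrite -[f^-1]/(hsinvs f) hsinvsE /hsinv.
have [f0|f0] := eqVneq f 0; first exact: inS0.
have hl : P (lm f) by apply: hf; case: (lmP f0).
have ht : inS P (tm (lc f)^-1 (lm f)^-1%g) by apply: inS_tm; apply: PV.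
apply: (inSM PM) => //; apply: inS_ps => //.
by apply: inSB; [apply: (inSM PM)|apply: inS_tm].
Qed.

Lemma inS_eps (P : set M) f : P 1%g -> (forall a b, P a -> P b -> P (a * b)%g) ->
  (forall a, P a -> P a^-1%g) -> inS P f -> inS P (eps f).
Proof.
move=> P1 PM PV hf; have [->|f0] := eqVneq f 0.
  by rewrite /eps mulr0 sub0r; apply: inSN; apply: inS_tm.
have Pl : P (lm f) by apply: hf; case: (lmP f0).
apply: inSB; last exact: inS_tm.
by apply: (inSM PM) hf; apply: inS_tm; apply: PV.
Qed.

Definition pos f : bool := `[< hpos f >].

Lemma hposE f : pos f = (f != 0) && (0 < lc f).
Proof.
apply/asboolP/andP => [[m hm fm]|[f0 hc]].
  by rewrite /lc (lm_eq hm); split => //; case: hm => + _; apply: supp_neq0.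
by exists (lm f) => //; apply: lmP.
Qed.

Definition hslt f g := pos (g - f).
Definition hsle f g := (f == g) || hslt f g.
Definition hsnorm f := if pos f then f else - f.

Lemma lead_lt1D f g : f != 0 -> (forall m, supp g m -> (m < lm f)%O) ->
  is_lead (f + g) (lm f) /\ lc (f + g) = lc f.
Proof.
move=> f0 hg; have g0 : g (lm f) = 0 by apply: not_supp => /hg; rewrite ltxx.
have E : (f + g) (lm f) = lc f by rewrite hvD g0 addr0.
have L : is_lead (f + g) (lm f).
  split; first by change ((f + g) (lm f) != 0); rewrite E lc_neq0.
  by move=> n /supp_add[/lm_max|/hg/ltW].
by split => //; rewrite {1}/lc (lm_eq L).
Qed.

Fact pos_add f g : pos f -> pos g -> pos (f + g).
Proof.
wlog h : f g / (lm g <= lm f)%O.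
  move=> hw pf pg; have [h|h] := leP (lm g) (lm f); first exact: hw.
  by rewrite addrC; apply: hw => //; apply: ltW.
rewrite !hposE => /andP[f0 cf] /andP[g0 cg].
move: h; rewrite le_eqVlt => /orP[/eqP E|h]; last first.
  have [|L ->] := @lead_lt1D f g f0; first by move=> m /lm_max /le_lt_trans; apply.
  by rewrite cf andbT; case: L => + _; apply: supp_neq0.
have E2 : (f + g) (lm f) = lc f + lc g by rewrite hvD /lc E.
have P2 : 0 < lc f + lc g by apply: addr_gt0.
have L : is_lead (f + g) (lm f).
  split; first by change ((f + g) (lm f) != 0); rewrite E2 lt0r_neq0.
  by move=> n /supp_add[/lm_max|/lm_max]; rewrite ?E.
by rewrite {1}/lc (lm_eq L) E2 P2 andbT; case: L => + _; apply: supp_neq0.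
Qed.

Fact pos_mul f g : pos f -> pos g -> pos (f * g).
Proof.
rewrite !hposE => /andP[f0 cf] /andP[g0 cg].
by rewrite lcM // mulr_gt0 // andbT hs_mulf_eq0.
Qed.

Fact posN f : pos f -> ~~ pos (- f).
Proof. by rewrite !hposE lcN oppr_gt0 negb_and -leNgt => /andP[_ /ltW ->]; rewrite orbT. Qed.

Fact pos_total f : f != 0 -> pos f || pos (- f).
Proof. by move=> f0; rewrite !hposE oppr_eq0 f0 lcN oppr_gt0 /= orbC -neq_lt lc_neq0. Qed.

Fact hslt0_add f g : hslt 0 f -> hslt 0 g -> hslt 0 (f + g).
Proof. by rewrite /hslt !subr0; apply: pos_add. Qed.
Fact hslt0_mul f g : hslt 0 f -> hslt 0 g -> hslt 0 (f * g).
Proof. by rewrite /hslt !subr0; apply: pos_mul. Qed.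
Fact hslt0_ngt0 f : hslt 0 f -> ~~ hslt f 0.
Proof. by rewrite /hslt subr0 sub0r; apply: posN. Qed.
Fact hssub_gt0 f g : hslt 0 (g - f) = hslt f g.
Proof. by rewrite /hslt subr0. Qed.
Fact hslt0_total f : f != 0 -> hslt 0 f || hslt f 0.
Proof. by rewrite /hslt subr0 sub0r; apply: pos_total. Qed.
Fact hsnormN f : hsnorm (- f) = hsnorm f.
Proof.
rewrite /hsnorm opprK; have [->|f0] := eqVneq f 0; first by rewrite oppr0 !if_same.
have := pos_total f0; case: (boolP (pos f)) => [pf _|_ /= ->//].
by rewrite (negPf (posN pf)).
Qed.
Fact hsge0_norm f : hsle 0 f -> hsnorm f = f.
Proof.
rewrite /hsle /hslt subr0 /hsnorm => /orP[/eqP <-|->//].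
by rewrite oppr0 if_same.
Qed.
Fact hsle_def f g : hsle f g = (f == g) || hslt f g. Proof. by []. Qed.

HB.instance Definition _ := Num.IntegralDomain_isLtReal.Build H
  hslt0_add hslt0_mul hslt0_ngt0 hssub_gt0 hslt0_total hsnormN hsge0_norm hsle_def.

Lemma gt0E f : (0 < f) = (f != 0) && (0 < lc f).
Proof. by rewrite -hposE -[f in RHS]subr0. Qed.

Lemma hltP f g : reflect (hlt f g) (f < g).
Proof. exact: asboolP. Qed.

End Leading.

Global Opaque hs0 hs1 hsadd hsopp hsmul hslt hsle hsnorm pos.

(** * Asymptotic comparison of series *)

Section Asymptotics.
Context {d : Order.disp_t} {R : realType} {M : oabGroupType d}.
Local Notation H := (HS R M).
Implicit Types (f g h k : H) (m n a b : M) (c r : R).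

Lemma kst_gt0 c : (0 < (kst c : H)) = (0 < c).
Proof.
rewrite gt0E; have [->|c0] := eqVneq c 0; first by rewrite kst0 eqxx ltxx.
by rewrite lc_kst // -(@kst0 _ _ M) (inj_eq (@kst_inj _ _ _)) c0.
Qed.

Lemma kst_lt c r : ((kst c : H) < kst r) = (c < r).
Proof. by rewrite -subr_gt0 -kstN -kstD kst_gt0 subr_gt0. Qed.

Lemma kst_le c r : ((kst c : H) <= kst r) = (c <= r).
Proof. by rewrite !leNgt kst_lt. Qed.

Lemma kst_ge0 c : (0 <= (kst c : H)) = (0 <= c).
Proof. by rewrite -(@kst0 _ _ M) kst_le. Qed.

Lemma kst_eq0 c : ((kst c : H) == 0) = (c == 0).
Proof. by rewrite -(@kst0 _ _ M) (inj_eq (@kst_inj _ _ _)). Qed.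

Lemma kstV c : (kst c^-1 : H) = (kst c)^-1.
Proof. exact: fmorphV. Qed.

Lemma kst_norm c : `|kst c : H| = kst `|c|.
Proof.
have [c0|c0] := leP 0 c; first by rewrite !ger0_norm ?kst_ge0.
by rewrite !ltr0_norm ?kstN // -(@kst0 _ _ M) kst_lt.
Qed.

Lemma mn_gt0 m : 0 < (mn m : H).
Proof. by rewrite gt0E lc_mn ltr01 andbT (@supp_neq0 _ _ _ _ m) // /supp /= /term eqxx oner_neq0. Qed.

Lemma mn_neq0 m : (mn m : H) != 0. Proof. by rewrite gt_eqF // mn_gt0. Qed.

Lemma mnV m : (mn m^-1%g : H) = (mn m)^-1.
Proof. by apply: (mulfI (mn_neq0 m)); rewrite -mnM mulgV mulfV // mn_neq0. Qed.

Lemma lm_norm f : lm `|f| = lm f.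
Proof. by case: (ger0P f) => // _; rewrite lmN. Qed.

Lemma lc_norm f : f != 0 -> lc `|f| = `|lc f|.
Proof.
move=> f0; case: (ltrgt0P f) => [|f0'|/eqP]; last by rewrite (negPf f0).
  by rewrite gt0E f0 /= => h; rewrite gtr0_norm.
by rewrite lcN; move: f0'; rewrite -oppr_gt0 gt0E lcN oppr_gt0 => /andP[_ h]; rewrite ltr0_norm.
Qed.

(* f << g; never true for g = 0. *)
Definition prec f g := forall c, kst c * `|f| < `|g|.

Lemma prec_neq0 f g : prec f g -> g != 0.
Proof. by move=> /(_ 0); rewrite kst0 mul0r normr_gt0. Qed.

Lemma lm_prec f g : g != 0 -> (forall m, supp f m -> (m < lm g)%O) -> prec f g.
Proof.
move=> g0 hf c; rewrite -subr_gt0.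
have ng0 : `|g| != 0 by rewrite normr_eq0.
have [|L E] := @lead_lt1D _ _ _ `|g| (- (kst c * `|f|)) ng0.
  move=> m; rewrite lm_norm => fm; apply: hf; move: m fm; apply: inSN; apply: inSZ.
  by case: (ger0P f) => _; [|apply: inSN].
by rewrite gt0E E lc_norm // normr_gt0 lc_neq0 // andbT; case: L => + _; apply: supp_neq0.
Qed.

Lemma coef_ge0 f m : 0 < f -> (forall n, (m < n)%O -> f n = 0) -> 0 <= f m.
Proof.
rewrite gt0E => /andP[f0 cf] h; have [->//|fm] := eqVneq (f m) 0.
suff -> : m = lm f by apply: ltW.
apply/esym/lm_eq; split => // n; rewrite /supp /= => fn; rewrite leNgt.
by apply/negP => /h fn0; rewrite fn0 eqxx in fn.
Qed.

(** Together with [lm_prec] this gives [prec] two forms. The form by the order is transported by the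
    embedding f |-> f o x; the form by supports passes through infinite sums, as in [prec_sum]. *)
Lemma prec_lm f g m : prec f g -> supp f m -> (m < lm g)%O.
Proof.
move=> pfg fm; apply: le_lt_trans (lm_max fm) _; rewrite ltNge; apply/negP => gf.
have f0 := supp_neq0 fm; have g0 := prec_neq0 pfg.
(* This multiple of |f| has the coefficient |lc g| + 1 at [lm f], where the coefficient of |g| is
   |lc g| or 0. *)
have := pfg ((`|lc g| + 1) / `|lc f|); rewrite -subr_gt0 => /(@coef_ge0 _ (lm f)).
have cf0 : `|lc f| != 0 by rewrite normr_eq0 lc_neq0.
have hg n : (lm g < n)%O -> `|g| n = 0.
  by move=> gn; apply: gt_lm0; rewrite lm_norm.
have hf n : (lm f < n)%O -> `|f| n = 0.
  by move=> fn; apply: gt_lm0; rewrite lm_norm.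
have -> : (`|g| - kst ((`|lc g| + 1) / `|lc f|) * `|f|) (lm f) = `|g| (lm f) - (`|lc g| + 1).
  by rewrite hvB hv_kstM -[X in _ * `|f| X](lm_norm f) -/(lc `|f|) lc_norm // divfK.
have -> : (0 <= `|g| (lm f) - (`|lc g| + 1)) = false.
  apply/negbTE; rewrite -ltNge subr_lt0; move: gf; rewrite le_eqVlt => /orP[/eqP <-|/hg ->].
    by rewrite -[X in `|g| X]lm_norm -/(lc `|g|) lc_norm // ltrDl.
  by rewrite ltr_wpDl.
move=> h; have : false by apply: h => n fn; rewrite hvB hv_kstM hf // hg ?mulr0 ?subr0 // (le_lt_trans gf).
by [].
Qed.

Lemma prec_norm f g h k : `|f| <= `|g| -> prec g h -> `|h| <= `|k| -> prec f k.
Proof.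
move=> fg gh hk c; apply: lt_le_trans hk; apply: le_lt_trans (gh `|c|).
apply: le_trans (_ : kst `|c| * `|f| <= _).
  by apply: ler_wpM2r => //; rewrite kst_le ler_norm.
by apply: ler_wpM2l => //; rewrite kst_ge0.
Qed.

Lemma prec_le f g h : `|f| <= `|g| -> prec g h -> prec f h.
Proof. by move=> fg gh; apply: prec_norm gh _. Qed.

Lemma prec_leR f g h : prec f g -> `|g| <= `|h| -> prec f h.
Proof. exact: prec_norm. Qed.

Lemma precNl f g : prec f g -> prec (- f) g.
Proof. by apply: prec_le; rewrite normrN. Qed.

Lemma precNr f g : prec f g -> prec f (- g).
Proof. by move=> h; apply: prec_leR h _; rewrite normrN. Qed.

Lemma prec_lt_norm f g : prec f g -> `|f| < `|g|.
Proof. by move=> /(_ 1); rewrite kst1 mul1r. Qed.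

Lemma prec_trans g f h : prec f g -> prec g h -> prec f h.
Proof. by move=> fg; apply: prec_le; apply/ltW/prec_lt_norm. Qed.

Lemma precZl c f g : prec f g -> prec (kst c * f) g.
Proof. by move=> h r; rewrite normrM kst_norm mulrA -kstM. Qed.

Lemma precZr c f g : c != 0 -> prec f g -> prec f (kst c * g).
Proof.
move=> c0 h r; rewrite normrM kst_norm.
have nc : 0 < `|c| by rewrite normr_gt0.
have -> : kst r * `|f| = kst `|c| * (kst (r / `|c|) * `|f|).
  by rewrite mulrA -kstM mulrCA divff ?mulr1 // gt_eqF.
by rewrite ltr_pM2l ?kst_gt0.
Qed.

Lemma precD f g h : prec f h -> prec g h -> prec (f + g) h.
Proof.
move=> pf pg c; have := pf (2 * `|c|); have := pg (2 * `|c|).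
have h1 : kst c * `|f + g| <= kst `|c| * (`|f| + `|g|).
  apply: le_trans (_ : kst `|c| * `|f + g| <= _).
    by apply: ler_wpM2r => //; rewrite kst_le ler_norm.
  by apply: ler_wpM2l (ler_normD _ _); rewrite kst_ge0.
rewrite !kstM kst_nat -!mulrA; move: h1; rewrite mulrDr.
set u := kst _ * `|_|; set v := kst _ * `|_|; set w := kst _ * `|_|; lra.
Qed.

Lemma precB f g h : prec f h -> prec g h -> prec (f - g) h.
Proof. by move=> pf pg; apply: precD pf (precNl pg). Qed.

Lemma precM f g h k : prec f g -> k != 0 -> `|h| <= `|k| -> prec (f * h) (g * k).
Proof.
move=> fg k0 hk c; rewrite !normrM mulrA.
apply: le_lt_trans (_ : kst `|c| * `|f| * `|k| < _).
  apply: le_trans (_ : kst `|c| * `|f| * `|h| <= _).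
    by apply: ler_wpM2r => //; apply: ler_wpM2r => //; rewrite kst_le ler_norm.
  by apply: ler_wpM2l => //; apply: mulr_ge0 => //; rewrite kst_ge0.
by rewrite ltr_pM2r ?normr_gt0.
Qed.

Lemma precMr f g h : prec f g -> h != 0 -> prec (f * h) (g * h).
Proof. by move=> fg h0; apply: precM. Qed.

Lemma precMl f g h : prec f g -> h != 0 -> prec (h * f) (h * g).
Proof. by rewrite ![h * _]mulrC; apply: precMr. Qed.

Lemma prec_lt f g : prec f g -> 0 < g -> - g < f < g.
Proof. by move=> /prec_lt_norm fg g0; rewrite -ltr_norml -[ltRHS]gtr0_norm. Qed.

Lemma prec_irr f : ~ prec f f.
Proof. by move=> /prec_lt_norm; rewrite ltxx. Qed.

Lemma prec0 g : g != 0 -> prec 0 g.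
Proof. by move=> g0 c; rewrite normr0 mulr0 normr_gt0. Qed.

Lemma prec_sum {I : choiceType} (F : I -> H) g : g != 0 -> (forall i, prec (F i) g) ->
  prec (ssum F) g.
Proof.
move=> g0 h; apply: lm_prec => //; apply: (@inS_sumI _ _ _ _ [set m | (m < lm g)%O]).
by move=> i m; apply: prec_lm.
Qed.

Lemma prec_mn a b : prec (mn a) (mn b) <-> (a < b)%O.
Proof.
split => [/prec_lm /(_ _) h|ab].
  by have := h a; rewrite lm_mn; apply; rewrite /supp /= /term eqxx oner_neq0.
by apply: lm_prec (mn_neq0 b) _ => m /supp_term ->; rewrite lm_mn.
Qed.

Lemma mn_lt a b : ((mn a : H) < mn b) = (a < b)%O.
Proof.
have mono x y : (x < y)%O -> (mn x : H) < mn y.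
  by move=> /prec_mn /prec_lt /(_ (mn_gt0 y)) /andP[].
case: (ltgtP a b) => [/mono//|/mono h|->]; last by rewrite ltxx.
by apply/negbTE; rewrite -leNgt ltW.
Qed.

Lemma prec1P f : prec f 1 <-> inS Mlt1 f.
Proof.
have l1 : lm (1 : H) = 1%g by rewrite -kst1 lm_kst // oner_neq0.
split => [h m /(prec_lm h)|h]; first by rewrite l1.
by apply: lm_prec (oner_neq0 _) _ => m /h; rewrite l1.
Qed.

Lemma inS_Mlt1_le f r : 0 < r -> inS Mlt1 f -> `|f| < kst r.
Proof.
move=> r0 /prec1P /(_ r^-1); rewrite normr1 kstV ltr_pdivrMl ?kst_gt0 // mulr1.
by [].
Qed.

Definition above f := 0 < f /\ prec 1 f.

Lemma aboveP f : above f <-> forall r, kst r < f.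
Proof.
split=> [[f0 h] r|h].
  by have := h r; rewrite normr1 mulr1 [ `|f| ]gtr0_norm.
have f0 : 0 < f by rewrite -(@kst0 _ _ M).
by split => // c; rewrite normr1 mulr1 gtr0_norm.
Qed.

Lemma aboveE f : above f <-> above_reals (hv f).
Proof.
by split => [/aboveP h r|h]; [apply/(hltP (kst r)); exact: h|apply/aboveP => r; apply/hltP; exact: h].
Qed.

Lemma above_le f g : above f -> f <= g -> above g.
Proof. by move=> /aboveP h fg; apply/aboveP => r; apply: lt_le_trans fg. Qed.

Lemma inS_Mgt1_prec f : f != 0 -> inS Mgt1 f -> prec 1 f.
Proof.
move=> f0 h; apply: lm_prec => // m /supp_term ->.
by apply: h; case: (lmP f0).
Qed.

Lemma hs_split f : f = rst Mgt1 f + kst (f 1%g) + rst Mlt1 f.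
Proof.
apply: hsP => m; rewrite !hvD !hv_rst hv_tm; case: (ltgtP m 1%g) => h.
- by rewrite asboolF ?asboolT ?add0r // => /lt_trans /(_ h); rewrite ltxx.
- by rewrite asboolT ?asboolF ?addr0 // => /lt_trans /(_ h); rewrite ltxx.
- by rewrite h !asboolF ?add0r ?addr0 // /Mlt1 /Mgt1 /= ltxx.
Qed.

Lemma hs_split_uniq J r (e : H) : inS Mgt1 J -> inS Mlt1 e ->
  [/\ rst Mgt1 (J + kst r + e) = J, (J + kst r + e) 1%g = r & rst Mlt1 (J + kst r + e) = e].
Proof.
move=> hJ he.
have J1 m : (m <= 1%g)%O -> J m = 0.
  by move=> m1; apply: not_supp => /hJ; rewrite /Mgt1 /= ltNge m1.
have e1 m : (1%g <= m)%O -> e m = 0.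
  by move=> m1; apply: not_supp => /he; rewrite /Mlt1 /= ltNge m1.
split; last 1 first.
- apply: hsP => m; rewrite hv_rst !hvD hv_tm; case: asboolP => h.
    by rewrite J1 ?(ltW h) // lt_eqF // !add0r.
  by rewrite e1 // leNgt; apply/negP.
- apply: hsP => m; rewrite hv_rst !hvD hv_tm; case: asboolP => h.
    by rewrite e1 ?(ltW h) // gt_eqF // !addr0.
  by rewrite J1 // leNgt; apply/negP.
- by rewrite !hvD hv_tm eqxx J1 // e1 // add0r addr0.
Qed.

Lemma ps_prec (c0 : nat -> R) f N : f != 0 -> inS Mlt1 f ->
  prec (ps c0 f - \sum_(k < N.+1) kst (c0 k) * f ^+ k) (f ^+ N).
Proof.
move=> f0 hf; apply: lm_prec; first exact: expf_neq0.
have := ps_trunc c0 f N.+1 (supp f) hf (@inS_powfrom_supp _ _ _ f).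
move=> h m /h [k Nk Pk] {h}.
have bd j n : powset (supp f) j n -> (n <= lm (f ^+ j))%O.
  elim: j n => [|j IH] n /=; first by move=> ->; rewrite expr0 -kst1 lm_kst ?oner_neq0.
  move=> [a [b [fa /IH Pb ->]]]; rewrite exprS lmM ?expf_neq0 //.
  by apply: lemM => //; apply: lm_max.
apply: le_lt_trans (bd _ _ Pk) _.
have lf1 : (lm f < 1%g)%O by apply: hf; case: (lmP f0).
elim: k Nk {Pk} => // k IH; rewrite ltnS leq_eqVlt exprS lmM ?expf_neq0 // => /orP[/eqP->|/IH h].
  by rewrite -[ltRHS]mul1g ltmM2r.
by apply: lt_trans h; rewrite -[ltRHS]mul1g ltmM2r.
Qed.

Lemma ps_prec1 (c0 : nat -> R) f : inS Mlt1 f -> f != 0 -> prec (ps c0 f - (kst (c0 0%N) + kst (c0 1%N) * f)) f.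
Proof.
move=> hf f0; have := ps_prec c0 1 f0 hf.
by rewrite !big_ord_recl big_ord0 /= expr0 expr1 mulr1 addr0.
Qed.

End Asymptotics.

(** * Exponential and logarithm on all series *)

Section ExpLog.
Context {d : Order.disp_t} {R : realType} {M : oabGroupType d}.
Variable log : M -> M -> R.
Hypothesis hlog : transseries_field log.
Local Notation H := (HS R M).
Implicit Types (f g h k J e t : H) (m n a b : M) (r : R).

Lemma log_pi m : purely_infinite (log m).
Proof. by case: hlog => -[h _ _] _ _ _; apply: h. Qed.

Definition lg m : H := mkHS (proj1 (log_pi m)).

Lemma hv_lg m : hv (lg m) = log m. Proof. by []. Qed.

Lemma inS_lg m : inS Mgt1 (lg m).
Proof. by have [_ h] := log_pi m. Qed.

Lemma hs_eq f g : hv f = hv g -> f = g.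
Proof. by move=> E; apply: hsP => m; rewrite E. Qed.

Lemma lgM m n : lg (m * n)%g = lg m + lg n.
Proof. by apply: hs_eq; case: hlog => _ h _ _; apply: h. Qed.

Lemma lg1 : lg 1%g = 0.
Proof. by apply: (addrI (lg 1%g)); rewrite -lgM mulg1 addr0. Qed.

Lemma lgV m : lg m^-1%g = - lg m.
Proof. by apply: (addrI (lg m)); rewrite -lgM mulgV lg1 subrr. Qed.

Lemma lg_le m n : (lg m <= lg n) = (m <= n)%O.
Proof.
case: hlog => _ _ h _; rewrite le_eqVlt; apply/idP/idP => [|/(h m n)[E|E]].
- by move=> /orP[/eqP E|E]; apply/h; [left; rewrite -!hv_lg E|right; exact: (elimT (hltP _ _) E)].
- by apply/orP; left; apply/eqP; apply: hs_eq.
- by apply/orP; right; apply/(hltP (lg m) (lg n)).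
Qed.

Lemma lg_lt m n : (lg m < lg n) = (m < n)%O.
Proof. by rewrite !ltNge lg_le. Qed.

Lemma lg_gt0 m : (0 < lg m) = (1%g < m)%O.
Proof. by rewrite -lg1 lg_lt. Qed.

Lemma lg_inj : injective lg.
Proof. by move=> m n E; apply/le_anti; rewrite -!lg_le E lexx. Qed.

Lemma lgX_lt m j : (1%g < m)%O -> lg m ^+ j < mn m.
Proof.
move=> m1; case: hlog => _ _ _ h; apply/hltP.
by rewrite hv_exp; apply: h.
Qed.

Lemma lg_surj J : inS Mgt1 J -> exists m, lg m = J.
Proof.
move=> hJ; case: hlog => -[_ _ h] _ _ _; have [|m _ E] := h (hv J).
  by split; [apply: hvP|].
by exists m; apply: hs_eq.
Qed.

Definition exm J : M := expm log J.

Lemma exmK J : inS Mgt1 J -> lg (exm J) = J.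
Proof.
move=> /lg_surj[m E]; apply: hs_eq.
rewrite /exm /expm; case: xgetP => [y _ E'|h]; first exact: E'.
by case: (h m); rewrite /= -E.
Qed.

Lemma lgK m : exm (lg m) = m.
Proof. by apply: lg_inj; rewrite exmK //; apply: inS_lg. Qed.

Lemma exmD J J' : inS Mgt1 J -> inS Mgt1 J' -> exm (J + J') = (exm J * exm J')%g.
Proof.
move=> hJ hJ'; apply: lg_inj; rewrite lgM !exmK //.
exact: inSD.
Qed.

(** The exponential is given by its formula on the purely infinite, constant and infinitesimal
    parts; [raw_EXP] identifies it with [Exp], which is defined as an inverse. *)
Definition EXP_def f : H :=
  mn (exm (rst Mgt1 f)) * kst (expR (f 1%g)) * ps expc (rst Mlt1 f).
Fact EXP_sealed : {E : H -> H | E = EXP_def}. Proof. by exists EXP_def. Qed.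
Definition EXP : H -> H := sval EXP_sealed.

Definition LOG_def f : H := lg (lm f) + kst (ln (lc f)) + ps lnc (eps f).
Fact LOG_sealed : {L : H -> H | L = LOG_def}. Proof. by exists LOG_def. Qed.
Definition LOG : H -> H := sval LOG_sealed.

Lemma EXPE J r e : inS Mgt1 J -> inS Mlt1 e ->
  EXP (J + kst r + e) = mn (exm J) * kst (expR r) * ps expc e.
Proof. by move=> hJ he; rewrite /EXP (svalP EXP_sealed) /EXP_def; have [-> -> ->] := hs_split_uniq r hJ he. Qed.

Lemma LOGE f : LOG f = lg (lm f) + kst (ln (lc f)) + ps lnc (eps f).
Proof. by rewrite /LOG (svalP LOG_sealed). Qed.

Lemma ps_exp_neq0 e : inS Mlt1 e -> inS Mlt1 (ps expc e - 1).
Proof.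
move=> he; have [->|e0] := eqVneq e 0; first by rewrite ps_exp0 subrr; apply: inS0.
have := ps_prec1 expc he e0; rewrite /expc !factS fact0 /= invr1 kst1 mul1r => h.
apply/prec1P; rewrite (_ : _ - 1 = ps expc e - (1 + e) + e); last by ring.
by apply: precD; [apply: prec_trans h _|]; apply/prec1P.
Qed.

Lemma ps_exp_eq1 e : inS Mlt1 e -> ps expc e = 1 -> e = 0.
Proof.
move=> he E; apply/eqP; apply: contrapT => /negP e0.
have := ps_prec1 expc he e0; rewrite /expc !factS fact0 /= invr1 kst1 mul1r E.
rewrite opprD addNKr => /precNl; rewrite opprK.
exact: prec_irr.
Qed.

Lemma ps_exp_inj e t : inS Mlt1 e -> inS Mlt1 t -> ps expc e = ps expc t -> e = t.
Proof.
move=> he ht E; apply/eqP; rewrite -subr_eq0; apply/eqP; apply: ps_exp_eq1.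
  exact: inSB.
have ht' : inS Mlt1 (- t) by apply: inSN.
by rewrite ps_expD // E -ps_expD // subrr ps_exp0.
Qed.

Lemma EXPD f g : EXP (f + g) = EXP f * EXP g.
Proof.
have [hf1 hf2] := (@inS_rst _ _ _ Mgt1 f, @inS_rst _ _ _ Mlt1 f).
have [hg1 hg2] := (@inS_rst _ _ _ Mgt1 g, @inS_rst _ _ _ Mlt1 g).
rewrite {1}(hs_split f) {1}(hs_split g).
rewrite (_ : _ + _ = (rst Mgt1 f + rst Mgt1 g) + kst (f 1%g + g 1%g) + (rst Mlt1 f + rst Mlt1 g)); last first.
  by rewrite kstD; ring.
rewrite EXPE; [|exact: inSD|exact: inSD].
rewrite exmD // mnM expRD kstM ps_expD // /EXP (svalP EXP_sealed) /EXP_def; ring.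
Qed.

Lemma EXP0 : EXP 0 = 1.
Proof.
rewrite -(addr0 (0 : H)) -{1}(addr0 (0 : H)) -{2}(@kst0 _ R M) EXPE; try exact: inS0.
by rewrite expR0 kst1 ps_exp0 !mulr1 (_ : exm 0 = 1%g) // -lg1 lgK.
Qed.

Lemma EXP_pi J : inS Mgt1 J -> EXP J = mn (exm J).
Proof.
move=> hJ; rewrite -{1}(addr0 J) -{1}(addr0 (J + 0)) -{1}(@kst0 _ R M) EXPE //; last exact: inS0.
by rewrite expR0 kst1 ps_exp0 !mulr1.
Qed.

Lemma EXP_lg m : EXP (lg m) = mn m.
Proof. by rewrite EXP_pi ?lgK //; apply: inS_lg. Qed.

Lemma EXP_kst r : EXP (kst r) = kst (expR r).
Proof.
rewrite -{1}(add0r (kst r)) -{1}(addr0 (0 + kst r)) EXPE; try exact: inS0.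
by rewrite ps_exp0 mulr1 (_ : exm 0 = 1%g) ?mul1r // -lg1 lgK.
Qed.

Lemma EXP_small e : inS Mlt1 e -> EXP e = ps expc e.
Proof.
move=> he; rewrite -{1}(add0r e) -{1}(add0r 0) -{2}(@kst0 _ R M) EXPE //; last exact: inS0.
by rewrite expR0 kst1 (_ : exm 0 = 1%g) ?mulr1 ?mul1r // -lg1 lgK.
Qed.

Lemma ps_exp_gt0 e : inS Mlt1 e -> 0 < ps expc e.
Proof.
move=> /ps_exp_neq0 /(inS_Mlt1_le ltr01); rewrite kst1 ltr_norml => /andP[h _].
by move: h; rewrite ltrBrDl subrr.
Qed.

Lemma EXP_gt0 f : 0 < EXP f.
Proof.
rewrite (hs_split f) EXPE; try exact: inS_rst.
rewrite mulr_gt0 ?mulr_gt0 ?mn_gt0 ?kst_gt0 ?expR_gt0 //.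
by apply: ps_exp_gt0; apply: inS_rst.
Qed.

Lemma EXP_neq0 f : EXP f != 0. Proof. by rewrite gt_eqF // EXP_gt0. Qed.

Lemma EXPN f : EXP (- f) = (EXP f)^-1.
Proof. by apply: (mulfI (EXP_neq0 f)); rewrite -EXPD subrr EXP0 mulfV // EXP_neq0. Qed.

Lemma EXPB f g : EXP (f - g) = EXP f / EXP g.
Proof. by rewrite EXPD EXPN. Qed.

Lemma lead_mul1 r m e : r != 0 -> inS Mlt1 e ->
  [/\ lm (kst r * mn m * (1 + e)) = m, lc (kst r * mn m * (1 + e)) = r &
      eps (kst r * mn m * (1 + e)) = e].
Proof.
move=> r0 he.
have l1 : lm (1 : H) = 1%g by rewrite -kst1 lm_kst // oner_neq0.
have [|L E] := @lead_lt1D _ _ _ (1 : H) e (oner_neq0 _).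
  by move=> n /he; rewrite l1.
have n0 : 1 + e != 0 by case: L => + _; apply: supp_neq0.
have lE : lm (1 + e) = 1%g by rewrite (lm_eq L).
have cE : lc (1 + e) = 1 by rewrite E -kst1 lc_kst // oner_neq0.
have t0 : kst r * mn m != 0 by rewrite mulf_neq0 ?kst_eq0 ?mn_neq0.
have l2 : lm (kst r * mn m * (1 + e)) = m by rewrite lmM // lE mulg1 -tmE lm_tm.
have c2 : lc (kst r * mn m * (1 + e)) = r by rewrite lcM // cE mulr1 -tmE lc_tm.
split => //; rewrite /eps l2 c2 tmE mnV kstV.
rewrite mulrA [X in X * _](_ : _ = 1) ?mul1r ?[1 + e]addrC ?addrK //.
by rewrite -invfM mulVf.
Qed.

Lemma LOG_EXP f : LOG (EXP f) = f.
Proof.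
rewrite {1}(hs_split f); set J := rst _ _; set e := rst Mlt1 _.
have hJ : inS Mgt1 J by apply: inS_rst.
have he : inS Mlt1 e by apply: inS_rst.
have he' := ps_exp_neq0 he.
rewrite EXPE // [mn _ * _]mulrC (_ : ps expc e = 1 + (ps expc e - 1)); last by rewrite addrC subrK.
have r0 : expR (f 1%g) != 0 by rewrite gt_eqF // expR_gt0.
rewrite LOGE; have [-> -> ->] := lead_mul1 (exm J) r0 he'.
rewrite exmK // expRK [RHS](hs_split f) -/J -/e; congr (_ + _).
(* That the logarithm series inverts the exponential series on this side too follows from
   [ps_exp_ln], since both sides have the same exponential. *)
apply: ps_exp_inj => //; first exact: inS_lt1_ps.
by rewrite ps_exp_ln // addrC subrK.
Qed.

Lemma EXP_LOG f : 0 < f -> EXP (LOG f) = f.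
Proof.
move=> f0; have n0 : f != 0 by rewrite gt_eqF.
have c0 : 0 < lc f by move: f0; rewrite gt0E => /andP[].
have he := eps_lt1 n0.
rewrite LOGE EXPE; [|exact: inS_lg|exact: inS_lt1_ps].
by rewrite lgK ps_exp_ln // lnK // [RHS]epsE // tmE [kst _ * _]mulrC.
Qed.

Lemma LOGM f g : 0 < f -> 0 < g -> LOG (f * g) = LOG f + LOG g.
Proof. by move=> f0 g0; rewrite -{1}(EXP_LOG f0) -{1}(EXP_LOG g0) -EXPD LOG_EXP. Qed.

Lemma LOG_mn m : LOG (mn m) = lg m.
Proof. by rewrite -EXP_lg LOG_EXP. Qed.

Lemma LOG_kst r : 0 < r -> LOG (kst r) = kst (ln r).
Proof. by move=> r0; rewrite -{1}(lnK r0) -EXP_kst LOG_EXP. Qed.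

Lemma LOG_1D e : inS Mlt1 e -> LOG (1 + e) = ps lnc e.
Proof.
move=> he; rewrite -(ps_exp_ln he) -EXP_small ?LOG_EXP //.
exact: inS_lt1_ps.
Qed.

(** Every later estimate of the exponential rests on this inequality. For J < 0 the left side is
    negative; for J > 0 the growth axiom e^J > J^2 decides; for J = 0 and r nonzero the real
    inequality is strict by a real amount, which absorbs the infinitesimal e; for f = e the term
    e^2/2 decides. *)
Lemma EXP_ge1D f : 1 + f <= EXP f.
Proof.
set J := rst Mgt1 f; set e := rst Mlt1 f; set r := f 1%g.
have fE : f = J + kst r + e := hs_split f.
have hJ : inS Mgt1 J by apply: inS_rst.
have he : inS Mlt1 e by apply: inS_rst.
have [J0|J0] := eqVneq J 0.
  rewrite fE J0 add0r EXPD EXP_kst EXP_small // addrA -{1}(@kst1 _ R M) -kstD.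
  have /orP[/eqP r0|r0] : (r == 0) || (1 + r < expR r).
    by have [//|r0] := eqVneq r 0; rewrite /= expR_gt1Dx.
    rewrite r0 expR0 addr0 kst1 mul1r.
    have [->|e0] := eqVneq e 0; first by rewrite ps_exp0 addr0.
    have := ps_prec expc 2 e0 he; rewrite !big_ord_recl big_ord0 /= expr0 expr1 !mulr1 addr0.
    have E0 : expc 0 = 1 :> R by rewrite /expc invr1.
    have E1 : expc 1 = 1 :> R by rewrite /expc invr1.
    have E2 : expc 2 = 2^-1 :> R by [].
    rewrite /bump /= E0 E1 E2 kst1 mul1r kstV kst_nat => /(_ 2).
    set p := ps expc e; have := sqr_ge0 e; set q := e ^+ 2.
    move=> q0; rewrite kst_nat (ger0_norm q0) => h.
    have : - (q / 2) < p - (1 + (e + 2^-1 * q)).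
      by have := ler_norm (- (p - (1 + (e + 2^-1 * q)))); rewrite normrN; lra.
    lra.
  have he' := ps_exp_neq0 he; set e' := ps expc e - 1.
  have -> : ps expc e = 1 + e' by rewrite addrC subrK.
  have hu : inS Mlt1 (e - kst (expR r) * e') by apply: inSB => //; apply: inSZ.
  have s0 : 0 < expR r - (1 + r) by rewrite subr_gt0.
  have := ltr_normlW (inS_Mlt1_le s0 hu); rewrite !kstD kstN kstD.
  set a := kst (expR r); set b := kst r; set c := kst 1.
  lra.
have p1J := inS_Mgt1_prec J0 hJ.
have hb (s : R) : kst s < `|J| by have := p1J s; rewrite normr1 mulr1.
have he1 : `|e| < 1 by rewrite -(@kst1 _ R M); apply: inS_Mlt1_le.
have [Jn|Jp] := ltP J 0.
  apply: ltW; apply: le_lt_trans (EXP_gt0 f); rewrite fE.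
  have := hb (r + 2); rewrite (ltr0_norm Jn) kstD kst_nat; move: (ltr_normlW he1).
  set a := kst r; lra.
have {}Jp : 0 < J by rewrite lt_neqAle eq_sym J0.
have hm := exmK hJ; set m := exm J in hm.
have m1 : (1%g < m)%O by rewrite -lg_gt0 hm.
have := lgX_lt 2 m1; rewrite hm expr2 => hJm.
rewrite {2}fE EXPE // -/m.
(* The goal follows from 1 + f < 2J < J^2 c/2 < e^J c E, where c = e^r: the second inequality is J >
   4/c, and the third uses J^2 < e^J and E > 1/2. *)
set E := ps expc e.
have hE : 1 / 2 < E.
  have he' := ps_exp_neq0 he; rewrite -/E in he'.
  have := inS_Mlt1_le (_ : 0 < 2^-1) he'; rewrite kstV kst_nat => /(_ _).
  rewrite invr_gt0 ltr0n => /(_ isT); rewrite ltr_norml => /andP[h _]; lra.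
set c := kst (expR r); have c0 : 0 < c by rewrite kst_gt0 expR_gt0.
have h1 : 4 / c < J.
  have := hb (4 / expR r); rewrite kstM kstV kst_nat -/c.
  by rewrite [X in _ < X -> _]gtr0_norm.
have h2 : 2 * J < J * J * c / 2.
  have : 4 < J * c by rewrite -ltr_pdivrMr.
  move=> h; have : J * 4 < J * (J * c) by rewrite ltr_pM2l.
  move=> h'; rewrite [J * J * c](_ : _ = J * (J * c)); last by rewrite mulrA.
  lra.
have h3 : J * J * c / 2 < mn m * c * E.
  rewrite -mulrA; have h4 : 0 < c / 2 by rewrite divr_gt0 // ltr0n.
  apply: lt_trans (_ : mn m * (c / 2) < _); first by rewrite ltr_pM2r.
  rewrite -mulrA ltr_pM2l ?mn_gt0 // ltr_pM2l //; lra.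
have h5 : 1 + f < 2 * J.
  have := hb (r + 2); rewrite (gtr0_norm Jp) kstD kst_nat fE; move: (ltr_normlW he1).
  set a := kst r; lra.
by apply: ltW; apply: lt_trans h5 _; apply: lt_trans h2 h3.
Qed.

Lemma EXP_lt f g : f < g -> EXP f < EXP g.
Proof.
move=> fg; rewrite -(subrK f g) EXPD -[ltLHS]mul1r ltr_pM2r ?EXP_gt0 //.
by apply: lt_le_trans (EXP_ge1D _); rewrite ltrDl subr_gt0.
Qed.

Lemma EXP_ltE f g : (EXP f < EXP g) = (f < g).
Proof.
case: (ltgtP f g) => [/EXP_lt//|/EXP_lt h|->]; last by rewrite ltxx.
by apply/negbTE; rewrite -leNgt ltW.
Qed.

Lemma EXP_leE f g : (EXP f <= EXP g) = (f <= g).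
Proof. by rewrite !leNgt EXP_ltE. Qed.

Lemma LOG_ltE f g : 0 < f -> 0 < g -> (LOG f < LOG g) = (f < g).
Proof. by move=> f0 g0; rewrite -EXP_ltE !EXP_LOG. Qed.

Lemma EXP_le_inv t : t < 1 -> EXP t <= (1 - t)^-1.
Proof.
move=> t1; have h : 0 < 1 - t by rewrite subr_gt0.
rewrite -[EXP t]invrK -EXPN lef_pV2 ?posrE //; first exact: EXP_ge1D.
by rewrite EXP_gt0.
Qed.

Lemma above_LOG f : above f -> above (LOG f).
Proof.
move=> af; have [f0 _] := af; apply/aboveP => r.
rewrite -EXP_ltE EXP_LOG // EXP_kst.
by move/aboveP: af; apply.
Qed.

Lemma above_EXP f : above f -> above (EXP f).
Proof.
move=> /above_le; apply; apply: le_trans (EXP_ge1D f).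
by rewrite lerDr ler01.
Qed.

Lemma raw_LOG f : 0 < f -> Log log (hv f) = hv (LOG f).
Proof.
move=> f0; have n0 : f != 0 by rewrite gt_eqF.
rewrite LOGE /Log; apply/funext => m; rewrite !hvD; congr (_ + _).
have he := eps_lt1 n0.
rewrite ps_shift // kst0 add0r psE -sumM; last exact: ps_summable.
rewrite hv_sum; last by apply: summableM; apply: ps_summable.
congr (hsum _ m); apply/funext => k; apply/funext => n.
rewrite mulrCA -exprS hv_kstM -[infinitesimal_part (hv f)]/(hv (eps f)) -hv_exp.
by [].
Qed.

Lemma hposP f : 0 < f <-> hpos (hv f).
Proof.
have E : hv f \- hv (0 : H) = hv f by apply/funext => m; rewrite /= hv0 subr0.
split => [/hltP|h]; first by rewrite /hlt E.
by apply/hltP; rewrite /hlt E.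
Qed.

Lemma raw_EXP f : Exp log (hv f) = hv (EXP f).
Proof.
rewrite /Exp; case: xgetP => [g _ [hg pg Lg]|h].
  have p0 : 0 < mkHS hg by apply/hposP.
  rewrite -[g]/(hv (mkHS hg)); congr hv.
  rewrite -(EXP_LOG p0); congr EXP; apply: hs_eq.
  by rewrite -raw_LOG.
case: (h (hv (EXP f))); split; first exact: hvP.
  by apply/hposP; apply: EXP_gt0.
by rewrite raw_LOG ?LOG_EXP // EXP_gt0.
Qed.

End ExpLog.

(** * From coefficient functions to bundled series; indicator series *)

Section Lift.
Context {d : Order.disp_t} {R : realType} {M : oabGroupType d}.
Local Notation H := (HS R M).

Definition hlift (g : M -> R) : H := if pselect (hahn g) is left h then mkHS h else 0.

Lemma hv_lift g : hahn g -> hv (hlift g) = g.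
Proof. by rewrite /hlift; case: pselect. Qed.

Lemma hliftK (f : H) : hlift (hv f) = f.
Proof. by apply: hs_eq; rewrite hv_lift //; apply: hvP. Qed.

(** Applied to this series, strong linearity of composition shows that the composites of all
    monomials of [A] form one summable family. *)
Definition ind (A : set M) : H := hlift (fun n => if `[< A n >] then 1 else 0).

Lemma hv_ind A n : well_based A -> ind A n = if `[< A n >] then 1 else 0.
Proof.
move=> wA; rewrite /ind hv_lift //; apply: well_based_sub wA => m.
by rewrite /supp /=; case: asboolP => // _; rewrite eqxx.
Qed.

Lemma inS_ind A : well_based A -> inS A (ind A).
Proof. by move=> wA n; rewrite /supp /= hv_ind //; case: asboolP => // _; rewrite eqxx. Qed.

Lemma inS_norm (P : set M) (f : H) : inS P f -> inS P `|f|.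
Proof. by move=> h; case: (ger0P f) => // _; apply: inSN. Qed.

Lemma powset1 (q : M) k n : powset [set q] k n <-> n = (q ^+ k)%g.
Proof.
elim: k n => [|k IH] n /=; first by rewrite expg0.
rewrite expgS; split => [[a [b [-> /IH -> ->]]]//|->].
by exists q, (q ^+ k)%g; split => //; apply/IH.
Qed.

End Lift.

(** A real is determined by the rationals below it, so [nat -> bool] covers [R] even when [R] lives
    in a large universe. Exponents and coefficients of monomials range over [R], whence the use in
    [LG_small]. *)
Lemma small_real (R : realType) : small [set: R].
Proof.
pose code (r : R) (n : nat) : bool := if unpickle n is Some q then `[< ratr q < r >] else false.
exists (nat -> bool), (fun c => xget 0 [set r | code r = c]) => r _.
exists (code r) => //; apply: xget_unique => // s E.
have lem (u v : R) : u < v -> code v = code u -> False.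
  move=> uv E'.
  have [q] := rat_in_itvoo uv; rewrite in_itv /= => /andP[uq qv].
  have := congr1 (fun c => c (pickle q)) E'; rewrite /code pickleK asboolT // asboolF //.
  by apply/negP; rewrite -leNgt ltW.
by case: (ltgtP r s) => // rs; exfalso; apply: (lem _ _ rs); rewrite E.
Qed.

Section LeadLemmas.
Context {d : Order.disp_t} {R : realType} {M : oabGroupType d}.
Local Notation H := (HS R M).
Implicit Types (f g h u : H).

Lemma prec_same_lm f g h : g != 0 -> lm h = lm g -> prec f h -> prec f g.
Proof. by move=> g0 E pf; apply: lm_prec => // m /(prec_lm pf); rewrite E. Qed.

Lemma prec_lead_add f u : prec u f -> f + u != 0 /\ lm (f + u) = lm f.
Proof.
move=> uf; have f0 := prec_neq0 uf.
have [|L _] := @lead_lt1D _ _ _ f u f0; first by move=> m; apply: prec_lm.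
by rewrite (lm_eq L); split => //; case: L => + _; apply: supp_neq0.
Qed.

Lemma precDr f g u : prec u f -> prec g f -> prec g (f + u).
Proof.
by move=> uf gf; have [n0 E] := prec_lead_add uf; apply: prec_same_lm gf.
Qed.

Lemma prec_lead_mn f g : f != 0 -> prec g (mn (lm f)) -> prec g f.
Proof. by move=> f0; apply: prec_same_lm; rewrite ?lm_mn. Qed.

Lemma inS_and (P Q : set M) f : inS P f -> inS Q f -> inS (P `&` Q) f.
Proof. by move=> hP hQ m fm; split; [apply: hP|apply: hQ]. Qed.

Lemma prec_lt0D f u : prec u f -> f < 0 -> f + u < 0.
Proof.
move=> /precNr h f0; have nf : 0 < - f by rewrite oppr_gt0.
by have /andP[] := prec_lt h nf; lra. Qed.

End LeadLemmas.

(** * The groups G_n over an arbitrary base monomial *)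

Section Groups.
Context {d : Order.disp_t} {R : realType} {M : oabGroupType d}.
Variable log : M -> M -> R.
Hypothesis hlog : transseries_field log.
Local Notation H := (HS R M).
Local Notation EXP := (EXP log).
Local Notation LOG := (LOG hlog).
Local Notation lg := (lg hlog).
Local Notation exm := (exm log).
Implicit Types (f g h u x : H) (l m p q : M) (a r : R).

(* LG T n is the group G_n, and LG l n is its image under T |-> l. *)
Fixpoint LG l n : set M :=
  if n is n'.+1 then
    [set m | exists a g, inS (LG l n' `&` Mgt1) g /\ lg m = kst a * lg l + g]
  else [set m | exists a, lg m = kst a * lg l].

Lemma LG0_sub l n : LG l 0 `<=` LG l n.
Proof.
case: n => [//|n] m [a E]; exists a, 0; split; first exact: inS0.
by rewrite addr0.
Qed.

Lemma LG_1 l n : LG l n 1%g.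
Proof. by apply: LG0_sub; exists 0; rewrite lg1 kst0 mul0r. Qed.

Lemma LG_base l n : LG l n l.
Proof. by apply: LG0_sub; exists 1; rewrite kst1 mul1r. Qed.

Lemma LG_M l n p q : LG l n p -> LG l n q -> LG l n (p * q)%g.
Proof.
case: n => [|n] /=.
  by move=> [a E] [b E']; exists (a + b); rewrite lgM E E' kstD mulrDl.
move=> [a [g [hg E]]] [b [h [hh E']]]; exists (a + b), (g + h); split; first exact: inSD.
by rewrite lgM E E' kstD mulrDl addrACA.
Qed.

Lemma LG_pow l n p r : LG l n p -> LG l n (exm (kst r * lg p)).
Proof.
have K : lg (exm (kst r * lg p)) = kst r * lg p by apply: exmK; apply: inSZ; apply: inS_lg.
case: n => [|n] /=.
  by move=> [a E]; exists (r * a); rewrite K E kstM mulrA.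
move=> [a [g [hg E]]]; exists (r * a), (kst r * g); split; first exact: inSZ.
by rewrite K E kstM mulrDr mulrA.
Qed.

Lemma LG_V l n p : LG l n p -> LG l n p^-1%g.
Proof.
move=> /(LG_pow (-1)); rewrite (_ : exm _ = p^-1%g) //.
by apply: (lg_inj (hlog := hlog)); rewrite exmK ?lgV ?kstN ?kst1 ?mulN1r //; apply: inSN; apply: inS_lg.
Qed.

Lemma LG_S l n : LG l n `<=` LG l n.+1.
Proof.
elim: n => [|n IH]; first exact: (@LG0_sub l 1).
move=> m [a [g [hg E]]]; exists a, g; split => //.
by apply: inS_sub hg => p [/IH].
Qed.

Lemma LG_le l n k : (n <= k)%N -> LG l n `<=` LG l k.
Proof.
elim: k => [|k IH]; first by rewrite leqn0 => /eqP ->.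
by rewrite leq_eqVlt => /orP[/eqP->//|/IH h]; apply: subset_trans h (@LG_S l k).
Qed.

Lemma LG_exp l n g : inS (LG l n) g -> inS Mgt1 g -> LG l n.+1 (exm g).
Proof.
move=> hg g1; exists 0, g; split; first exact: inS_and.
by rewrite kst0 mul0r add0r exmK.
Qed.

(** A monomial of level n + 1 is given by a real exponent and a coefficient function on the
    monomials of level n, both of which range over a set. This makes [contraction_fixedpoint]
    applicable at a fixed level. *)
Lemma LG_small l n : small (LG l n).
Proof.
have [IR [eR hR]] := small_real R.
elim: n => [|n [I [e he]]].
  exists IR, (fun i => exm (kst (eR i) * lg l)) => m [a E].
  have [i _ Ei] := hR a Logic.I; exists i => //.
  by rewrite Ei -E lgK.
pose dec (c : I -> IR) (m : M) : R :=
  if pselect (exists i, e i = m) is left h then eR (c (sval (cid h))) else 0.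
exists (IR * (I -> IR))%type, (fun y : IR * (I -> IR) => exm (kst (eR y.1) * lg l + hlift (dec y.2))).
move=> m [a [g [hg E]]]; have [i _ Ei] := hR a Logic.I.
have /choice[c hc] (j : I) : exists k, eR k = g (e j).
  by have [k _ Ek] := hR (g (e j)) Logic.I; exists k.
exists (i, c) => //=; rewrite Ei (_ : dec c = hv g) ?hliftK -?E ?lgK //.
apply/funext => p; rewrite /dec; case: pselect => [h|h].
  by rewrite hc (svalP (cid h)).
symmetry; apply: not_supp => /hg[/he[j _ Ej] _]; apply: h; by exists j.
Qed.

(** Since l = e^l', the powers of [l] are exponentials of multiples of [l'], which costs one
    level. *)
Lemma LG_shift l l' n : lg l = mn l' -> LG l n `<=` LG l' n.+1.
Proof.
move=> E; have l1 : (1%g < l')%O by apply: (@inS_lg _ _ _ _ hlog l l'); rewrite E /supp /= /term eqxx oner_neq0.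
have hl a : inS (LG l' 0 `&` Mgt1) (kst a * mn l').
  by apply: inSZ; apply: inS_tm; split => //; apply: LG_base.
elim: n => [|n IH] m.
  by move=> [a Em]; exists 0, (kst a * mn l'); split => //; rewrite Em E kst0 mul0r add0r.
move=> [a [g [hg Em]]]; exists 0, (kst a * mn l' + g); split; last by rewrite Em E kst0 mul0r add0r.
apply: inSD; first by apply: inS_sub (hl a) => p [hp ?]; split => //; apply: LG0_sub.
by apply: inS_sub hg => p [/IH].
Qed.

Lemma lg_prec q : (1%g < q)%O -> prec (lg q) (mn q).
Proof.
move=> q1 c; have a1 : above (lg q).
  have q0 : 0 < lg q by rewrite lg_gt0.
  by split => //; apply: inS_Mgt1_prec; [rewrite gt_eqF|apply: inS_lg].
have [q0 _] := a1; rewrite (gtr0_norm q0) gtr0_norm ?mn_gt0 //.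
apply: lt_trans (lgX_lt hlog 2 q1); rewrite expr2 ltr_pM2r //.
by move/aboveP: a1; apply.
Qed.

(** In log q = a log l + g with g nonzero, the leading monomial of g has a lower level, so g
    dominates log l by induction, and log q is negligible against q. The use is this domination: the
    exponent of a monomial has the size of its part g. *)
Lemma LG_lg_prec l n q : LG l n q -> (1%g < q)%O -> prec (lg l) (mn q).
Proof.
elim: n q => [|n IH] q.
  move=> [a E] q1; have a0 : a != 0.
    by apply: contraTneq q1 => a0; rewrite -(lg_gt0 hlog) E a0 kst0 mul0r ltxx.
  have := precZl a^-1 (lg_prec q1); rewrite E mulrA -kstM mulVf // kst1 mul1r.
  by [].
move=> [a [g [hg E]]] q1; have [g0|g0] := eqVneq g 0.
  apply: (IH q _ q1); apply: LG0_sub; exists a; by rewrite E g0 addr0.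
have [Ls s1] := hg _ (proj1 (lmP g0)).
have pl : prec (lg l) g by apply: prec_lead_mn => //; apply: IH.
apply: prec_trans (lg_prec q1); rewrite E addrC; apply: precDr => //.
exact: precZl.
Qed.

Lemma LG_new l n q : LG l n.+1 q -> ~ LG l n q -> (q < 1%g)%O ->
  exists a g, [/\ inS (LG l n `&` Mgt1) g, lg q = kst a * lg l + g, g < 0 & prec (lg l) g].
Proof.
move=> [a [g [hg E]]] nq q1; exists a, g.
have g0 : g != 0 by apply: contra_not_neq nq => g0; apply: LG0_sub; exists a; rewrite E g0 addr0.
have [Ls s1] := hg _ (proj1 (lmP g0)).
have pl : prec (lg l) g by apply: prec_lead_mn => //; apply: LG_lg_prec Ls s1.
split => //; rewrite ltNge; apply/negP; rewrite le_eqVlt eq_sym (negPf g0) /= => gp.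
have /andP[h _] := prec_lt (precZl a pl) gp.
by move: q1; rewrite -ltm1V -(lg_gt0 hlog) lgV E; lra.
Qed.

(** Each level is thus a convex subgroup of the next. The part g of the exponent of the new monomial
    q contains a monomial that is itself new one level lower; by induction this one exceeds all
    monomials in the exponent of p, so g dominates the difference of the exponents. *)
Lemma LG_convex l n q p : LG l n.+1 q -> ~ LG l n q -> (q < 1%g)%O -> LG l n p -> (q < p)%O.
Proof.
elim: n q p => [|n IH] q p Lq nq q1 Lp; have [a [g [hg E gn pl]]] := LG_new Lq nq q1;
  rewrite -(lg_lt hlog) -subr_lt0 E.
  move: Lp => [b ->]; rewrite (_ : _ - _ = g + kst (a - b) * lg l); last by rewrite kstD kstN; ring.
  by apply: prec_lt0D => //; apply: precZl.
move: Lp => [b [k [hk ->]]].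
rewrite (_ : _ - _ = g + (kst (a - b) * lg l - k)); last by rewrite kstD kstN; ring.
apply: prec_lt0D => //; apply: precB; first exact: precZl.
have [s [gs ns]] : exists s, supp g s /\ ~ LG l n s.
  apply: contrapT => /forallNP h; apply: nq; exists a, g; split => // s gs; split; last by case: (hg _ gs).
  by have /not_andP[//|/contrapT] := h s.
have [Lss ss1] := hg _ gs.
apply: lm_prec => [|r /hk[Lr _]]; first exact: supp_neq0 gs.
apply: lt_le_trans (lm_max gs).
rewrite -ltmV; apply: IH; [exact: LG_V| |by rewrite ltmV1|exact: LG_V].
by move=> /LG_V; rewrite invgK.
Qed.

End Groups.

(** * The series over the iterated logarithms of T *)

Section Tower.
Context {d : Order.disp_t} {R : realType} {M : oabGroupType d}.
Variable log : M -> M -> R.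
Hypothesis hlog : transseries_field log.
Variable T : M.
Hypothesis hT : log_atomic log T.
Local Notation H := (HS R M).
Local Notation EXP := (EXP log).
Local Notation LOG := (LOG hlog).
Local Notation lg := (lg hlog).
Local Notation exm := (exm log).
Local Notation LG := (LG hlog).
Implicit Types (f g h u x : H) (l m p q : M) (a r : R).

Definition ell k : M := sval (cid (proj2 hT k)).

Lemma ell_iter k : iter k (Log log) (mono T) = hv (mn (ell k) : H).
Proof. exact: (svalP (cid (proj2 hT k))). Qed.

Lemma ell0 : ell 0 = T.
Proof. by apply: (@mn_inj _ R); apply: hs_eq; rewrite -ell_iter. Qed.

Lemma lg_ell k : lg (ell k) = mn (ell k.+1).
Proof. by apply: hs_eq; rewrite -ell_iter iterS ell_iter (raw_LOG hlog) ?LOG_mn ?mn_gt0. Qed.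

Lemma ell_gt1 k : (1%g < ell k)%O.
Proof.
case: k => [|k]; first by rewrite ell0; case: hT.
by apply: (@inS_lg _ _ _ _ hlog (ell k) (ell k.+1)); rewrite lg_ell /supp /= /term eqxx oner_neq0.
Qed.

Lemma omega_ell k : omega log T (mono (ell k)).
Proof.
elim: k => [|k IH]; first by rewrite ell0; apply: omega_T.
rewrite -[mono _]/(hv (mn (ell k.+1) : H)) -ell_iter iterS ell_iter; apply: omega_log => //.
by apply/hposP; apply: mn_gt0.
Qed.

Lemma LG_omega l l' n : omega log T (@mono _ R _ l) -> omega log T (@mono _ R _ l') -> lg l = mn l' ->
  forall m, LG l n m -> omega log T (@mono _ R _ m).
Proof.
move=> ol ol' E.
have key m : omega log T (hv (lg m)) -> omega log T (@mono _ R _ m).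
  by move=> o; rewrite -[mono m]/(hv (mn m : H)) -(EXP_lg hlog) -(raw_EXP hlog); apply: omega_exp.
have hl a : inS [set q | omega log T (@mono _ R _ q)] (kst a * lg l).
  by rewrite E; apply: inSZ; apply: inS_tm.
elim: n => [|n IH] m.
  by move=> [a Em]; apply: key; rewrite Em; apply: omega_sum; [apply: hvP|apply: hl].
move=> [a [g [hg Em]]]; apply: key; rewrite Em; apply: omega_sum; first exact: hvP.
by apply: (inSD (hl a)) => q /hg[/IH].
Qed.

(* As G_n o ell j is contained in G_(n+1) o ell (j+1), the sets D j increase, and
   LE consists of the series with support in some D j. *)
Definition D j : set M := LG (ell j) (j + j).

Lemma D_S j : D j `<=` D j.+1.
Proof.
move=> m /(LG_shift (lg_ell j)); rewrite /D addSn addnS.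
exact: LG_S.
Qed.

Lemma D_le i j : (i <= j)%N -> D i `<=` D j.
Proof.
elim: j => [|j IH]; first by rewrite leqn0 => /eqP ->.
by rewrite leq_eqVlt => /orP[/eqP->//|/IH h]; apply: subset_trans h (@D_S j).
Qed.

Lemma LG_D k n j : (k <= j)%N -> (n <= j)%N -> LG (ell k) n `<=` D j.
Proof.
move=> kj nj; apply: subset_trans (_ : LG (ell j) (n + (j - k)) `<=` _); last first.
  by apply: LG_le; apply: leq_add => //; apply: leq_subr.
rewrite -{1}(subnKC kj); elim: (j - k)%N => [|i IH]; first by rewrite !addn0.
rewrite !addnS; apply: subset_trans IH _; apply: LG_shift; exact: lg_ell.
Qed.

Definition X : set M := \bigcup_j D j.

Lemma X_D j : D j `<=` X.
Proof. by move=> m h; exists j. Qed.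

Lemma LG_X k n : LG (ell k) n `<=` X.
Proof. by apply: subset_trans (@X_D (maxn k n)); apply: LG_D; rewrite ?leq_maxl ?leq_maxr. Qed.

Lemma X_1 : X 1%g. Proof. by exists 0%N => //; apply: LG_1. Qed.

Lemma X_M p q : X p -> X q -> X (p * q)%g.
Proof.
move=> [i _ Dp] [j _ Dq]; exists (maxn i j) => //; apply: LG_M.
  by apply: (D_le (leq_maxl i j)).
by apply: (D_le (leq_maxr i j)).
Qed.

Lemma X_V p : X p -> X p^-1%g.
Proof. by move=> [i _ Dp]; exists i => //; apply: LG_V. Qed.

Lemma X_omega p : X p -> omega log T (@mono _ R _ p).
Proof. by move=> [i _ Dp]; apply: LG_omega Dp; [apply: omega_ell|apply: omega_ell|apply: lg_ell]. Qed.

Lemma LG_ell_lg k n m : LG (ell k) n.+1 m -> inS (LG (ell k) n `|` [set ell k.+1]) (lg m).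
Proof.
move=> [a [g [hg ->]]]; apply: inSD; last by apply: inS_sub hg => q [h _]; left.
by rewrite lg_ell; apply: inSZ; apply: inS_tm; right.
Qed.

Lemma D_lg j m : D j m -> inS (D j.+1) (lg m).
Proof.
move=> Dm; have : LG (ell j) (j + j).+1 m by apply: LG_S.
move=> /LG_ell_lg; apply: inS_sub => q [/D_S//|->].
exact: LG_base.
Qed.

Lemma X_lg m : X m -> inS X (lg m).
Proof. by move=> [j _ /D_lg]; apply: inS_sub; apply: X_D. Qed.

(** This describes LE by supports alone, without composition; the agreement with [LE] is
    [LE_LEh]. *)
Definition LEh f := exists j, inS (D j) f.

Lemma LEh_X f : LEh f -> inS X f.
Proof. by move=> [j]; apply: inS_sub; apply: X_D. Qed.

Lemma LEh2 f g : LEh f -> LEh g -> exists j, inS (D j) f /\ inS (D j) g.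
Proof.
move=> [i hf] [j hg]; exists (maxn i j); split.
  by apply: inS_sub hf; apply: D_le; apply: leq_maxl.
by apply: inS_sub hg; apply: D_le; apply: leq_maxr.
Qed.

Lemma LEhD f g : LEh f -> LEh g -> LEh (f + g).
Proof. by move=> hf hg; have [j [? ?]] := LEh2 hf hg; exists j; apply: inSD. Qed.

Lemma LEhN f : LEh f -> LEh (- f).
Proof. by move=> [j hf]; exists j; apply: inSN. Qed.

Lemma LEh_kst r : LEh (kst r).
Proof. by exists 0%N; apply: inS_kst; apply: LG_1. Qed.

Lemma LEhV f : LEh f -> LEh f^-1.
Proof. by move=> [j hf]; exists j; apply: inS_inv => //; [apply: LG_1|apply: LG_M|apply: LG_V]. Qed.

Lemma LEh_LOG f : 0 < f -> LEh f -> LEh (LOG f).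
Proof.
move=> f0 [j hf]; have n0 : f != 0 by rewrite gt_eqF.
have Dl : D j (lm f) by apply: hf; case: (lmP n0).
exists j.+1; rewrite LOGE; apply: inSD.
  by apply: inSD; [apply: D_lg|apply: inS_kst; apply: LG_1].
apply: inS_ps; [exact: LG_1|exact: LG_M|].
apply: inS_eps; [exact: LG_1|exact: LG_M|exact: LG_V|].
by apply: inS_sub hf; apply: D_S.
Qed.

(** Passing from [ell j] to [ell j.+1] costs one level while [D] gains two, so one level is left for
    the exponential. *)
Lemma LEh_EXP f : LEh f -> LEh (EXP f).
Proof.
move=> [j hf]; exists j.+1.
have hf' : inS (D j.+1) f by apply: inS_sub hf; apply: D_S.
rewrite (hs_split f) EXPE; try exact: inS_rst.
apply: (@inSM _ _ _ (D j.+1) (D j.+1)); first exact: LG_M.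
  rewrite mulrC; apply: inSZ; apply: inS_tm.
  have /LG_exp : inS (LG (ell j) (j + j)) (rst Mgt1 f) by apply: inS_rst2.
  move=> /(_ (@inS_rst _ _ _ _ _)) /(LG_shift (lg_ell j)).
  by rewrite /D addSn addnS.
by apply: inS_ps; [exact: LG_1|exact: LG_M|apply: inS_rst2].
Qed.

Lemma LEh_mn_ell k : LEh (mn (ell k)).
Proof. by exists k; apply: inS_tm; apply: LG_base. Qed.

End Tower.

(** * Fixed points of contractions *)

Section FixedPoint.
Context {d : Order.disp_t} {R : realType} {M : oabGroupType d}.
Local Notation H := (HS R M).
Implicit Types (u v z : H) (c m : M).

(* The fixpoint is a limit z of approximations: the coefficient of z at c is
   that of any u for which the leading monomial of F u - u is below c. *)
Lemma contraction_fixedpoint (Q : set M) (F : H -> H) : small Q ->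
  (forall u, inS Q u -> inS Q (F u)) ->
  (forall u v, inS Q u -> inS Q v -> u != v -> prec (F u - F v) (u - v)) ->
  exists2 u, inS Q u & F u = u.
Proof.
move=> sQ FQ FC; apply: contrapT => nfix.
pose err u := F u - u.
have err0 u : inS Q u -> err u != 0.
  by move=> Qu; apply/eqP => /eqP; rewrite subr_eq0 => /eqP E; apply: nfix; exists u.
have coefB (f g : H) c : (f - g) c = f c - g c by rewrite hvB.
have errl u : inS Q u -> supp (err u) (lm (err u)) by move=> /err0 h; case: (lmP h).
(* Otherwise [c] is at most the leading monomial of u - v. There both errors vanish, and so does F u
   - F v by contraction; hence u - v vanishes there as well, which is absurd. *)
have diff u v c : inS Q u -> inS Q v -> (lm (err u) < c)%O -> (lm (err v) < c)%O -> u c = v c.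
  move=> Qu Qv uc vc; have [->//|uv] := eqVneq u v.
  have uv0 : u - v != 0 by rewrite subr_eq0.
  apply/eqP; rewrite -subr_eq0 -coefB; apply: contrapT => /negP nz.
  have cl : (c <= lm (u - v))%O by apply: lm_max.
  have Fl : (F u - F v) (lm (u - v)) = 0.
    by apply: contrapT => /eqP /(prec_lm (FC _ _ Qu Qv uv)); rewrite ltxx.
  have eq0 w : inS Q w -> (lm (err w) < c)%O -> err w (lm (u - v)) = 0.
    move=> Qw wc; apply: contrapT => /eqP /lm_max h.
    by have := lt_le_trans wc cl; rewrite ltNge h.
  have : (err u - err v) (lm (u - v)) = 0 by rewrite coefB !eq0 ?subrr.
  have -> : err u - err v = (F u - F v) - (u - v) by rewrite /err; ring.
  rewrite coefB Fl sub0r => /eqP; rewrite oppr_eq0.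
  by have [+ _] := lmP uv0; rewrite /supp /= => /negPf ->.
pose W c u := inS Q u /\ (lm (err u) < c)%O.
pose zf c : R := if pselect (exists u, W c u) is left h then (sval (cid h)) c else 0.
have zE c u : W c u -> zf c = u c.
  move=> Wu; rewrite /zf; case: pselect => [h|[]]; last by exists u.
  by case: (svalP (cid h)) => Qs sc; case: Wu => Qu uc; apply: diff.
have zQ : supp zf `<=` Q.
  move=> c; rewrite /supp /= /zf; case: pselect => [h|]; last by rewrite eqxx.
  by case: (cid h) => u [Qu _] /= /Qu.
(* The coefficients may come from many different [u], and the support is a set because [Q] is small.
   It is reverse well-ordered because a [u] that determines the coefficient at [b] also determines
   those at all larger monomials. *)
have zh : hahn zf.
  split; first by have [I [e he]] := sQ; exists I, e => c /zQ /he.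
  move=> B Bz [b Bb]; have := Bz _ Bb; rewrite /supp /=.
  have [[u Wu]|h] := pselect (exists u, W b u); last by rewrite /zf; case: pselect => //; rewrite eqxx.
  have Wn n : (b <= n)%O -> W n u.
    by case: Wu => Qu ub bn; split => //; apply: lt_le_trans bn.
  move=> _; have [_ wu] := hvP u.
  have [||m [Bm bm] hm] := wu (B `&` [set n | (b <= n)%O]).
  - by move=> n [Bn bn]; have := Bz _ Bn; rewrite /supp /= (zE n u) //; apply: Wn.
  - by exists b; split => //=; rewrite lexx.
  exists m => // n Bn; have [bn|nb] := leP b n; first exact: hm.
  exact: le_trans (ltW nb) bm.
pose z : H := mkHS zh.
have Qz : inS Q z by [].
have zu u c : inS Q u -> (lm (err u) < c)%O -> (z - u) c = 0.
  by move=> Qu uc; rewrite coefB [z c](zE c u) ?subrr.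
have hz u : inS Q u -> (lm (err z) <= lm (err u))%O.
  move=> Qu; rewrite leNgt; apply/negP => lt; set e := lm (err z) in lt.
  have [E|uz] := eqVneq z u; first by move: lt; rewrite /e E ltxx.
  have : (err z - err u) e != 0.
    rewrite coefB [err u e](_ : _ = 0) ?subr0; first exact: errl.
    by apply: contrapT => /eqP /lm_max; rewrite leNgt lt.
  have -> : err z - err u = (F z - F u) - (z - u) by rewrite /err; ring.
  rewrite coefB zu // subr0 => /(prec_lm (FC _ _ Qz Qu uz)) el.
  have zu0 : z - u != 0 by rewrite subr_eq0.
  by have [+ _] := lmP zu0; rewrite /supp /= zu ?eqxx //; apply: lt_trans el.
have Fzz : F z != z by rewrite -subr_eq0; apply: err0.
(* The error of [F z] is F (F z) - F z, by contraction smaller than F z - z, whereas by [hz] no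
   error has a smaller leading monomial than that of [z]. *)
have QF := FQ _ Qz; have := hz _ QF; rewrite leNgt => /negP; apply.
by apply: prec_lm (errl _ QF); apply: FC.
Qed.

End FixedPoint.

(** * Composition as an embedding of ordered fields *)

Section Composition.
Context {d : Order.disp_t} {R : realType} {M : oabGroupType d}.
Variable log : M -> M -> R.
Hypothesis hlog : transseries_field log.
Variable T : M.
Hypothesis hT : log_atomic log T.
Variable comp : (M -> R) -> (M -> R) -> M -> R.
Hypothesis hcomp : is_composition log T comp.
Local Notation H := (HS R M).
Local Notation EXP := (EXP log).
Local Notation LOG := (LOG hlog).
Local Notation lg := (lg hlog).
Local Notation exm := (exm log).
Local Notation LG := (LG hlog).
Local Notation ell := (ell hT).
Local Notation D := (D hlog hT).
Local Notation X := (X hlog hT).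
Local Notation LEh := (LEh hlog hT).
Let X1 : X 1%g := X_1 hlog hT.
Let XM := @X_M _ _ _ _ hlog _ hT : forall a b, X a -> X b -> X (a * b)%g.
Let XV := @X_V _ _ _ _ hlog _ hT : forall a, X a -> X a^-1%g.
Let Xomega := @X_omega _ _ _ _ hlog _ hT : forall m, X m -> omega log T (@mono _ R _ m).
Let Xlog := @X_lg _ _ _ _ hlog _ hT : forall m, X m -> inS X (lg m).
Implicit Types (f g h u x : H) (m : M) (r : R).

Lemma omega_hahn (g : M -> R) : omega log T g -> hahn g.
Proof.
elim=> {g}.
- by move=> r; apply: hahn_term.
- exact: hahn_term.
- move=> f _ hf; rewrite -[f]/(hv (mkHS hf)) (raw_EXP hlog); exact: hvP.
- move=> f _ hf pf; rewrite -[f]/(hv (mkHS hf)) raw_LOG; first exact: hvP.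
  by apply/hposP.
- by [].
Qed.

Lemma inS_omega f : inS X f -> omega log T (hv f).
Proof. by move=> hf; apply: omega_sum; [apply: hvP|move=> m /hf /Xomega]. Qed.

Definition composable x := omega log T (hv x) /\ above x.

Definition cmp_def f x : H := hlift (comp (hv f) (hv x)).
Fact cmp_sealed : {c : H -> H -> H | c = cmp_def}. Proof. by exists cmp_def. Qed.
Definition cmp : H -> H -> H := sval cmp_sealed.
Fact cmpE f x : cmp f x = hlift (comp (hv f) (hv x)).
Proof. by rewrite /cmp (svalP cmp_sealed). Qed.

Section AtX.
Variable x : H.
Hypothesis dxx : composable x.

Let hx := hcomp (proj1 dxx) (proj1 (aboveE x) (proj2 dxx)).

Lemma cmp_omega f : inS X f -> omega log T (comp (hv f) (hv x)).
Proof. by move=> /inS_omega hf; case: hx => h _ _ _; apply: h. Qed.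

Lemma hv_cmp f : inS X f -> hv (cmp f x) = comp (hv f) (hv x).
Proof. by move=> hf; rewrite cmpE hv_lift //; apply: omega_hahn; apply: cmp_omega. Qed.

Lemma cmp_T : cmp (mn T) x = x.
Proof. by rewrite cmpE; case: hx => _ E _ _; rewrite -[hv (mn T)]/(mono T) E hliftK. Qed.

Lemma cmp_sum f : inS X f ->
  ssummable (fun m => kst (f m) * cmp (mn m) x) /\ cmp f x = ssum (fun m => kst (f m) * cmp (mn m) x).
Proof.
move=> hf; case: hx => _ _ _ /(_ _ (inS_omega hf)) /=.
have -> : (fun m => hscale (hv f m) (comp (mono m) (hv x))) = (fun m => hv (kst (f m) * cmp (mn m) x)).
  apply/funext => m; apply/funext => n; rewrite hv_kstM /hscale.
  have [->|fm] := eqVneq (f m) 0; first by rewrite !mul0r.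
  by rewrite hv_cmp //; apply: inS_tm; apply: hf.
move=> [s E]; split => //; apply: hs_eq.
by rewrite hv_cmp // E hv_sum.
Qed.

Lemma cmp_mn_exm (J : H) : inS X J -> inS Mgt1 J -> cmp (mn (exm J)) x = EXP (cmp J x).
Proof.
move=> XJ J1; case: hx => _ _ h _; rewrite cmpE -[hv (mn (exm J))]/(mono (expm log (hv J))).
rewrite h; first by rewrite -(hv_cmp XJ) raw_EXP // hliftK.
by split; [apply: inS_omega|split => //; apply: hvP].
Qed.

Lemma cmp_mn m : X m -> cmp (mn m) x = EXP (cmp (lg m) x).
Proof.
by move=> Xm; rewrite -{1}(lgK hlog m) cmp_mn_exm //; [apply: Xlog|apply: inS_lg].
Qed.

Lemma cmpD f g : inS X f -> inS X g -> cmp (f + g) x = cmp f x + cmp g x.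
Proof.
move=> hf hg; have [sf ->] := cmp_sum hf; have [shiftT ->] := cmp_sum hg.
have [_ ->] := cmp_sum (inSD hf hg); rewrite -sumD //.
by congr ssum; apply/funext => m; rewrite hvD kstD mulrDl.
Qed.

Lemma cmpZ r f : inS X f -> cmp (kst r * f) x = kst r * cmp f x.
Proof.
move=> hf; have [sf ->] := cmp_sum hf; have [_ ->] := cmp_sum (@inSZ _ _ _ _ r _ hf).
rewrite -sumM //; congr ssum; apply/funext => m.
by rewrite hv_kstM kstM mulrA.
Qed.

Lemma cmpN f : inS X f -> cmp (- f) x = - cmp f x.
Proof. move=> hf; have E g : - g = kst (- 1) * g :> H by rewrite kstN kst1 mulN1r.
by rewrite [LHS](congr1 (cmp ^~ x) (E f)) cmpZ // -E. Qed.

Lemma cmpB f g : inS X f -> inS X g -> cmp (f - g) x = cmp f x - cmp g x.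
Proof. by move=> hf hg; rewrite cmpD ?cmpN //; apply: inSN. Qed.

Lemma cmp0 : cmp 0 x = 0.
Proof. by rewrite -(subrr (0 : H)) cmpB ?subrr //; apply: inS0. Qed.

Lemma cmp_mn1 : cmp (mn 1%g) x = 1.
Proof. by rewrite cmp_mn // lg1 cmp0 EXP0. Qed.

Lemma cmp_kst r : cmp (kst r) x = kst r.
Proof. by rewrite -[kst r]mulr1 -mn1 cmpZ ?cmp_mn1 //; apply: inS_tm. Qed.

Lemma cmp_mnM m n : X m -> X n -> cmp (mn (m * n)%g) x = cmp (mn m) x * cmp (mn n) x.
Proof. by move=> Xm Xn; rewrite !cmp_mn ?lgM ?cmpD ?EXPD //; try exact: Xlog; exact: XM. Qed.

Lemma cmp_mn_gt0 m : X m -> 0 < cmp (mn m) x.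
Proof. by move=> Xm; rewrite cmp_mn // EXP_gt0. Qed.

Lemma X_expg q k : X q -> X (q ^+ k)%g.
Proof. by move=> Xq; elim: k => [|k IH]; rewrite ?expg0 // expgS; apply: XM. Qed.

Lemma cmp_mnX m k : X m -> cmp (mn (m ^+ k)%g) x = cmp (mn m) x ^+ k.
Proof.
move=> Xm; elim: k => [|k IH]; first by rewrite expg0 cmp_mn1.
by rewrite expgS cmp_mnM ?IH ?exprS //; apply: X_expg.
Qed.

(* The series of the powers m^-k is omega, so the powers of m^-1 o x are
   summable, which forces m^-1 o x to be infinitesimal. *)
Lemma cmp_mn_above m : X m -> (1%g < m)%O -> above (cmp (mn m) x).
Proof.
move=> Xm m1; split; first exact: cmp_mn_gt0.
pose q := m^-1%g; have q1 : (q < 1%g)%O by rewrite ltmV1.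
have Xq : X q by apply: XV.
pose A := powfrom [set q] 0.
have wA : well_based A.
  split; first by apply: small_powfrom; apply: small1.
  by apply: neumann => [|a ->//]; apply: rwo1.
have Aq k : A (q ^+ k)%g by exists k => //; apply/powset1.
have XA : inS X (ind A : H).
  apply: (inS_sub _ (inS_ind wA)) => n [k _ /powset1 ->]; exact: X_expg.
have [[[_ rF] fin] _] := cmp_sum XA.
set u := cmp (mn q) x.
have u0 : u != 0 by rewrite gt_eqF // cmp_mn_gt0.
have uX k p : supp (u ^+ k) p -> supp (kst (ind A (q ^+ k)%g) * cmp (mn (q ^+ k)%g) x) p.
  by rewrite cmp_mnX // hv_ind // asboolT // kst1 mul1r.
have lu k : supp (u ^+ k) (lm (u ^+ k)) by case: (lmP (expf_neq0 k u0)).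
have l1 : lm (1 : H) = 1%g by rewrite -kst1 lm_kst // oner_neq0.
have qinj i j : (i < j)%N -> (q ^+ j < q ^+ i)%g%O.
  elim: j => // j IH; rewrite ltnS leq_eqVlt => /orP[/eqP->|/IH h].
    by rewrite expgS -[ltRHS]mul1g ltmM2r.
  by apply: lt_trans h; rewrite expgS -[ltRHS]mul1g ltmM2r.
suff pu : prec u 1.
  have mE : cmp (mn m) x = u^-1.
    by apply: (mulfI u0); rewrite mulfV // -cmp_mnM // mulVg cmp_mn1.
  rewrite mE; have := precMr pu (_ : u^-1 != 0); rewrite mulfV // mul1r.
  by apply; rewrite invr_eq0.
apply: lm_prec (oner_neq0 _) _ => n /lm_max nl; rewrite l1; apply: le_lt_trans nl _.
(* If the leading monomial of u were 1, every power of u would have 1 in its support, against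
   finiteness; if it were larger, the leading monomials of the powers would increase strictly,
   against well-basedness. *)
rewrite ltNge; apply/negP; rewrite le_eqVlt => /orP[/eqP lu1|lu1].
  have lk k : lm (u ^+ k) = 1%g.
    by elim: k => [//|k IH]; rewrite exprS lmM ?expf_neq0 // IH mulg1.
  have [s us hs] := finite_seq_uniq (fin 1%g).
  have : (size (map (fun k => (q ^+ k)%g) (iota 0 (size s).+1)) <= size s)%N.
    apply: uniq_leq_size.
      rewrite map_inj_in_uniq ?iota_uniq // => i j _ _ E.
      by case: (ltngtP i j) => // /qinj; rewrite E ltxx.
    move=> _ /mapP[k _ ->]; apply/hs.
    by have := lu k; rewrite lk => h; apply: uX.
  by rewrite size_map size_iota ltnn.
have lS k : (lm (u ^+ k) < lm (u ^+ k.+1))%O.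
  by rewrite exprS lmM ?expf_neq0 // -[ltLHS]mul1g ltmM2r.
apply: (rwo_no_seq rF _ lS) => k; exists (q ^+ k)%g => //.
by apply: uX; apply: lu.
Qed.

Lemma cmp_mn_prec a b : X a -> X b -> (a < b)%O -> prec (cmp (mn a) x) (cmp (mn b) x).
Proof.
move=> Xa Xb ab.
have [_ h] : above (cmp (mn (a^-1 * b)%g) x).
  by apply: cmp_mn_above; [apply: XM => //; apply: XV|rewrite -(mulVg a) ltmM2l].
have := precMl h (_ : cmp (mn a) x != 0); rewrite mulr1 -cmp_mnM // ?mulVKg; last first.
  by apply: XM => //; apply: XV.
by apply; rewrite gt_eqF // cmp_mn_gt0.
Qed.

Lemma cmp_lead f : inS X f -> f != 0 ->
  prec (cmp f x - kst (lc f) * cmp (mn (lm f)) x) (cmp (mn (lm f)) x).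
Proof.
move=> hf f0; have Xl : X (lm f) by apply: hf; case: (lmP f0).
have Xt : inS X (kst (lc f) * mn (lm f)) by apply: inSZ; apply: inS_tm.
rewrite -cmpZ -?cmpB //; last by apply: inS_tm.
have [_ ->] := cmp_sum (inSB hf Xt).
have c0 : cmp (mn (lm f)) x != 0 by rewrite gt_eqF // cmp_mn_gt0.
apply: prec_sum => // m; rewrite -tmE hvB hv_tm.
have [->|ml] := eqVneq m (lm f); first by rewrite subrr kst0 mul0r; apply: prec0.
rewrite subr0; have [->|fm] := eqVneq (f m) 0; first by rewrite kst0 mul0r; apply: prec0.
apply: precZl; apply: cmp_mn_prec => //; first exact: hf.
by rewrite lt_neqAle ml; apply: lm_max.
Qed.

Lemma cmp_gt0 f : inS X f -> 0 < f -> 0 < cmp f x.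
Proof.
move=> hf; rewrite gt0E => /andP[f0 cf].
have Xl : X (lm f) by apply: hf; case: (lmP f0).
have := cmp_lead hf f0 => /(precZr (lt0r_neq0 cf)) h.
have t0 : 0 < kst (lc f) * cmp (mn (lm f)) x by rewrite mulr_gt0 ?kst_gt0 ?cmp_mn_gt0.
by have /andP[] := prec_lt h t0; lra.
Qed.

Lemma cmp_lt f g : inS X f -> inS X g -> f < g -> cmp f x < cmp g x.
Proof.
move=> hf hg fg; rewrite -subr_gt0 -cmpB //; apply: cmp_gt0; first exact: inSB.
by rewrite subr_gt0.
Qed.

Lemma cmp_ltE f g : inS X f -> inS X g -> (cmp f x < cmp g x) = (f < g).
Proof.
move=> hf hg; case: (ltgtP f g) => [/cmp_lt->//|/cmp_lt h|->]; last by rewrite ltxx.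
by apply/negbTE; rewrite -leNgt ltW // h.
Qed.

Lemma cmp_norm f : inS X f -> cmp `|f| x = `|cmp f x|.
Proof.
move=> hf; have [->|f0] := eqVneq f 0; first by rewrite cmp0 !normr0 cmp0.
have [h|h|/eqP] := ltrgt0P f; last by rewrite (negPf f0).
  by rewrite gtr0_norm // cmp_gt0.
rewrite cmpN // ltr0_norm // -oppr_gt0 -cmpN // cmp_gt0 ?oppr_gt0 //.
exact: inSN.
Qed.

Lemma cmp_prec f g : inS X f -> inS X g -> prec f g -> prec (cmp f x) (cmp g x).
Proof.
move=> hf hg pfg c; rewrite -!cmp_norm // -cmpZ; last exact: inS_norm.
apply: cmp_lt => //; last exact: inS_norm.
by apply: inSZ; apply: inS_norm.
Qed.

Lemma cmp_above f : inS X f -> above f -> above (cmp f x).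
Proof.
move=> hf /aboveP h; apply/aboveP => r; rewrite -cmp_kst; apply: cmp_lt => //.
exact: inS_kst.
Qed.

Lemma cmp_small f : inS X f -> inS Mlt1 f -> inS Mlt1 (cmp f x).
Proof.
move=> hf /prec1P h; apply/prec1P.
rewrite -(@kst1 _ R M) -cmp_kst kst1; apply: cmp_prec => //.
by rewrite -kst1; apply: inS_kst.
Qed.

(** Composition is known to be linear over the terms of a single series. The indicator series of the
    union of all supports provides one well-based set for the double family of terms, so that
    [exch_sum] applies. *)
Lemma cmp_ssum {I : choiceType} (F : I -> H) : ssummable F -> (forall i, inS X (F i)) ->
  ssummable (fun i => cmp (F i) x) /\ cmp (ssum F) x = ssum (fun i => cmp (F i) x).
Proof.
move=> sF XF; pose S := \bigcup_i supp (F i).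
have wS : well_based S by case: sF.
have XS : inS X (ind S : H) by apply: (inS_sub _ (inS_ind wS)) => n [i _ /XF].
have [[wA fin] _] := cmp_sum XS.
set A := \bigcup_i _ in wA.
pose G i m := kst (F i m) * cmp (mn m) x.
have nz i m p : supp (G i m) p -> S m /\ supp (kst (ind S m) * cmp (mn m) x) p.
  have [E|Fm] := eqVneq (F i m) 0.
    by rewrite /G E kst0 mul0r => /inS0 h; case: (h set0).
  have Sm : S m by exists i.
  by rewrite /G hv_ind // asboolT // kst1 mul1r => h; split => //; exact: inSZ h.
have [i m p /nz[_ h]||s1 s2 s3] := @exch_sum _ _ _ _ _ G A wA.
- by exists m.
- move=> p; have := fin p => finp.
  apply: (@sub_finite_set _ _ (\bigcup_(m in [set m | supp (kst (ind S m) * cmp (mn m) x) p])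
    ((fun i => (i, m)) @` [set i | supp (F i) m]))).
    move=> [i m] /= h; have [Sm hp] := nz _ _ _ h; exists m => //=; exists i => //.
    apply: contrapT => /not_supp E; move: h; rewrite /G E kst0 mul0r.
    by move=> /inS0 h; case: (h set0).
  apply: bigcup_finite => // m _; apply: finite_image.
  by case: sF => _; apply.
have E i : ssum (G i) = cmp (F i) x by have [_ ->] := cmp_sum (XF i).
have E' j : ssum (G ^~ j) = kst (ssum F j) * cmp (mn j) x.
  have [s us hs] := summable_seq j sF.
  have [|_ ->] := @sum_fin _ _ _ _ (G ^~ j) s us.
    move=> i /negP ni; rewrite /G not_supp ?kst0 ?mul0r // => h; apply: ni; exact/hs.
  rewrite (@sum_seq _ _ _ _ F j s) // ; last by move=> i h; apply/hs.
  by rewrite (raddf_sum kst) /= mulr_suml.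
have XsF : inS X (ssum F) by apply: inS_sumI.
split; first by move: s2; congr ssummable; apply/funext => i.
have [_ ->] := cmp_sum XsF.
rewrite -(eq_sum E) s3; apply: eq_sum => j; exact: esym.
Qed.

(** On monomials multiplicativity comes from the exponential ([cmp_mnM]); strong linearity extends
    it here to one factor and in [cmpM] to the other. *)
Lemma cmp_mnMf a g : X a -> inS X g -> cmp (mn a * g) x = cmp (mn a) x * cmp g x.
Proof.
move=> Xa hg; have [shiftT ->] := cmp_sum hg.
have smn := summable_mn g.
have Xb b : inS X (mn a * (kst (g b) * mn b)).
  have [->|gb] := eqVneq (g b) 0; first by rewrite kst0 mul0r mulr0; apply: inS0.
  rewrite mulrCA; apply: inSZ; rewrite -mnM; apply: inS_tm; apply: XM => //; exact: hg.
rewrite {1}(sum_mn g) -(sumM _ smn) -(sumM _ shiftT).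
have [_ ->] := cmp_ssum (summableM (mn a) smn) Xb.
apply: eq_sum => b; have [->|gb] := eqVneq (g b) 0.
  by rewrite kst0 !mul0r !mulr0 cmp0.
have Xb' : X b by apply: hg.
rewrite [mn a * _]mulrCA -mnM cmpZ ?cmp_mnM //; last by apply: inS_tm; apply: XM.
by rewrite mulrCA.
Qed.

Lemma cmpM f g : inS X f -> inS X g -> cmp (f * g) x = cmp f x * cmp g x.
Proof.
move=> hf hg; have [sf ->] := cmp_sum hf.
have smn := summable_mn f.
have Xa a : inS X (g * (kst (f a) * mn a)).
  have [->|fa] := eqVneq (f a) 0; first by rewrite kst0 mul0r mulr0; apply: inS0.
  rewrite mulrCA; apply: inSZ; apply: inSM hg (@inS_tm _ R _ X 1 a (hf _ fa)) => //.
rewrite {1}(sum_mn f) mulrC -(sumM _ smn) mulrC -(sumM _ sf).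
have [_ ->] := cmp_ssum (summableM g smn) Xa.
apply: eq_sum => a; have [->|fa] := eqVneq (f a) 0.
  by rewrite kst0 !mul0r !mulr0 cmp0.
have Xa' : X a by apply: hf.
rewrite [g * _]mulrCA [g * _]mulrC cmpZ; last first.
  by apply: inSM (@inS_tm _ R _ X 1 a Xa') hg.
by rewrite cmp_mnMf // mulrA mulrC.
Qed.

Lemma inS_X_exprn f k : inS X f -> inS X (f ^+ k).
Proof. exact: inSXP. Qed.

Lemma cmp1 : cmp 1 x = 1. Proof. exact: cmp_mn1. Qed.

Lemma cmpX f k : inS X f -> cmp (f ^+ k) x = cmp f x ^+ k.
Proof.
move=> hf; elim: k => [|k IH]; first exact: cmp1.
by rewrite exprS cmpM ?IH ?exprS //; apply: inS_X_exprn.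
Qed.

Lemma inS_X_inv f : inS X f -> inS X f^-1.
Proof. exact: inS_inv. Qed.

Lemma cmpV f : inS X f -> cmp f^-1 x = (cmp f x)^-1.
Proof.
move=> hf; have [->|f0] := eqVneq f 0; first by rewrite invr0 cmp0 invr0.
have E : cmp f x * cmp f^-1 x = 1 by rewrite -cmpM ?mulfV ?cmp1 //; apply: inS_X_inv.
have c0 : cmp f x != 0 by apply: contra_eq_neq E => ->; rewrite mul0r eq_sym oner_eq0.
by apply: (mulfI c0); rewrite E mulfV.
Qed.

Lemma cmp_ps (c : nat -> R) f : inS X f -> inS Mlt1 f -> cmp (ps c f) x = ps c (cmp f x).
Proof.
move=> hf f1; rewrite !psE.
have [|_ ->] := cmp_ssum (ps_summable c f1); first by move=> k; apply: inSZ; apply: inS_X_exprn.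
by apply: eq_sum => k; rewrite cmpZ ?cmpX //; apply: inS_X_exprn.
Qed.

Lemma inS_LOG f : 0 < f -> inS X f -> inS X (LOG f).
Proof.
move=> f0 hf; have n0 : f != 0 by rewrite gt_eqF.
have Xl : X (lm f) by apply: hf; case: (lmP n0).
rewrite LOGE; apply: inSD; last by apply: inS_ps; [exact: X1|exact: XM|exact: (inS_eps X1 XM XV hf)].
by apply: inSD; [apply: Xlog|apply: inS_kst].
Qed.

Lemma cmp_LOG f : 0 < f -> inS X f -> cmp (LOG f) x = LOG (cmp f x).
Proof.
move=> f0 hf; have n0 : f != 0 by rewrite gt_eqF.
have c0 : 0 < lc f by move: f0; rewrite gt0E => /andP[].
have Xl : X (lm f) by apply: hf; case: (lmP n0).
have he := inS_eps X1 XM XV hf; have e1 := eps_lt1 n0.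
have ce1 := cmp_small he e1.
have E : cmp f x = kst (lc f) * cmp (mn (lm f)) x * (1 + cmp (eps f) x).
  have X1e : inS X (1 + eps f) by apply: inSD => //; apply: inS_tm.
  have Xml : inS X (mn (lm f) : H) by apply: inS_tm.
  have X11 : inS X (1 : H) by rewrite -kst1; apply: inS_kst.
  rewrite [in LHS](epsE n0) tmE; move: X1e he; move: (eps f) => e X1e he.
  by rewrite cmpM ?cmpZ ?cmpD ?cmp1 //; apply: inSZ.
have p1 : 0 < 1 + cmp (eps f) x.
  by have := inS_Mlt1_le ltr01 ce1; rewrite kst1 ltr_norml => /andP[h _]; lra.
have p2 : 0 < kst (lc f) * cmp (mn (lm f)) x by rewrite mulr_gt0 ?kst_gt0 ?cmp_mn_gt0.
rewrite E LOGE; move: he e1 ce1 p1 {E}; move: (eps f) => e he e1 ce1 p1.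
rewrite !LOGM ?kst_gt0 ?cmp_mn_gt0 // LOG_kst // LOG_1D // cmp_mn // LOG_EXP.
have hl : inS X (lg (lm f)) by apply: Xlog.
have hk : inS X (kst (ln (lc f)) : H) by apply: inS_kst.
have hp : inS X (ps lnc e) by apply: inS_ps.
by rewrite !cmpD ?cmp_kst ?cmp_ps // ?[cmp (lg _) x + _]addrC //; apply: inSD.
Qed.

Lemma cmp_EXP f : inS X (EXP f) -> cmp (EXP f) x = EXP (cmp f x).
Proof.
move=> h; have := cmp_LOG (EXP_gt0 log f) h; rewrite LOG_EXP => ->.
by rewrite EXP_LOG // cmp_gt0 // EXP_gt0.
Qed.

End AtX.

Lemma composable_cmp f x : composable x -> inS X f -> above f -> composable (cmp f x).
Proof.
move=> dxx hf af; split; first by rewrite hv_cmp //; apply: cmp_omega.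
exact: cmp_above.
Qed.

Lemma LGT_X n : LG T n `<=` X.
Proof. by have := @LG_X _ _ _ _ hlog _ hT 0 n; rewrite ell0. Qed.

Lemma inS_LGT_X n f : inS (LG T n) f -> inS X f.
Proof. by apply: inS_sub; apply: LGT_X. Qed.

Lemma mn_above (l : M) : (1%g < l)%O -> above (mn l : H).
Proof. by move=> l1; split; [apply: mn_gt0|rewrite -mn1; apply/prec_mn]. Qed.

Lemma composable_LEh x : LEh x -> above x -> composable x.
Proof. by move=> /LEh_X hx ax; split => //; apply: inS_omega. Qed.

Lemma composable_ell k : composable (mn (ell k)).
Proof. by apply: composable_LEh; [apply: LEh_mn_ell|apply: mn_above; apply: ell_gt1]. Qed.

Lemma cmp_lgT x : composable x -> cmp (lg T) x = LOG x.
Proof.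
move=> dxx; have XT : X T by apply: (@LGT_X 0); apply: LG_base.
by rewrite -[in RHS](cmp_T dxx) cmp_mn // LOG_EXP.
Qed.

(** * Composition with a monomial maps levels onto levels *)

Section MonomialBase.
Variable l : M.
Hypothesis dxl : composable (mn l).

Lemma cmp_mn_lin n m a g : lg m = kst a * lg T + g -> X m -> inS (LG T n) g ->
  cmp (mn m) (mn l) = EXP (kst a * lg l + cmp g (mn l)).
Proof.
move=> E Xm /inS_LGT_X hg.
have XT : inS X (lg T) by apply: Xlog; apply: (@LGT_X 0); apply: LG_base.
by rewrite (cmp_mn dxl) // E (cmpD dxl) ?(cmpZ dxl) ?cmp_lgT ?LOG_mn //; apply: inSZ.
Qed.

(** This is the half of the induction on levels that passes from monomials to series; [cmp_monomial]
    passes from series of level n to monomials of level n + 1, whence the hypothesis on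
    monomials. *)
Lemma cmp_series n f : (forall m, LG T n m -> exists2 m', LG l n m' & cmp (mn m) (mn l) = mn m') ->
  inS (LG T n) f ->
  inS (LG l n) (cmp f (mn l)) /\ (inS Mgt1 f -> inS Mgt1 (cmp f (mn l))).
Proof.
move=> fwd hf; have [_ ->] := cmp_sum dxl (inS_LGT_X hf).
split => [|f1]; apply: inS_sumI => m; (have [->|fm] := eqVneq (f m) 0; first by rewrite kst0 mul0r; apply: inS0);
  apply: inSZ; have [m' Lm' E] := fwd m (hf _ fm); rewrite E; apply: inS_tm => //.
have [_] := cmp_mn_above dxl (LGT_X (hf _ fm)) (f1 _ fm).
by rewrite E -mn1 => /prec_mn.
Qed.

Lemma cmp_monomial n m : LG T n m -> exists2 m', LG l n m' & cmp (mn m) (mn l) = mn m'.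
Proof.
have hl : inS Mgt1 (lg l) by apply: inS_lg.
elim: n m => [|n IH] m Lm; have Xm := LGT_X Lm.
  have [a E] := Lm; exists (exm (kst a * lg l)); first by exists a; rewrite exmK //; apply: inSZ.
  rewrite (@cmp_mn_lin 0 m a 0) ?addr0 //; last exact: inS0.
  by rewrite (cmp0 dxl) addr0 EXP_pi //; apply: inSZ.
have [a [g [hg E]]] := Lm.
have hg1 : inS (LG T n) g by apply: inS_sub hg => p [].
have hg2 : inS Mgt1 g by apply: inS_sub hg => p [].
have [c1 c2] := cmp_series IH hg1.
have h : inS Mgt1 (kst a * lg l + cmp g (mn l)) by apply: inSD; [apply: inSZ|apply: c2].
exists (exm (kst a * lg l + cmp g (mn l))).
  exists a, (cmp g (mn l)); split; last by rewrite exmK.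
  by apply: inS_and => //; apply: c2.
by rewrite (cmp_mn_lin E Xm hg1) EXP_pi.
Qed.

Lemma cmp_LG n f : inS (LG T n) f -> inS (LG l n) (cmp f (mn l)).
Proof. by move=> hf; have [] := cmp_series (@cmp_monomial n) hf. Qed.

(** Composition with [l] induces an order isomorphism [phi] from [LG T n] to [LG l n], with inverse
    [psi]; the preimage of [g] has the coefficients of [g] pulled back along [phi]. *)
Lemma cmp_series_onto n g :
  (forall m', LG l n m' -> exists2 m, LG T n m & cmp (mn m) (mn l) = mn m') ->
  inS (LG l n) g ->
  exists f, [/\ inS (LG T n) f, cmp f (mn l) = g & inS Mgt1 g -> inS Mgt1 f].
Proof.
move=> bwd hg.
have /choice[phi hphi] (m : M) : exists m', LG T n m -> LG l n m' /\ cmp (mn m) (mn l) = mn m'.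
  have [Lm|nL] := pselect (LG T n m); last by exists m.
  by have [m' h1 h2] := cmp_monomial Lm; exists m'.
have /choice[psi hpsi] (m' : M) : exists m, LG l n m' -> LG T n m /\ cmp (mn m) (mn l) = mn m'.
  have [Lm|nL] := pselect (LG l n m'); last by exists m'.
  by have [m h1 h2] := bwd _ Lm; exists m.
have phi_lt m p : LG T n m -> LG T n p -> (m < p)%O -> (phi m < phi p)%O.
  move=> Lm Lp mp; have [_ Em] := hphi _ Lm; have [_ Ep] := hphi _ Lp.
  by apply/(@prec_mn _ R); rewrite -Em -Ep; exact: (cmp_mn_prec dxl (LGT_X Lm) (LGT_X Lp) mp).
have phi_inj m p : LG T n m -> LG T n p -> phi m = phi p -> m = p.
  move=> Lm Lp E; case: (ltgtP m p) => // h.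
    by have := phi_lt _ _ Lm Lp h; rewrite E ltxx.
  by have := phi_lt _ _ Lp Lm h; rewrite E ltxx.
have psiK m' : LG l n m' -> phi (psi m') = m'.
  move=> Lm; have [L1 E1] := hpsi _ Lm; have [_ E2] := hphi _ L1.
  by apply: (@mn_inj _ R); rewrite -E2.
pose f0 m := if `[< LG T n m >] then g (phi m) else 0.
have f0S m : supp f0 m -> LG T n m /\ supp g (phi m).
  by rewrite /supp /= /f0; case: asboolP => // _; rewrite eqxx.
have hf0 : hahn f0.
  have [[I [e he]] rg] := hvP g; split.
    exists I, (psi \o e) => m /f0S[Lm /[dup] gm /he[i _ Ei]]; exists i => //=.
    by rewrite Ei; apply: phi_inj => //; [case: (hpsi _ (hg _ gm))|rewrite psiK //; apply: hg].
  move=> B Bf [b Bb]; have [||m' [c Bc <-] hm] := rg (phi @` B).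
  - by move=> _ [c Bc <-]; case: (f0S _ (Bf _ Bc)).
  - by exists (phi b), b.
  exists c => // c' Bc'; rewrite leNgt; apply/negP => h.
  have := hm (phi c') (ex_intro2 _ _ c' Bc' erefl); rewrite leNgt phi_lt //.
    by case: (f0S _ (Bf _ Bc)).
  by case: (f0S _ (Bf _ Bc')).
pose f : H := mkHS hf0.
have hf : inS (LG T n) f by move=> m /f0S[].
exists f; split => //; last first.
  move=> g1 m /[dup] /f0S[Lm gm] fm; have [_ E] := hphi _ Lm.
  rewrite /Mgt1 /= ltNge; apply/negP; rewrite le_eqVlt => /orP[/eqP m1|m1].
    have := g1 _ gm; rewrite /Mgt1 /= (_ : phi m = 1%g) ?ltxx //.
    by apply: (@mn_inj _ R); rewrite -E m1 cmp_mn1.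
  have := g1 _ gm; rewrite /Mgt1 /= ltNge => /negP; apply; apply: ltW.
  apply/(@prec_mn _ R); rewrite mn1 -E -(cmp_mn1 dxl).
  exact: (cmp_mn_prec dxl (LGT_X Lm) X1 m1).
have [sF ->] := cmp_sum dxl (inS_LGT_X hf).
have FE m : kst (f m) * cmp (mn m) (mn l) = tm (f m) (phi m).
  have [E|fm] := eqVneq (f m) 0.
    by rewrite E kst0 mul0r tmE kst0 mul0r.
  by have [_ ->] := hphi _ (hf _ fm); rewrite tmE.
apply: hsP => p; have [Lp|nLp] := pselect (LG l n p).
  have [L1 _] := hpsi _ Lp.
  rewrite (@sum_seq _ _ _ _ _ p [:: psi p]) //; last first.
    move=> m; rewrite FE => h; have := supp_term h => /= pE.
    have Lm : LG T n m.
      by apply: hf; apply/eqP => fm0; move: h; rewrite fm0 /supp /= /term if_same eqxx.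
    by rewrite inE; apply/eqP; apply: phi_inj => //; rewrite psiK.
  by rewrite big_seq1 FE hv_tm psiK // eqxx /= /f0 asboolT // psiK.
rewrite [RHS]not_supp; last by move=> /hg.
rewrite (@sum_seq _ _ _ _ _ p [::]) ?big_nil // => m; rewrite FE => h.
have := supp_term h => /= pE; exfalso; apply: nLp; rewrite pE.
have Lm : LG T n m.
  by apply: hf; apply/eqP => fm0; move: h; rewrite fm0 /supp /= /term if_same eqxx.
by case: (hphi _ Lm).
Qed.

Lemma cmp_monomial_onto n m' : LG l n m' -> exists2 m, LG T n m & cmp (mn m) (mn l) = mn m'.
Proof.
have hl : inS Mgt1 (lg T) by apply: inS_lg.
elim: n m' => [|n IH] m' Lm'.
  have [a E] := Lm'.
  have K : lg (exm (kst a * lg T)) = kst a * lg T by apply: exmK; apply: inSZ.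
  have L : LG T 0 (exm (kst a * lg T)) by exists a.
  exists (exm (kst a * lg T)) => //.
  rewrite (@cmp_mn_lin 0 _ a 0) ?addr0 ?(cmp0 dxl) ?addr0 -?E ?EXP_lg //; last exact: inS0.
  exact: LGT_X L.
have [a [g [hg E]]] := Lm'.
have hg1 : inS (LG l n) g by apply: inS_sub hg => p [].
have hg2 : inS Mgt1 g by apply: inS_sub hg => p [].
have [f [hf Ef f1]] := cmp_series_onto IH hg1.
have K : lg (exm (kst a * lg T + f)) = kst a * lg T + f.
  by apply: exmK; apply: inSD; [apply: inSZ|apply: f1].
have L : LG T n.+1 (exm (kst a * lg T + f)).
  by exists a, f; split => //; apply: inS_and => //; apply: f1.
by exists (exm (kst a * lg T + f)) => //; rewrite (cmp_mn_lin K (LGT_X L) hf) Ef -E EXP_lg.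
Qed.

Lemma cmp_LG_onto n g : inS (LG l n) g -> exists2 f, inS (LG T n) f & cmp f (mn l) = g.
Proof. by move=> /(cmp_series_onto (@cmp_monomial_onto n))[f [? ? _]]; exists f. Qed.

End MonomialBase.

(** * Identification of LE by supports; associativity of composition *)

Lemma LEgroupE n : LEgroup log T n = LG T n.
Proof.
elim: n => [|n IH].
  apply/seteqP; split => m /=.
    move=> [a _ <-]; exists a; rewrite /powT -[hscale a (log T)]/(hscale a (hv (lg T))).
    have -> : hscale a (hv (lg T)) = hv (kst a * lg T) by apply/funext => p; rewrite hv_kstM.
    by rewrite -/(exm _) exmK //; apply: inSZ; apply: inS_lg.
  move=> [a E]; exists a => //; rewrite /powT -[hscale a (log T)]/(hscale a (hv (lg T))).
  have -> : hscale a (hv (lg T)) = hv (kst a * lg T) by apply/funext => p; rewrite hv_kstM.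
  by rewrite -/(exm _) -E lgK.
have hE a : powT log T a = exm (kst a * lg T).
  rewrite /powT -[hscale a (log T)]/(hscale a (hv (lg T))).
  by have -> : hscale a (hv (lg T)) = hv (kst a * lg T) by apply/funext => p; rewrite hv_kstM.
have h1 a : inS Mgt1 (kst a * lg T) by apply: inSZ; apply: inS_lg.
apply/seteqP; split => m /=.
  move=> [a [g [[og hg] ->]]]; have hh := omega_hahn og.
  have hg' : inS (LG T n `&` Mgt1) (mkHS hh) by rewrite -IH.
  have hg1 : inS Mgt1 (mkHS hh) by apply: inS_sub hg' => p [].
  by exists a, (mkHS hh); split => //; rewrite lgM hE -[expm log g]/(exm (mkHS hh)) !exmK.
move=> [a [g [hg E]]]; exists a, (hv g).
have hg1 : inS Mgt1 g by apply: inS_sub hg => p [].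
split; last by rewrite hE -[expm log _]/(exm g) -exmD // -E lgK.
split; last by rewrite IH.
by apply: inS_omega; apply: (inS_sub _ hg) => p [/LGT_X].
Qed.

(** A composite of a series of level n with [ell k] has its support in [D (maxn k n)]. Conversely
    [D j] is level j + j over [ell j], onto which composition with [ell j] is surjective. *)
Lemma LE_LEh f : LE log T comp (hv f) <-> LEh f.
Proof.
split.
  move=> [k _ [f0 [n _ [of0 sf0]] E]]; have hh := omega_hahn of0.
  have hf0 : inS (LG T n) (mkHS hh) by rewrite -LEgroupE.
  have -> : f = cmp (mkHS hh) (mn (ell k)).
    by rewrite cmpE -ell_iter E hliftK.
  exists (maxn k n); apply: inS_sub (cmp_LG (composable_ell k) hf0).
  by apply: LG_D; rewrite ?leq_maxl ?leq_maxr.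
move=> [j hf]; have [f0 hf0 <-] := cmp_LG_onto (composable_ell j) hf.
exists j => //; exists (hv f0).
  exists (j + j)%N => //; split; first by apply: inS_omega; apply: inS_LGT_X hf0.
  by rewrite LEgroupE.
by rewrite ell_iter -(hv_cmp (composable_ell j)) //; apply: inS_LGT_X hf0.
Qed.

Lemma LE_hahn (f : M -> R) : LE log T comp f -> exists2 F : H, LEh F & f = hv F.
Proof.
move=> Lf; have hh : hahn f.
  move: Lf => [k _ [f0 [n _ [of0 sf0]] <-]]; have hh := omega_hahn of0.
  have hf0 : inS (LG T n) (mkHS hh) by rewrite -LEgroupE.
  rewrite ell_iter -[f0]/(hv (mkHS hh)) -(hv_cmp (composable_ell k)); first exact: hvP.
  exact: inS_LGT_X hf0.
by exists (mkHS hh) => //; apply/LE_LEh.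
Qed.

(* The uniqueness argument for composition: both sides agree on T, commute
   with exponentials and are strongly linear. *)
Lemma cmp_assoc g x n f : composable x -> inS X g -> above g -> inS (LG T n) f ->
  (forall k h, (k <= n)%N -> inS (LG T k) h -> inS X (cmp h g)) ->
  cmp (cmp f g) x = cmp f (cmp g x).
Proof.
move=> dxx Xg ag hf hX.
have dxg : composable g by split => //; apply: inS_omega.
have dxgx : composable (cmp g x) by apply: composable_cmp.
have XT : inS X (lg T) by apply: Xlog; apply: (@LGT_X 0); apply: LG_base.
have series k : (k <= n)%N -> (forall m, LG T k m -> cmp (cmp (mn m) g) x = cmp (mn m) (cmp g x)) ->
    forall h, inS (LG T k) h -> cmp (cmp h g) x = cmp h (cmp g x).
  move=> kn hm h hh; have [s1 ->] := cmp_sum dxg (inS_LGT_X hh).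
  have Xm m : h m != 0 -> inS X (cmp (mn m) g).
    by move=> hm0; apply: (hX k) => //; apply: inS_tm; apply: hh.
  have [|_ ->] := cmp_ssum dxx s1.
    move=> m; have [->|hm0] := eqVneq (h m) 0; first by rewrite kst0 mul0r; apply: inS0.
    by apply: inSZ; apply: Xm.
  have [_ ->] := cmp_sum dxgx (inS_LGT_X hh).
  apply: eq_sum => m; have [->|hm0] := eqVneq (h m) 0; first by rewrite kst0 !mul0r (cmp0 dxx).
  by rewrite (cmpZ dxx) ?hm //; [apply: hh|apply: Xm].
have cT : cmp (cmp (lg T) g) x = cmp (lg T) (cmp g x).
  by rewrite !cmp_lgT // (cmp_LOG dxx) //; case: ag.
have step k m a h : (k <= n)%N -> LG T k m -> lg m = kst a * lg T + h -> inS X h -> inS X (cmp h g) ->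
    cmp (cmp h g) x = cmp h (cmp g x) -> cmp (cmp (mn m) g) x = cmp (mn m) (cmp g x).
  move=> kn Lm E Xh Xhg Eh; have Xm := LGT_X Lm.
  have XcT : inS X (cmp (lg T) g) by rewrite cmp_lgT //; apply: inS_LOG => //; case: ag.
  rewrite (cmp_mn dxg) // (cmp_EXP dxx); last first.
    by rewrite -(cmp_mn dxg) //; apply: (hX k) => //; apply: inS_tm.
  rewrite (cmp_mn dxgx) // E (cmpD dxg) ?(cmpZ dxg) //; last exact: inSZ.
  rewrite (cmpD dxgx) ?(cmpZ dxgx) //; last exact: inSZ.
  rewrite (cmpD dxx) ?(cmpZ dxx) ?cT ?Eh //; exact: inSZ.
have mon k : (k <= n)%N -> forall m, LG T k m -> cmp (cmp (mn m) g) x = cmp (mn m) (cmp g x).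
  elim: k => [|k IH] kn m Lm.
    have [a E] := Lm; apply: (step 0%N m a 0) => //; rewrite ?addr0 //; first exact: inS0.
      by rewrite (cmp0 dxg); apply: inS0.
    by rewrite (cmp0 dxg) (cmp0 dxx) (cmp0 dxgx).
  have [a [h [hh E]]] := Lm.
  have hh1 : inS (LG T k) h by apply: inS_sub hh => p [].
  apply: (step k.+1 m a h) => //.
  - exact: inS_LGT_X hh1.
  - by apply: (hX k) => //; apply: ltnW.
  - by apply: (series k) => //; [apply: ltnW|apply: IH; apply: ltnW].
exact: (series n (leqnn n) (mon n (leqnn n))).
Qed.

(** If log q increases by t from x to y, then 1 - e^(-t) is the relative decrease of q^-1. It is at
    most 1, and comparable with t as long as t is bounded. *)
Lemma kappa_le (t : H) : 1 - EXP (- t) <= t.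
Proof. by have := EXP_ge1D hlog (- t); lra. Qed.

Lemma kappa_ge (t : H) : 0 <= t -> t / (1 + t) <= 1 - EXP (- t).
Proof.
move=> t0; have h : 0 < 1 + t by lra.
have : EXP (- t) <= (1 + t)^-1 by rewrite (EXPN hlog) lef_pV2 ?posrE ?EXP_gt0 //; apply: (EXP_ge1D hlog).
have -> : t / (1 + t) = 1 - (1 + t)^-1 by field; rewrite gt_eqF.
lra.
Qed.

Lemma kappa_gt0 (t : H) : 0 < t -> 0 < 1 - EXP (- t).
Proof. by move=> t0; rewrite subr_gt0 -[ltRHS](EXP0 hlog) (EXP_ltE hlog) oppr_lt0. Qed.

(** Since g dominates a log T, the leading monomial of log q is s = [lm g]. If q were at most s^2,
    then (log q)^3, which has the size of s^3, would exceed q against the growth axiom. *)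
Lemma lm_lg_sq n q a g : (1%g < q)%O -> lg q = kst a * lg T + g ->
  inS (LG T n `&` Mgt1) g -> g != 0 -> (lm g * lm g < q)%g%O /\ 0 < g.
Proof.
move=> q1 E hg g0; have [Ls s1] := hg _ (proj1 (lmP g0)); set s := lm g in Ls s1 *.
have pl : prec (kst a * lg T) g by apply/precZl/prec_lead_mn => //; apply: LG_lg_prec Ls s1.
have lq0 : 0 < lg q by rewrite lg_gt0.
split; last first.
  rewrite ltNge; apply/negP; rewrite le_eqVlt (negPf g0) /= => gn.
  by have := prec_lt0D pl gn; rewrite addrC -E ltNge (ltW lq0).
have [_ lq] := prec_lead_add pl; rewrite addrC -E -/s in lq.
rewrite ltNge; apply/negP => qs.
have h3 := lgX_lt hlog 3 q1.
have n0 : lg q ^+ 3 != 0 by rewrite expf_neq0 // gt_eqF.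
have l3 : lm (lg q ^+ 3) = (s * (s * s))%g.
  by rewrite !exprS expr0 mulr1 !lmM ?mulf_neq0 ?gt_eqF // lq.
have : prec (mn (s * s)%g) (lg q ^+ 3).
  apply: lm_prec n0 _ => m h; rewrite l3; have -> : m = (s * s)%g.
    exact: (@inS_tm _ R _ [set (s * s)%g] 1 (s * s)%g erefl m h).
  by rewrite -[ltLHS]mul1g ltmM2r.
move=> /prec_lt /(_ (exprn_gt0 _ lq0)) /andP[_ h].
have := lt_trans h h3; rewrite mn_lt ltNge qs //.
Qed.

(** * Increments between two points *)

Section Monotonicity.
Variables x y : H.
Hypotheses (dxx : composable x) (dxy : composable y) (xy : x < y).

Local Notation dl f := (cmp f y - cmp f x).
Let lam := LOG y - LOG x.

Lemma lam_gt0 : 0 < lam.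
Proof. by rewrite subr_gt0 LOG_ltE //; case: dxx => _ []; case: dxy => _ []. Qed.

Lemma dl_lgT : dl (lg T) = lam.
Proof. by rewrite !cmp_lgT. Qed.

Lemma dl_lin a g : inS X g -> dl (kst a * lg T + g) = kst a * lam + dl g.
Proof.
move=> hg; have XT : inS X (lg T) by apply: Xlog; apply: (@LGT_X 0); apply: LG_base.
have XaT : inS X (kst a * lg T) by apply: inSZ.
by rewrite (cmpD dxy) ?(cmpD dxx) ?(cmpZ dxy) ?(cmpZ dxx) // -dl_lgT; ring.
Qed.

Lemma dl_mn m : X m -> dl (mn m) = cmp (mn m) x * (EXP (dl (lg m)) - 1).
Proof.
move=> Xm; rewrite (cmp_mn dxy) // (cmp_mn dxx) // (EXPB hlog).
by field; apply: EXP_neq0.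
Qed.

Lemma lgT_gt0 : 0 < lg T. Proof. by rewrite lg_gt0; case: hT. Qed.

(** The invariant of the induction on levels, measured in units of [lam], the increment of log T. A
    real factor depending on [q] is enough because q o x exceeds every real, see [lam_prec]. *)
Definition mon_lg n := forall q, LG T n q -> (1%g < q)%O ->
  exists2 c : R, 0 < c & kst c * lam <= dl (lg q).

Section Level.
Variable n : nat.
Hypothesis mon : mon_lg n.

Lemma dl_lg_gt0 q : LG T n q -> (1%g < q)%O -> 0 < dl (lg q).
Proof.
move=> Lq q1; have [c c0] := mon Lq q1; apply: lt_le_trans.
by rewrite mulr_gt0 ?kst_gt0 // lam_gt0.
Qed.

Lemma cmp_mn_x_gt0 q : LG T n q -> 0 < cmp (mn q) x.
Proof. by move=> /LGT_X; apply: cmp_mn_gt0. Qed.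

Lemma dl_mn_gt0 q : LG T n q -> (1%g < q)%O -> 0 < dl (mn q).
Proof.
move=> Lq q1; rewrite dl_mn; last exact: LGT_X Lq.
rewrite mulr_gt0 ?cmp_mn_x_gt0 // subr_gt0 -(EXP0 hlog) (EXP_ltE hlog).
exact: dl_lg_gt0.
Qed.

(** The increment of q is q o x times e^t - 1 >= t, where t, the increment of log q, is at least a
    positive real multiple of [lam], and q o x exceeds all reals. *)
Lemma lam_prec q : LG T n q -> (1%g < q)%O -> prec lam (dl (mn q)).
Proof.
move=> Lq q1; have Xq := LGT_X Lq; have [c c0 hc] := mon Lq q1.
have qx0 := cmp_mn_x_gt0 Lq.
have [_ p1] := cmp_mn_above dxx Xq q1.
have l0 : kst c * lam != 0 by rewrite mulf_neq0 ?gt_eqF ?lam_gt0 // kst_gt0.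
have := precMr p1 l0; rewrite mul1r => /(precZl c^-1).
rewrite mulrA -kstM mulVf ?gt_eqF // kst1 mul1r => h.
apply: prec_leR h _; rewrite dl_mn // !gtr0_norm.
- by rewrite ler_pM2l //; apply: le_trans hc _; have := EXP_ge1D hlog (dl (lg q)); lra.
- by rewrite -dl_mn //; apply: dl_mn_gt0.
- by rewrite mulr_gt0 // mulr_gt0 ?kst_gt0 // lam_gt0.
Qed.

(** In the increment (q o x)(e^t - 1), with t the increment of log q, passing from p to q makes the
    first factor larger by more than every real multiple and also increases the second. *)
Lemma dl_mn_prec p q : LG T n p -> LG T n q -> (1%g < p)%O -> (p < q)%O ->
  prec (dl (mn p)) (dl (mn q)).
Proof.
move=> Lp Lq p1 pq; have Xp := LGT_X Lp; have Xq := LGT_X Lq.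
have q1 := lt_trans p1 pq.
have hd : dl (lg p) < dl (lg q).
  have Lr : LG T n (p^-1 * q)%g by apply: LG_M => //; apply: LG_V.
  have r1 : (1%g < p^-1 * q)%g%O by rewrite -(mulVg p) ltmM2l.
  have E : lg q = lg p + lg (p^-1 * q)%g by rewrite -lgM (mulVKg p).
  have := dl_lg_gt0 Lr r1; have Xr := LGT_X Lr; rewrite E.
  by rewrite (cmpD dxy) ?(cmpD dxx); try exact: Xlog; lra.
rewrite !dl_mn //; apply: precM; first exact: cmp_mn_prec.
  by rewrite gt_eqF // subr_gt0 -(EXP0 hlog) (EXP_ltE hlog); apply: dl_lg_gt0.
have h1 : 1 < EXP (dl (lg p)) by rewrite -(EXP0 hlog) (EXP_ltE hlog); apply: dl_lg_gt0.
have h2 : EXP (dl (lg p)) < EXP (dl (lg q)) by rewrite (EXP_ltE hlog).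
by rewrite !gtr0_norm; lra.
Qed.

(** The increment of [g] is the sum of the increments of its terms, and those of all terms but the
    leading one are negligible by [dl_mn_prec]. *)
Lemma dl_lead g : inS (LG T n `&` Mgt1) g -> g != 0 ->
  prec (dl g - kst (lc g) * dl (mn (lm g))) (dl (mn (lm g))).
Proof.
move=> hg g0; have [Ls s1] := hg _ (proj1 (lmP g0)); set s := lm g in Ls s1 *.
have Xg : inS X g by apply: inS_sub hg => p [/LGT_X].
have Xs := LGT_X Ls; have Xms : inS X (mn s : H) by apply: inS_tm.
have S0 : dl (mn s) != 0 by rewrite gt_eqF // dl_mn_gt0.
have [sy Ey] := cmp_sum dxy Xg; have [sx Ex] := cmp_sum dxx Xg.
have [ty Fy] := cmp_sum dxy (@inSZ _ _ _ _ (lc g) _ Xms).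
have [tx Fx] := cmp_sum dxx (@inSZ _ _ _ _ (lc g) _ Xms).
have -> : dl g - kst (lc g) * dl (mn s) = dl g - dl (kst (lc g) * mn s).
  by rewrite (cmpZ dxy) // (cmpZ dxx) //; ring.
rewrite Ey Ex Fy Fx -!sumB //; last 2 first.
- exact: summableB.
- exact: summableB.
apply: prec_sum => // m.
have -> : kst (g m) * cmp (mn m) y - kst (g m) * cmp (mn m) x
   - (kst ((kst (lc g) * mn s) m) * cmp (mn m) y - kst ((kst (lc g) * mn s) m) * cmp (mn m) x)
   = kst (g m - (kst (lc g) * mn s) m) * dl (mn m) by rewrite kstD kstN; ring.
rewrite -tmE hv_tm; have [->|ms] := eqVneq m s.
  by rewrite subrr kst0 mul0r; apply: prec0.
rewrite subr0; have [->|gm] := eqVneq (g m) 0; first by rewrite kst0 mul0r; apply: prec0.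
have [Lm m1] := hg _ gm.
by apply: precZl; apply: dl_mn_prec => //; rewrite lt_neqAle ms; apply: lm_max.
Qed.

End Level.

Lemma pos_of_lg q : (1%g < q)%O -> 0 < lg q. Proof. by rewrite lg_gt0. Qed.

Lemma mon_lg_all n : mon_lg n.
Proof.
have lin q a : lg q = kst a * lg T -> (1%g < q)%O -> 0 < a.
  move=> E /pos_of_lg; rewrite E pmulr_lgt0 ?lgT_gt0 // kst_gt0.
  by [].
elim: n => [|n IH] q.
  move=> [a E] q1; exists a; first exact: lin E q1.
  by rewrite -(addr0 (_ * lg T)) in E; rewrite E dl_lin ?(cmp0 dxx) ?(cmp0 dxy) ?subrr ?addr0 //; apply: inS0.
move=> [a [g [hg E]]] q1; have [g0|g0] := eqVneq g 0.
  rewrite g0 in E; exists a; first by apply: lin q1; rewrite E addr0.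
  by rewrite E dl_lin ?(cmp0 dxx) ?(cmp0 dxy) ?subrr ?addr0 //; apply: inS0.
have [Ls s1] := hg _ (proj1 (lmP g0)); set s := lm g in Ls s1.
have Xg : inS X g by apply: inS_sub hg => p [/LGT_X].
have pl : prec (lg T) g by apply: prec_lead_mn => //; apply: LG_lg_prec Ls s1.
have gp : 0 < g.
  rewrite ltNge; apply/negP; rewrite le_eqVlt (negPf g0) /= => gn.
  have := prec_lt0D (precZl a pl) gn; rewrite addrC -E ltNge => /negP; apply.
  by apply/ltW/pos_of_lg.
have cg : 0 < lc g by move: gp; rewrite gt0E => /andP[].
(* Any positive constant would do: up to a negligible error [dl g] is [lc g] times the increment of
   [s], which dominates every multiple of [lam]. *)
exists 1 => //; rewrite kst1 mul1r E dl_lin //.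
have pL := lam_prec IH Ls s1.
have h1 := precD (dl_lead IH hg g0) (precZl (a - 1) pL).
have S0 := dl_mn_gt0 IH Ls s1.
have cS : 0 < kst (lc g) * dl (mn s) by rewrite mulr_gt0 ?kst_gt0.
have /andP[h2 _] := prec_lt (precZr (lt0r_neq0 cg) h1) cS.
by move: h2; rewrite kstD kstN kst1 -/s; lra.
Qed.

Local Notation kappa q := (1 - EXP (- dl (lg q))).

Lemma lam_le : lam * x <= y - x.
Proof.
have [_ [x0 _]] := dxx; have [_ [y0 _]] := dxy.
have := EXP_ge1D hlog lam; rewrite (EXPB hlog) !EXP_LOG // ler_pdivlMr //.
by rewrite mulrDl mul1r; lra.
Qed.

(** This handles powers of T: [kappa q] <= c lam <= c (y - x)/x, and 1/x is infinitesimal while q o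
    x exceeds all reals. *)
Lemma kappa_lam q c : X q -> (1%g < q)%O -> 0 < dl (lg q) -> dl (lg q) <= kst c * lam ->
  prec (kappa q) ((y - x) * cmp (mn q) x).
Proof.
move=> Xq q1 d0 dc; have [_ [x0 px]] := dxx.
have [q0 pq] := cmp_mn_above dxx Xq q1.
have xi : prec x^-1 (cmp (mn q) x).
  apply: prec_trans pq; have xn : x^-1 != 0 by rewrite invr_eq0 gt_eqF.
  by have := precMr px xn; rewrite mul1r mulfV ?gt_eqF.
have yx0 : 0 < y - x by rewrite subr_gt0.
have h := precMl (precZl c xi) (lt0r_neq0 yx0).
apply: prec_le h; have k0 : 0 <= kappa q.
  exact/ltW/kappa_gt0.
have l1 : lam <= (y - x) * x^-1 by rewrite ler_pdivlMr //; apply: lam_le.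
have c0 : 0 < (kst c : H).
  by have := lt_le_trans d0 dc; rewrite pmulr_lgt0 // lam_gt0.
have l2 : kappa q <= (y - x) * (kst c * x^-1).
  apply: le_trans (kappa_le _) _; apply: le_trans dc _.
  by rewrite mulrCA ler_pM2l.
by rewrite !ger0_norm //; apply: le_trans l2.
Qed.

(* For q > 1 the increment of q^-1 from x to y is -(q o x)^-1 * kappa q, so this
   says that it is negligible with respect to y - x. *)
Lemma kappa_prec n q : LG T n q -> (1%g < q)%O -> prec (kappa q) ((y - x) * cmp (mn q) x).
Proof.
have yx0 : 0 < y - x by rewrite subr_gt0.
have lin q' a n' : LG T n' q' -> (1%g < q')%O -> lg q' = kst a * lg T ->
    prec (kappa q') ((y - x) * cmp (mn q') x).
  move=> Lq q1 E; apply: (@kappa_lam _ a) => //; first exact: LGT_X Lq.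
    exact: (dl_lg_gt0 (@mon_lg_all n')).
  by rewrite E -[kst a * lg T]addr0 dl_lin ?(cmp0 dxx) ?(cmp0 dxy) ?subrr ?addr0 //; apply: inS0.
elim: n q => [|n IH] q Lq q1.
  by have [a E] := Lq; apply: (lin q a 0%N).
have [a [g [hg E]]] := Lq; have [g0|g0] := eqVneq g 0.
  by apply: (lin q a n.+1) => //; rewrite E g0 addr0.
have [Ls s1] := hg _ (proj1 (lmP g0)).
have [s2 gp] := lm_lg_sq q1 E hg g0; set s := lm g in Ls s1 s2.
have Xg : inS X g by apply: inS_sub hg => p [/LGT_X].
have Xs := LGT_X Ls; have Xq := LGT_X Lq.
have cg : 0 < lc g by move: gp; rewrite gt0E => /andP[].
have mon := @mon_lg_all n.
have := IH _ Ls s1; set t := dl (lg s).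
have t0 : 0 < t by apply: (dl_lg_gt0 mon).
have kt := kappa_gt0 t0.
have sx0 := cmp_mn_gt0 dxx Xs; have qx0 := cmp_mn_gt0 dxx Xq.
set S := cmp (mn s) x in sx0 *; set Q := cmp (mn q) x in qx0 *.
have S2Q : S * S < Q.
  by rewrite -(cmp_mnM dxx) // (cmp_ltE dxx) ?mn_lt //; apply: inS_tm => //; apply: XM.
have S1 : 1 < S by have [_ /prec_lt_norm] := cmp_mn_above dxx Xs s1; rewrite normr1 gtr0_norm.
have SQ : S < Q by apply: lt_trans S2Q; rewrite -[ltLHS]mulr1 ltr_pM2l.
have kq := kappa_gt0 (dl_lg_gt0 (@mon_lg_all n.+1) Lq q1).
(* Dichotomy on the increment t of log s. If t >= 1/2, then [kappa s] >= t/(1 + t) >= 1/3 while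
   [kappa q] < 1, so the induction hypothesis for s together with S < Q suffices. *)
move=> hk; have [t2|t2] := lerP (1 / 2%:R) t.
  have k3 : 1 / 3%:R <= 1 - EXP (- t).
    apply: le_trans (kappa_ge (ltW t0)); rewrite ler_pdivlMr; lra.
  have := precZl 3%:R hk; rewrite kst_nat => hk3.
  apply: prec_norm hk3 _; rewrite !gtr0_norm ?mulr_gt0 //; try lra.
    by have : 0 < EXP (- dl (lg q)) by [apply: EXP_gt0]; lra.
  by rewrite ler_pM2l // ltW.
(* If t < 1/2, three factors 2 arise: t <= 2 [kappa s]; e^t - 1 <= t/(1 - t) <= 2t; and the
   increment of log q is at most twice its main part, [lc g] times the increment of s. Hence
   [kappa q] <= 8 (lc g) S [kappa s], and the induction hypothesis times S bounds this by (y - x)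
   S^2, which is less than (y - x) Q. *)
have tk : t <= 2%:R * (1 - EXP (- t)).
  have := kappa_ge (ltW t0); rewrite ler_pdivrMr; nra.
have hE : dl (mn s) <= S * (2%:R * t).
  rewrite dl_mn // ler_pM2l //; have := EXP_le_inv hlog (_ : t < 1) => /(_ ltac:(lra)).
  rewrite -/t -[X in _ <= X -> _]mul1r ler_pdivlMr; last lra.
  nra.
have S0 := dl_mn_gt0 mon Ls s1.
have hq : dl (lg q) <= 2%:R * (kst (lc g) * dl (mn s)).
  rewrite E dl_lin //; have pL := lam_prec mon Ls s1.
  have h1 := precD (dl_lead mon hg g0) (precZl a pL).
  have cS : 0 < kst (lc g) * dl (mn s) by rewrite mulr_gt0 ?kst_gt0.
  by have /andP[] := prec_lt (precZr (lt0r_neq0 cg) h1) cS; rewrite -/s; lra.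
have h : prec (kst (8%:R * lc g) * (1 - EXP (- t)) * S) ((y - x) * S * S).
  by apply: precMr; [apply: precZl|rewrite gt_eqF].
have cgk : 0 < (kst (lc g) : H) by rewrite kst_gt0.
apply: prec_norm h _; rewrite !gtr0_norm ?mulr_gt0 //; last 2 first.
- by rewrite kst_gt0 mulr_gt0.
- by rewrite -mulrA ler_pM2l // ltW.
apply: le_trans (kappa_le _) _; apply: le_trans hq _.
have : kst (lc g) * dl (mn s) <= kst (lc g) * (S * (2%:R * (2%:R * (1 - EXP (- t))))).
  rewrite ler_pM2l //; apply: le_trans hE _; rewrite ler_pM2l //; lra.
rewrite kstM kst_nat; lra.
Qed.

Lemma dl_small n e : inS (LG T n) e -> inS Mlt1 e -> prec (dl e) (y - x).
Proof.
move=> he e1; have Xe := inS_LGT_X he; have d0 : y - x != 0 by rewrite subr_eq0 gt_eqF.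
have [sy ->] := cmp_sum dxy Xe; have [sx ->] := cmp_sum dxx Xe.
rewrite -sumB //; apply: prec_sum => // m; rewrite -mulrBr.
have [->|em] := eqVneq (e m) 0; first by rewrite kst0 mul0r; apply: prec0.
apply: precZl; have Lm := he _ em; have m1 := e1 _ em; have Xm := LGT_X Lm.
have p1 : (1%g < m^-1)%g%O by rewrite ltm1V.
have := kappa_prec (LG_V Lm) p1; rewrite lgV.
have Xl := Xlog Xm; rewrite (cmpN dxy) // (cmpN dxx) // => hk.
have mx0 : cmp (mn m) x != 0 by rewrite gt_eqF // cmp_mn_gt0.
move: (precMr hk mx0); rewrite -mulrA -(cmp_mnM dxx) ?mulVg ?(cmp_mn1 dxx) ?mulr1 //; last exact: XV.
by rewrite dl_mn // => /precNl; rewrite -mulNr mulrC opprB opprD !opprK.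
Qed.

End Monotonicity.

Lemma cmp_small_contract n e x y : composable x -> composable y -> x != y -> inS (LG T n) e -> inS Mlt1 e ->
  prec (cmp e y - cmp e x) (y - x).
Proof.
move=> dxx dxy xy he e1; case: (ltgtP x y) xy => // [h|h] _; first exact: dl_small he e1.
by rewrite -(opprB (cmp e x)) -(opprB x); apply/precNl/precNr/(dl_small dxy dxx h he e1).
Qed.

Lemma cmp_TD_lt n e x y : composable x -> composable y -> x < y -> inS (LG T n) e -> inS Mlt1 e ->
  cmp (mn T + e) x < cmp (mn T + e) y.
Proof.
move=> dxx dxy xy he e1; have XT : inS X (mn T : H) by apply: inS_tm; apply: (@LGT_X 0); apply: LG_base.
have Xe := inS_LGT_X he; rewrite (cmpD dxx) // (cmpD dxy) // !cmp_T //.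
have d0 : 0 < y - x by rewrite subr_gt0.
have /andP[] := prec_lt (dl_small dxx dxy xy he e1) d0; lra.
Qed.

(** * Closure of a fixed level under composition with w + u *)

Lemma LG_inv l n q : LG l n q -> exists a g,
  [/\ lg q = kst a * lg l + g, inS Mgt1 g &
      g = 0 \/ exists2 n', n = n'.+1 & inS (LG l n') g].
Proof.
case: n => [[a E]|n [a [g [hg E]]]].
  by exists a, 0; rewrite addr0; split => //; [apply: inS0|left].
exists a, g; split => //; first by apply: inS_sub hg => p [].
by right; exists n => //; apply: inS_sub hg => p [].
Qed.

Lemma inS_LG_EXP l n f : inS (LG l n) f -> inS (LG l n.+1) (EXP f).
Proof.
move=> hf; rewrite (hs_split f) EXPE; try exact: inS_rst.
apply: inSM (@LG_M _ _ _ _ _ l n.+1) _ _.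
  rewrite mulrC; apply: inSZ; apply: inS_tm.
  by apply: LG_exp; [apply: inS_rst2|apply: inS_rst].
apply: inS_ps; [exact: LG_1|exact: LG_M|].
by apply: inS_sub (@LG_S _ _ _ _ hlog l n) _; apply: inS_rst2.
Qed.

(** [LOG] and [EXP] separately may leave the level, but a real power does not: on the leading
    monomial it is [LG_pow], and the remaining factor is obtained by power series from [eps x]. *)
Lemma inS_LG_powR l n x a : 0 < x -> inS (LG l n) x -> inS (LG l n) (EXP (kst a * LOG x)).
Proof.
move=> x0 hx; have xn : x != 0 by rewrite gt_eqF.
have he : inS (LG l n) (eps x) by apply: inS_eps hx; [exact: LG_1|exact: LG_M|exact: LG_V].
have e1 : inS Mlt1 (ps lnc (eps x)) by apply: inS_lt1_ps; [rewrite /lnc|apply: eps_lt1].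
have hp : inS (LG l n) (ps lnc (eps x)) by apply: inS_ps he; [exact: LG_1|exact: LG_M].
rewrite LOGE !mulrDr -kstM EXPE; last 2 first.
- by apply: inSZ; apply: inS_lg.
- exact: inSZ.
apply: inSM (@LG_M _ _ _ _ _ l n) _ _.
  by rewrite mulrC; apply: inSZ; apply: inS_tm; apply: LG_pow; apply: hx; case: (lmP xn).
by apply: inS_ps (inSZ hp); [exact: LG_1|exact: LG_M].
Qed.

Definition below l n : set M := [set q | LG l n.+1 q /\ forall p, LG l n p -> (q < p)%O].

Lemma below_lt1 l n : below l n `<=` Mlt1.
Proof. by move=> q [_]; apply; apply: LG_1. Qed.

Lemma below_LG l n : below l n `<=` LG l n.+1. Proof. by move=> q []. Qed.

Lemma belowMl l n p q : LG l n p -> below l n q -> below l n (p * q)%g.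
Proof.
move=> Lp [Lq hq]; split; first by apply: LG_M => //; apply: LG_S.
move=> r Lr; have := hq (p^-1 * r)%g (LG_M (LG_V Lp) Lr).
by rewrite -(ltmM2l p) mulVKg.
Qed.

Lemma belowM l n p q : below l n p -> below l n q -> below l n (p * q)%g.
Proof.
move=> [Lp hp] bq; have [Lq hq] := bq; split; first exact: LG_M.
move=> r Lr; rewrite -[ltRHS]mul1g; apply: ltmM; first by apply: hp; apply: LG_1.
exact/ltW/hq.
Qed.

(** By [LG_convex] an infinitesimal monomial that is new at level n + 1 is smaller than everything
    of level n. *)
Lemma inS_split l n u : inS (LG l n.+1) u -> inS Mlt1 u ->
  inS (below l n) (rst (~` LG l n) u).
Proof.
move=> hu u1 m; have h := @inS_rst _ _ _ (~` LG l n) u m.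
move=> um; have nm := h um; have Lm := inS_rst2 hu um; have m1 := inS_rst2 u1 um.
by split => // p; apply: LG_convex Lm nm m1.
Qed.

Lemma aboveD w u : above w -> inS Mlt1 u -> above (w + u).
Proof.
move=> /aboveP hw hu; apply/aboveP => r; have := hw (r + 1).
have := inS_Mlt1_le (@ltr01 R) hu; rewrite ltr_norml kstD !kst1; lra.
Qed.

Lemma composable_LG k n v : inS (LG (ell k) n) v -> above v -> composable v.
Proof. by move=> hv av; split => //; apply: inS_omega; apply: inS_sub hv; apply: LG_X. Qed.

Lemma cmp_mn_powR v q a g : composable v -> X q -> inS X g -> lg q = kst a * lg T + g ->
  cmp (mn q) v = EXP (kst a * LOG v) * EXP (cmp g v).
Proof.
move=> dv Xq Xg E; have XT : inS X (lg T) by apply: Xlog; apply: (@LGT_X 0); apply: LG_base.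
by rewrite (cmp_mn dv) // E (cmpD dv) ?(cmpZ dv) ?(cmp_lgT dv) ?(EXPD hlog) //; apply: inSZ.
Qed.

Lemma inS_cmp_series (P : set M) v j : composable v ->
  (forall q, LG T j q -> inS P (cmp (mn q) v)) -> forall f, inS (LG T j) f -> inS P (cmp f v).
Proof.
move=> dv h f hf; have [_ ->] := cmp_sum dv (inS_LGT_X hf); apply: inS_sumI => q.
have [->|fq] := eqVneq (f q) 0; first by rewrite kst0 mul0r; apply: inS0.
by apply: inSZ; apply: h; apply: hf.
Qed.

(* Perturbing the argument by a series that is smaller than all of LG l n only
   changes the values by such series. *)
Lemma cmp_perturb l n x u j : inS (LG l n) x -> inS (below l n) u -> composable x -> composable (x + u) ->
  (forall k h, (k <= j)%N -> inS (LG T k) h -> inS (LG l n) (cmp h x)) ->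
  forall f, inS (LG T j) f -> inS (below l n) (cmp f (x + u) - cmp f x).
Proof.
move=> hx hu dxx dxu hX; have [_ [x0 _]] := dxx; have [_ [xu0 _]] := dxu.
have hxu : inS (below l n) (u / x).
  apply: (inSM (P := below l n) (Q := LG l n)) hu _; first by move=> a b ha hb; rewrite omulgC; apply: belowMl.
  by apply: inS_inv hx; [exact: LG_1|exact: LG_M|exact: LG_V].
have hps : inS (below l n) (ps lnc (u / x)) by apply: inS_ps0 hxu => //; exact: belowM.
have EL : LOG (x + u) = LOG x + ps lnc (u / x).
  have Exu : x + u = x * (1 + u / x) by field; rewrite gt_eqF.
  have p0 : 0 < 1 + u / x by move: xu0; rewrite Exu pmulr_rgt0.
  rewrite Exu LOGM // LOG_1D //; exact: inS_sub (@below_lt1 l n) hxu.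
have hE t : inS (below l n) t -> inS (below l n) (EXP t - 1).
  move=> ht; have t1 := inS_sub (@below_lt1 l n) ht.
  (* The constant term is removed because [below l n] is closed under products but does not contain
     1. *)
  pose c k : R := if k is 0%N then 0 else expc k.
  have -> : EXP t - 1 = ps c t.
    rewrite EXP_small // (ps_shift expc t1) (ps_shift c t1) /c kst0 add0r addrC.
    by rewrite [expc 0](_ : _ = 1) ?kst1 ?addKr // /expc fact0 invr1.
  by apply: inS_ps0 ht => //; exact: belowM.
have mon k q : LG T k q -> (k <= j)%N -> (forall i h, (i < k)%N -> inS (LG T i) h ->
    inS (below l n) (cmp h (x + u) - cmp h x)) ->
  inS (below l n) (cmp (mn q) (x + u) - cmp (mn q) x).
  move=> Lq kj IH; have Xq := LGT_X Lq; have [a [g [E g1 hg]]] := LG_inv Lq.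
  have [Xg Dg] : inS X g /\ inS (below l n) (cmp g (x + u) - cmp g x).
    case: hg => [->|[k' Ek hg]].
      by rewrite (cmp0 dxx) (cmp0 dxu) subrr; split; apply: inS0.
    by split; [apply: inS_LGT_X hg|apply: IH hg; rewrite Ek].
  have E1 := cmp_mn_powR dxu Xq Xg E; have E2 := cmp_mn_powR dxx Xq Xg E.
  set t := kst a * ps lnc (u / x) + (cmp g (x + u) - cmp g x).
  have ht : inS (below l n) t by apply: inSD => //; apply: inSZ.
  have -> : cmp (mn q) (x + u) - cmp (mn q) x = cmp (mn q) x * (EXP t - 1).
    rewrite mulrBr mulr1 E1 E2 EL; congr (_ - _); rewrite -!(EXPD hlog); congr EXP.
    by rewrite /t; ring.
  apply: (inSM (P := LG l n) (Q := below l n)) (hE _ ht); first exact: belowMl.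
  by apply: (hX k) => //; apply: inS_tm.
have series k : (k <= j)%N -> forall h, inS (LG T k) h -> inS (below l n) (cmp h (x + u) - cmp h x).
  elim/ltn_ind: k => k IH kj h hh.
  have [s1 ->] := cmp_sum dxu (inS_LGT_X hh); have [s2 ->] := cmp_sum dxx (inS_LGT_X hh).
  rewrite -sumB //; apply: inS_sumI => q; rewrite -mulrBr.
  have [->|hq] := eqVneq (h q) 0; first by rewrite kst0 mul0r; apply: inS0.
  apply: inSZ; apply: (mon k) => //; first exact: hh.
  by move=> i h' ik; apply: IH => //; apply: leq_trans (ltnW ik) kj.
exact: series.
Qed.

(** The target level does not depend on [u], so the fixed point can be sought in one set-sized
    group. For the induction on [i], let u0 be the part of u of level N and ub the rest, smaller
    than all of level N. For q = T^a e^g, the power v^a of v = w + u keeps its level, and e^(g o v)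
    is the product of e^(g o (w + u0)), one level above N by the induction hypothesis for g, and the
    exponential of a series in [below], which is a power series in it. *)
Lemma cmp_LG_closed k (m : nat) w i : inS (LG (ell k) m) w -> above w ->
  forall u, inS (LG (ell k) (m + i)) u -> inS Mlt1 u ->
  forall j f, (j <= i)%N -> inS (LG T j) f -> inS (LG (ell k) (m + i)) (cmp f (w + u)).
Proof.
move=> hw aw; have hw' n : inS (LG (ell k) (m + n)) w.
  by apply: inS_sub hw; apply: LG_le; apply: leq_addr.
elim: i => [|i IH] u hu u1.
  have av := aboveD aw u1; have hv := inSD (hw' 0%N) hu; have dv := composable_LG hv av.
  move=> [|//] f _; apply: inS_cmp_series => // q Lq; have [a E] := Lq.
  rewrite -[_ * lg T]addr0 in E.
  rewrite (cmp_mn_powR dv (LGT_X Lq) (inS0 _) E) (cmp0 dv) (EXP0 hlog) mulr1.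
  by apply: inS_LG_powR => //; case: av.
rewrite addnS in hu *; set N := (m + i)%N in IH hu *.
set u0 := rst (LG (ell k) N) u; set ub := rst (~` LG (ell k) N) u.
have Eu : u = u0 + ub by apply: rst_split.
have hu0 : inS (LG (ell k) N) u0 by apply: inS_rst.
have u01 : inS Mlt1 u0 by apply: inS_rst2.
have hub : inS (below (ell k) N) ub by apply: inS_split.
have ax0 := aboveD aw u01; have hx0 := inSD (hw' i) hu0; have dx0 := composable_LG hx0 ax0.
have av := aboveD aw u1.
have hv : inS (LG (ell k) N.+1) (w + u) by apply: inSD hu; rewrite -addnS.
have dv := composable_LG hv av; have Ev : w + u = w + u0 + ub by rewrite {1}Eu addrA.
have pert j f : (j <= i)%N -> inS (LG T j) f -> inS (below (ell k) N) (cmp f (w + u) - cmp f (w + u0)).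
  move=> ji hf; rewrite Ev.
  apply: (cmp_perturb hx0 hub dx0 _ _ hf); first by rewrite -Ev.
  by move=> k' h k'j; apply: IH => //; apply: leq_trans k'j ji.
move=> j f ji; apply: inS_cmp_series => // q Lq; have [a [g [E g1 hg]]] := LG_inv Lq.
have vpow b : inS (LG (ell k) N.+1) (EXP (kst b * LOG (w + u))).
  by apply: inS_LG_powR => //; case: av.
case: hg => [g0|[j' Ej hg]].
  rewrite g0 in E; rewrite (cmp_mn_powR dv (LGT_X Lq) (inS0 _) E) (cmp0 dv) (EXP0 hlog) mulr1.
  exact: vpow.
have ji' : (j' <= i)%N by rewrite -ltnS -Ej.
rewrite (cmp_mn_powR dv (LGT_X Lq) (inS_LGT_X hg) E).
apply: inSM (@LG_M _ _ _ _ _ (ell k) N.+1) (vpow a) _.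
rewrite -[cmp g (w + u)](subrK (cmp g (w + u0))) (EXPD hlog).
have hp := pert _ _ ji' hg; apply: inSM (@LG_M _ _ _ _ _ (ell k) N.+1) _ _; last first.
  by apply: inS_LG_EXP; apply: IH hg.
rewrite (EXP_small hlog); last exact: inS_sub (@below_lt1 (ell k) N) hp.
by apply: inS_ps (inS_sub (@below_LG (ell k) N) hp); [exact: LG_1|exact: LG_M].
Qed.

(** * Increasing bijections of the series above all reals *)

Definition increasing_onto f :=
  (forall x y, LEh x -> above x -> LEh y -> above y -> x < y -> cmp f x < cmp f y) /\
  (forall w, LEh w -> above w -> exists v, [/\ LEh v, above v & cmp f v = w]).

Lemma increasing_onto_TD n e : inS (LG T n) e -> inS Mlt1 e -> increasing_onto (mn T + e).
Proof.
move=> he e1; split => [x y hx ax hy ay xy|w [j hw] aw].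
  by apply: cmp_TD_lt he e1 => //; apply: composable_LEh.
have XT : inS X (mn T : H) by apply: inS_tm; apply: (@LGT_X 0); apply: LG_base.
have Xe := inS_LGT_X he.
(* [w] has level j + j, and by [cmp_LG_closed] the composition with [e], of level n, is absorbed by
   n further levels. *)
set G := LG (ell j) (j + j + n).
have hwG : inS G w by apply: inS_sub hw; apply: LG_le; apply: leq_addr.
have dw u : inS (G `&` Mlt1) u -> above (w + u) /\ composable (w + u).
  move=> hu; have au : above (w + u) by apply: aboveD => //; apply: inS_sub hu => p [].
  split => //; apply: (@composable_LG j (j + j + n)) => //; apply: inSD => //.
  by apply: inS_sub hu => p [].
have [|u hu|u v hu hv uv|u hu Eu] := @contraction_fixedpoint _ R M (G `&` Mlt1) (fun u => - cmp e (w + u)).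
- have [I [c hc]] := @LG_small _ _ _ _ hlog (ell j) (j + j + n).
  by exists I, c => m [/hc].
- have [au du] := dw _ hu; apply: inSN; apply: inS_and; last exact: cmp_small.
  by apply: (cmp_LG_closed hw aw _ _ (leqnn n)) => //; apply: inS_sub hu => p [].
- have [_ du] := dw _ hu; have [_ dv] := dw _ hv.
  have E : u - v = (w + u) - (w + v) by ring.
  have uvw : w + v != w + u by rewrite -subr_eq0 -opprB -E oppr_eq0 subr_eq0.
  have := cmp_small_contract dv du uvw he e1; rewrite -E => /precNl.
  by rewrite opprB -[- cmp e (w + u) - _]addrC opprK addrC.
have [au du] := dw _ hu; exists (w + u); split => //.
  exists (maxn j (j + j + n)); apply: inS_sub (inSD hwG (inS_sub _ hu)); last by move=> p [].
  by apply: LG_D; rewrite ?leq_maxl ?leq_maxr.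
by rewrite (cmpD du) ?(cmp_T du) // -[cmp e _]opprK Eu addrK.
Qed.

Lemma lead_add f u : prec u f -> lm (f + u) = lm f /\ lc (f + u) = lc f.
Proof.
move=> uf; have [_ E] := prec_lead_add uf; split => //.
rewrite {1}/lc E hvD [u _](_ : _ = 0) ?addr0 //.
by apply: contrapT => /eqP /(prec_lm uf); rewrite ltxx.
Qed.

Lemma lm_gt1 h : above h -> (1%g < lm h)%O.
Proof. by move=> [_ p]; apply: prec_lm p _; have := lmP (oner_neq0 H); rewrite -{2 3}mn1 lm_mn => -[]. Qed.

Lemma lead_LOG h : above h -> lm (LOG h) = lm (lg (lm h)) /\ lc (LOG h) = lc (lg (lm h)).
Proof.
move=> ah; have l1 := lm_gt1 ah; have h0 : h != 0 by rewrite gt_eqF //; case: ah.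
have lg0 : lg (lm h) != 0 by rewrite gt_eqF // lg_gt0.
have p1 : prec 1 (lg (lm h)) by apply: inS_Mgt1_prec => //; apply: inS_lg.
rewrite LOGE -addrA; apply: lead_add; apply: precD.
  by rewrite -[kst _]mulr1; apply: precZl.
by apply: prec_trans p1; apply/prec1P; apply: inS_lt1_ps (eps_lt1 h0).
Qed.

(** * Substitution of e^T and conjugation by the exponential *)

Let eT : M := exm (mn T : H).

Lemma T_gt1 : (1%g < T)%O. Proof. by case: hT. Qed.

Lemma lg_eT : lg eT = mn T.
Proof. by rewrite exmK // => m; apply: (@inS_tm _ R _ Mgt1 1 T T_gt1). Qed.

Lemma X_eT : X eT.
Proof.
apply: (@LGT_X 1); apply: LG_exp; last exact: (@inS_tm _ R _ Mgt1 1 T T_gt1).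
by apply: inS_tm; apply: LG_base.
Qed.

Lemma composable_eT : composable (mn eT).
Proof.
split; first by apply: Xomega; apply: X_eT.
by apply: mn_above; rewrite -(lg_gt0 hlog) lg_eT mn_gt0.
Qed.

Lemma LG_eT n : LG eT n `<=` LG T n.+1.
Proof. exact: LG_shift lg_eT. Qed.

Definition shiftT m := lm (cmp (mn m) (mn eT)).

Lemma shiftTE n m : LG T n m -> cmp (mn m) (mn eT) = mn (shiftT m) /\ LG eT n (shiftT m).
Proof. by move=> /(cmp_monomial composable_eT)[m' Lm E]; rewrite /shiftT E lm_mn. Qed.

Lemma lead_shiftT n f : inS (LG T n) f -> f != 0 ->
  lm (cmp f (mn eT)) = shiftT (lm f) /\ lc (cmp f (mn eT)) = lc f.
Proof.
move=> hf f0; have Ll := hf _ (proj1 (lmP f0)); have [E _] := shiftTE Ll.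
have := cmp_lead composable_eT (inS_LGT_X hf) f0; rewrite E => h.
have c0 := lc_neq0 f0.
have := lead_add (precZr c0 h); rewrite addrC subrK => -[-> ->].
by rewrite -tmE lm_tm // lc_tm.
Qed.

Lemma shiftT_gt1 n m : LG T n m -> (1%g < m)%O -> (1%g < shiftT m)%O.
Proof.
move=> Lm m1; have [E _] := shiftTE Lm.
by have [_] := cmp_mn_above composable_eT (LGT_X Lm) m1; rewrite E -mn1 => /prec_mn.
Qed.

Lemma LG_eT_lg n q : LG eT n q -> inS (LG T n.+1) (lg q).
Proof.
move=> /LG_inv[a [g [-> _ hg]]]; rewrite lg_eT; apply: inSD.
  by apply: inSZ; apply: inS_tm; apply: LG_base.
case: hg => [->|[k -> hg]]; first exact: inS0.
apply: inS_sub hg => p /LG_eT; exact: LG_S.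
Qed.

Definition log_shiftT m := lm (lg (shiftT m)).

Lemma log_shiftT_LG n m : LG T n m -> (1%g < m)%O -> LG T n.+1 (log_shiftT m) /\ (1%g < log_shiftT m)%O.
Proof.
move=> Lm m1; have [_ Ls] := shiftTE Lm; have s1 := shiftT_gt1 Lm m1.
have n0 : lg (shiftT m) != 0 by rewrite gt_eqF // lg_gt0.
have sl := proj1 (lmP n0); split; first exact: LG_eT_lg Ls _ sl.
exact: inS_lg sl.
Qed.

Lemma lg_shiftT n m : LG T n m -> lg (shiftT m) = cmp (lg m) (mn eT).
Proof.
move=> Lm; have [E _] := shiftTE Lm; rewrite -(LOG_mn hlog) -E.
by rewrite (cmp_mn composable_eT (LGT_X Lm)) LOG_EXP.
Qed.

Lemma log_shiftT_shiftT n m : LG T n m -> (1%g < m)%O -> log_shiftT (shiftT m) = shiftT (log_shiftT m).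
Proof.
move=> Lm m1; have [_ Ls] := shiftTE Lm; have s1 := shiftT_gt1 Lm m1.
rewrite /log_shiftT (lg_shiftT (LG_eT Ls)).
have n0 : lg (shiftT m) != 0 by rewrite gt_eqF // lg_gt0.
by have [] := lead_shiftT (LG_eT_lg Ls) n0.
Qed.

Fixpoint exp_tower (r : nat) : M := if r is r'.+1 then exm (mn (exp_tower r') : H) else T.

Lemma exp_towerP (r : nat) : [/\ LG T r (exp_tower r), (1%g < exp_tower r)%O & shiftT (exp_tower r) = exp_tower r.+1].
Proof.
elim: r => [|r [Lr r1 sr]].
  split; [exact: LG_base|exact: T_gt1|].
  by rewrite /shiftT (cmp_T composable_eT) lm_mn.
have hr : inS Mgt1 (mn (exp_tower r) : H) by apply: (@inS_tm _ R _ Mgt1 1 _ r1).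
have L1 : LG T r.+1 (exp_tower r.+1) by apply: LG_exp => //; apply: inS_tm.
split => //; first by rewrite -(lg_gt0 hlog) exmK // mn_gt0.
have [E _] := shiftTE Lr; rewrite sr in E.
have := lg_shiftT L1; rewrite {2}/exp_tower -/exp_tower exmK // E => /(congr1 exm).
by rewrite lgK.
Qed.

(** For m = T^a e^g with g nonzero, log(m o e^T) = aT + g o e^T has the leading monomial s o e^T,
    with s that of g. So a step lowers the level by one up to the shift T |-> e^T, which commutes
    with [log_shiftT] and only raises the final tower. Powers of T reach T in one step. *)
Lemma iter_log_shiftT n m : LG T n m -> (1%g < m)%O -> exists N (r : nat), iter N log_shiftT m = exp_tower r.
Proof.
elim: n m => [|n IH] m Lm m1.
  have [a E] := Lm; exists 1%N, 0%N; rewrite /= /log_shiftT (lg_shiftT Lm) E.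
  have XT : inS X (lg T) by apply: Xlog; apply: (@LGT_X 0); apply: LG_base.
  rewrite (cmpZ composable_eT) // (cmp_lgT composable_eT) LOG_mn lg_eT -tmE lm_tm //.
  by apply: contraTneq m1 => a0; rewrite -(lg_gt0 hlog) E a0 kst0 mul0r ltxx.
have [a [g [hg E]]] := Lm; have [g0|g0] := eqVneq g 0.
  exists 1%N, 0%N; rewrite /= /log_shiftT (lg_shiftT Lm) E g0 addr0.
  have XT : inS X (lg T) by apply: Xlog; apply: (@LGT_X 0); apply: LG_base.
  rewrite (cmpZ composable_eT) // (cmp_lgT composable_eT) LOG_mn lg_eT -tmE lm_tm //.
  by apply: contraTneq m1 => a0; rewrite -(lg_gt0 hlog) E a0 kst0 mul0r g0 addr0 ltxx.
have [Ls s1] := hg _ (proj1 (lmP g0)); set s := lm g in Ls s1.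
have hg1 : inS (LG T n) g by apply: inS_sub hg => p [].
have Xg := inS_LGT_X hg1.
have XT : inS X (lg T) by apply: Xlog; apply: (@LGT_X 0); apply: LG_base.
have pl : prec (kst a * lg T) g by apply/precZl/prec_lead_mn => //; apply: LG_lg_prec Ls s1.
have ts : log_shiftT m = shiftT s.
  have [<- _] := lead_shiftT hg1 g0; rewrite /log_shiftT (lg_shiftT Lm) E addrC (cmpD composable_eT) //; last exact: inSZ.
  apply: (proj1 (lead_add _)); apply: (cmp_prec composable_eT) => //; exact: inSZ.
have [N [r EN]] := IH s Ls s1; exists N.+1, r.+1; rewrite iterSr ts.
have comm k : [/\ exists n', LG T n' (iter k log_shiftT s), (1%g < iter k log_shiftT s)%O & iter k log_shiftT (shiftT s) = shiftT (iter k log_shiftT s)].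
  elim: k => [|k [[n' Lk] k1 Ek]]; first by split => //; exists n.
  have [L2 t1] := log_shiftT_LG Lk k1; split => /=; [by exists n'.+1|by []|].
  by rewrite Ek (log_shiftT_shiftT Lk).
by have [_ _ ->] := comm N; rewrite EN; have [_ _ ->] := exp_towerP r.
Qed.

(* Conjugation by the exponential, f |-> log o f o exp; log_shiftT is its effect
   on leading monomials. *)
Definition log_conj f := LOG (cmp f (mn eT)).

Lemma log_conj_above n f : inS (LG T n) f -> above f ->
  [/\ inS (LG T n.+1) (log_conj f), above (log_conj f) & lm (log_conj f) = log_shiftT (lm f)].
Proof.
move=> hf af; have f0 : f != 0 by rewrite gt_eqF //; case: af.
have [L1 _] := lead_shiftT hf f0; have ah := cmp_above composable_eT (inS_LGT_X hf) af.
have hh : inS (LG T n.+1) (cmp f (mn eT)).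
  by apply: inS_sub (cmp_LG composable_eT hf); apply: LG_eT.
split; last by rewrite /log_conj (proj1 (lead_LOG ah)) L1.
  rewrite /log_conj LOGE; apply: inSD; last first.
    by apply: inS_ps; [exact: LG_1|exact: LG_M|apply: inS_eps hh; [exact: LG_1|exact: LG_M|exact: LG_V]].
  apply: inSD; last by apply: inS_kst; apply: LG_1.
  rewrite L1; apply: LG_eT_lg; have [_ Ls] := shiftTE (hf _ (proj1 (lmP f0))); exact: Ls.
exact: above_LOG.
Qed.

Lemma cmp_log_conj n f v : inS (LG T n) f -> above f -> composable v -> cmp (log_conj f) v = LOG (cmp f (EXP v)).
Proof.
move=> hf af dv; have [de ae] := composable_eT.
have XeT : inS X (mn eT : H) by apply: inS_tm; apply: X_eT.
have Xall k h : inS (LG T k) h -> inS X (cmp h (mn eT)).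
  by move=> hh; apply: inS_sub (cmp_LG composable_eT hh) => p /LG_eT /LGT_X.
have [h0 _] := cmp_above composable_eT (inS_LGT_X hf) af.
rewrite /log_conj (cmp_LOG dv) //; last exact: Xall hf.
rewrite (cmp_assoc dv XeT ae hf); last by move=> k h _; apply: Xall.
by rewrite (cmp_mn dv X_eT) lg_eT (cmp_T dv).
Qed.

Lemma increasing_onto_LOG f : inS X f -> above f -> increasing_onto (LOG f) -> increasing_onto f.
Proof.
move=> hf af [G1 G2]; have [f0 _] := af; split => [x y hx ax hy ay xy|w hw aw].
  have dxx := composable_LEh hx ax; have dxy := composable_LEh hy ay.
  have := G1 _ _ hx ax hy ay xy; rewrite (cmp_LOG dxx) // (cmp_LOG dxy) // LOG_ltE //; exact: cmp_gt0.
have [w0 _] := aw; have [v [hv av E]] := G2 _ (LEh_LOG w0 hw) (above_LOG hlog aw).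
exists v; split => //; have dv := composable_LEh hv av; move: E; rewrite (cmp_LOG dv) //.
by move=> /(congr1 EXP); rewrite !EXP_LOG //; apply: cmp_gt0.
Qed.

Lemma increasing_onto_log_conj n f : inS (LG T n) f -> above f -> increasing_onto (log_conj f) -> increasing_onto f.
Proof.
move=> hf af [G1 G2]; have Xf := inS_LGT_X hf; have [f0 _] := af.
have E v : LEh v -> above v -> cmp (log_conj f) (LOG v) = LOG (cmp f v).
  move=> hv av; have [v0 _] := av.
  rewrite (cmp_log_conj hf af) ?EXP_LOG //.
  by apply: composable_LEh; [apply: LEh_LOG|apply: above_LOG].
split => [x y hx ax hy ay xy|w hw aw].
  have dxx := composable_LEh hx ax; have dxy := composable_LEh hy ay; have [x0 _] := ax; have [y0 _] := ay.
  have := G1 _ _ (LEh_LOG x0 hx) (above_LOG hlog ax) (LEh_LOG y0 hy) (above_LOG hlog ay).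
  by rewrite LOG_ltE // !E // LOG_ltE; [exact|exact: cmp_gt0|exact: cmp_gt0].
have [w0 _] := aw; have [v [hv av Ev]] := G2 _ (LEh_LOG w0 hw) (above_LOG hlog aw).
have hE := LEh_EXP hv; have aE : above (EXP v) by apply: above_EXP.
exists (EXP v); split => //; move: (E _ hE aE); rewrite LOG_EXP Ev => /(congr1 EXP).
rewrite !EXP_LOG //; apply: cmp_gt0 => //; exact: composable_LEh.
Qed.

Lemma log_conj_lead_T n f : inS (LG T n) f -> above f -> lm f = T ->
  exists2 e, inS Mlt1 e /\ inS (LG T n.+1) e & log_conj f = mn T + kst (ln (lc f)) + e.
Proof.
move=> hf af lT; have f0 : f != 0 by rewrite gt_eqF //; case: af.
have [L1 L2] := lead_shiftT hf f0; have [h0 _] := cmp_above composable_eT (inS_LGT_X hf) af.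
have hh : inS (LG T n.+1) (cmp f (mn eT)).
  by apply: inS_sub (cmp_LG composable_eT hf); apply: LG_eT.
exists (ps lnc (eps (cmp f (mn eT)))); last first.
  rewrite /log_conj LOGE L1 L2 lT; have [_ _ ->] := exp_towerP 0.
  by rewrite /= -/eT lg_eT.
split; first by apply: inS_lt1_ps => //; apply: eps_lt1; rewrite gt_eqF.
by apply: inS_ps; [exact: LG_1|exact: LG_M|apply: inS_eps hh; [exact: LG_1|exact: LG_M|exact: LG_V]].
Qed.

Lemma increasing_onto_exp_tower (r n : nat) f : inS (LG T n) f -> above f -> lm f = exp_tower r -> increasing_onto f.
Proof.
elim: r n f => [|r IH] n f hf af lf.
  (* Conjugation keeps the leading monomial T. The first one makes the leading coefficient 1, that
     of log(e^T) = T, so the constant ln 1 produced by the second one vanishes and T + e is left. *)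
  apply: (increasing_onto_log_conj hf af); have [hc ac lc1] := log_conj_above hf af; apply: (increasing_onto_log_conj hc ac).
  have [_ _ s0] := exp_towerP 0; have taT : log_shiftT T = T.
    by rewrite /log_shiftT s0 /= -/eT lg_eT lm_mn.
  have [|e [e1 he] ->] := log_conj_lead_T hc ac; first by rewrite lc1 lf taT.
  rewrite [lc _](_ : _ = 1) ?ln1 ?kst0 ?addr0; first exact: increasing_onto_TD he e1.
  rewrite (proj2 (lead_LOG (cmp_above composable_eT (inS_LGT_X hf) af))).
  have f0 : f != 0 by rewrite gt_eqF //; case: af.
  have -> : lm (cmp f (mn eT)) = eT by rewrite (proj1 (lead_shiftT hf f0)) lf s0.
  by rewrite lg_eT lc_mn.
(* Here log f stays in E because the logarithm of the leading monomial is the monomial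
   [exp_tower r]; in general it could contain a multiple of log T. *)
apply: increasing_onto_LOG => //; first exact: inS_LGT_X hf.
have [Lr r1 _] := exp_towerP r.
have E : lg (exp_tower r.+1) = mn (exp_tower r) by rewrite /= exmK //; apply: (@inS_tm _ R _ Mgt1 1 _ r1).
apply: (IH (maxn n r)); last by rewrite (proj1 (lead_LOG af)) lf E lm_mn.
  have he : inS (LG T (maxn n r)) (eps f).
    by apply: inS_eps (inS_sub (LG_le (leq_maxl n r)) hf); [exact: LG_1|exact: LG_M|exact: LG_V].
  rewrite LOGE lf E; apply: inSD; last by apply: inS_ps he; [exact: LG_1|exact: LG_M].
  apply: inSD; last by apply: inS_kst; apply: LG_1.
  by apply: inS_tm; apply: LG_le Lr; apply: leq_maxr.
exact: above_LOG.
Qed.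

Lemma increasing_onto_E n f : inS (LG T n) f -> above f -> increasing_onto f.
Proof.
move=> hf af; have f0 : f != 0 by rewrite gt_eqF //; case: af.
have [N [r]] := iter_log_shiftT (hf _ (proj1 (lmP f0))) (lm_gt1 af).
elim: N n f hf af {f0} => [|N IH] n f hf af; first exact: increasing_onto_exp_tower hf af.
have [hc ac lc1] := log_conj_above hf af.
by rewrite iterSr -lc1 => h; apply: (increasing_onto_log_conj hf af); apply: IH hc ac h.
Qed.

(** * The intermediate value property *)

Definition ivp (phi : H -> H) := forall x y w,
  LEh x -> above x -> LEh y -> above y -> LEh w -> phi x <= w -> w <= phi y ->
  exists z, [/\ LEh z, above z, x <= z <= y \/ y <= z <= x & phi z = w].

Lemma ivp_eq (phi psi : H -> H) :
  (forall v, LEh v -> above v -> phi v = psi v) -> ivp phi -> ivp psi.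
Proof.
move=> E h x y w hx ax hy ay hw; rewrite -!E // => h1 h2.
by have [z [hz az hb Ez]] := h x y w hx ax hy ay hw h1 h2; exists z; rewrite -E.
Qed.

(** The point found between LOG x and LOG y is carried back by the increasing map [EXP]. As [ivp]
    speaks of functions, no series representing the composite has to be exhibited. *)
Lemma ivp_LOG phi : ivp phi -> ivp (phi \o LOG).
Proof.
move=> h x y w hx ax hy ay hw h1 h2; have [x0 _] := ax; have [y0 _] := ay.
have [z [hz az hb Ez]] := h _ _ w (LEh_LOG x0 hx) (above_LOG hlog ax) (LEh_LOG y0 hy) (above_LOG hlog ay) hw h1 h2.
have LE v : 0 < v -> (LOG v <= z -> v <= EXP z) /\ (z <= LOG v -> EXP z <= v).
  move=> v0; have := EXP_leE hlog (LOG v) z; have := EXP_leE hlog z (LOG v).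
  by rewrite EXP_LOG // => -> ->.
have [ax1 ax2] := LE _ x0; have [ay1 ay2] := LE _ y0.
exists (EXP z); split; [exact: LEh_EXP|exact: above_EXP| |by rewrite /= LOG_EXP].
by case: hb => /andP[/[dup] h3 _ /[dup] h4 _]; [left|right]; apply/andP; auto.
Qed.

Lemma ivp_opp phi : ivp phi -> ivp (fun v => - phi v).
Proof.
move=> h x y w hx ax hy ay hw h1 h2; rewrite lerNl in h1; rewrite lerNr in h2.
have [z [hz az hb Ez]] := h y x (- w) hy ay hx ax (LEhN hw) h2 h1.
by exists z; split => //; [case: hb; [right|left]|rewrite Ez opprK].
Qed.

Lemma ivp_addr phi r : ivp phi -> ivp (fun v => phi v + kst r).
Proof.
move=> h x y w hx ax hy ay hw h1 h2; rewrite -lerBrDr in h1; rewrite -lerBlDr in h2.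
have hw' : LEh (w - kst r) by apply: LEhD => //; apply: LEhN; apply: LEh_kst.
have [z [hz az hb Ez]] := h x y _ hx ax hy ay hw' h1 h2.
by exists z; split => //; rewrite Ez subrK.
Qed.

Lemma ivp_inv phi : (forall v, LEh v -> above v -> 0 < phi v) -> ivp phi -> ivp (fun v => (phi v)^-1).
Proof.
move=> pos h x y w hx ax hy ay hw h1 h2; have px := pos _ hx ax; have py := pos _ hy ay.
have w0 : 0 < w by apply: lt_le_trans h1; rewrite invr_gt0.
have inv_le a b : 0 < a -> 0 < b -> a^-1 <= b -> b^-1 <= a :> H.
  move=> a0 b0; rewrite -(ler_pM2l a0) mulfV ?gt_eqF // => ab.
  by rewrite -(ler_pM2l b0) mulfV ?gt_eqF // mulrC.
have h1' := inv_le _ _ px w0 h1.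
have h2' : phi y <= w^-1.
  by rewrite -[leLHS]invrK; apply: inv_le => //; rewrite ?invr_gt0 ?invrK.
have [z [hz az hb Ez]] := h y x _ hy ay hx ax (LEhV hw) h2' h1'.
by exists z; split => //; [case: hb; [right|left]|rewrite Ez invrK].
Qed.

(** From w >= f o x it follows that w exceeds all reals, so w has a preimage, and monotonicity
    places it between [x] and [y]. *)
Lemma ivp_above n f : inS (LG T n) f -> above f -> ivp (cmp f).
Proof.
move=> hf af; have [mono onto] := increasing_onto_E hf af; move=> x y w hx ax hy ay hw h1 h2.
have aw : above w by apply: above_le h1; apply: (cmp_above (composable_LEh hx ax)) => //; apply: inS_LGT_X hf.
have [z [hz az Ez]] := onto _ hw aw; exists z; split => //; left; apply/andP; split.
  by rewrite leNgt; apply/negP => /(mono _ _ hz az hx ax); rewrite Ez ltNge h1.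
by rewrite leNgt; apply/negP => /(mono _ _ hy ay hz az); rewrite Ez ltNge h2.
Qed.

Lemma ivp_N n f : inS (LG T n) f -> ivp (cmp (- f)) -> ivp (cmp f).
Proof.
move=> hf /ivp_opp; apply: ivp_eq => v hv av.
by rewrite (cmpN (composable_LEh hv av)) ?opprK //; apply: inS_LGT_X hf.
Qed.

Lemma ivp_prec1 n f : inS (LG T n) f -> prec 1 f -> ivp (cmp f).
Proof.
move=> hf pf; have [f0|f0|E] := ltrgt0P f.
- exact: ivp_above hf (conj f0 pf).
- apply: (ivp_N hf); apply: (ivp_above (inSN hf)).
  by split; [rewrite oppr_gt0|apply: precNr].
by have := prec_neq0 pf; rewrite E eqxx.
Qed.

Lemma ivp_small n e : inS (LG T n) e -> inS Mlt1 e -> e != 0 -> ivp (cmp e).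
Proof.
move=> he e1 e0.
have pos g : inS (LG T n) g -> inS Mlt1 g -> 0 < g -> ivp (cmp g).
  move=> hg g1 g0; have hV : inS (LG T n) g^-1.
    by apply: inS_inv hg; [exact: LG_1|exact: LG_M|exact: LG_V].
  have aV : above g^-1.
    split; first by rewrite invr_gt0.
    have gn : g^-1 != 0 by rewrite invr_eq0 gt_eqF.
    by have := precMr (proj2 (prec1P g) g1) gn; rewrite mul1r mulfV // gt_eqF.
  have := ivp_inv _ (ivp_above hV aV) => /(_ _)/wrap[].
    by move=> v hv av; apply: (cmp_gt0 (composable_LEh hv av)) (inS_LGT_X hV) _; rewrite invr_gt0.
  apply: ivp_eq => v hv av.
  by rewrite (cmpV (composable_LEh hv av)) ?invrK //; apply: inS_LGT_X hg.
have [h|h|E] := ltrgt0P e; first exact: pos.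
  by apply: (ivp_N he); apply: pos; [apply: inSN|apply: inSN|rewrite oppr_gt0].
by rewrite E eqxx in e0.
Qed.

Lemma ivp_kst r : ivp (cmp (kst r)).
Proof.
move=> x y w hx ax hy ay hw; rewrite !cmp_kst; try exact: composable_LEh.
move=> h1 h2; have E : kst r = w by apply/le_anti; rewrite h1 h2.
exists x; split => //; last by rewrite cmp_kst //; apply: composable_LEh.
by have [xy|/ltW yx] := leP x y; [left; rewrite lexx|right; rewrite lexx andbT].
Qed.

Lemma ivp_E n f : inS (LG T n) f -> ivp (cmp f).
Proof.
move=> hf; have Ef := hs_split f; set J := rst Mgt1 f in Ef; set e := rst Mlt1 f in Ef.
have e1 : inS Mlt1 e by apply: inS_rst.
have [J0|J0] := eqVneq J 0; last first.
  apply: ivp_prec1 hf _; have J1 : prec 1 J by apply: inS_Mgt1_prec => //; apply: inS_rst.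
  rewrite Ef -addrA; apply: precDr => //; apply: precD.
    by rewrite -[kst _]mulr1; apply: precZl.
  by apply: prec_trans J1; apply/prec1P.
rewrite J0 add0r in Ef; have he : inS (LG T n) e by apply: inS_rst2.
clearbody e J; have [e0|e0] := eqVneq e 0; first by rewrite Ef e0 addr0; apply: ivp_kst.
apply: (ivp_eq _ (ivp_addr (r := f 1%g) (ivp_small he e1 e0))) => v hv av.
have dv := composable_LEh hv av; have Xk : inS X (kst (f 1%g) : H) by apply: inS_kst; apply: X1.
by rewrite [in RHS]Ef (cmpD dv Xk (inS_LGT_X he)) (cmp_kst dv) addrC.
Qed.

Lemma cmp_mn_ell k v : LEh v -> above v -> cmp (mn (ell k)) v = iter k LOG v.
Proof.
move=> hv av; have dv := composable_LEh hv av; elim: k => [|k IH]; first by rewrite ell0 (cmp_T dv).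
have Xl : X (ell k) by apply: (@LG_X _ _ _ _ hlog _ hT k 0); apply: LG_base.
by rewrite /= -lg_ell -IH -(LOG_mn hlog) (cmp_LOG dv) ?mn_gt0 //; apply: inS_tm.
Qed.

Lemma ivp_LE f : LEh f -> ivp (cmp f).
Proof.
move=> [j hf]; have [f0 hf0 <-] := cmp_LG_onto (composable_ell j) hf.
have iv k : ivp (fun v => cmp f0 (iter k LOG v)).
  elim: k => [|k IH]; first exact: ivp_E hf0.
  apply: ivp_eq (ivp_LOG IH) => v _ _; by rewrite iterSr.
apply: ivp_eq (iv j) => v hv av; have dv := composable_LEh hv av.
have [lX al] := composable_ell j.
have Xl : inS X (mn (ell j) : H).
  by apply: inS_tm; apply: (@LG_X _ _ _ _ hlog _ hT j 0); apply: LG_base.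
rewrite (cmp_assoc dv Xl al hf0) ?cmp_mn_ell // => k h _ hh.
by apply: inS_sub (cmp_LG (composable_ell j) hh); apply: LG_X.
Qed.

Lemma hleP f g : hle (hv f) (hv g) <-> f <= g.
Proof.
split=> [[/hs_eq ->//|/hltP/ltW//]|]; rewrite le_eqVlt => /orP[/eqP->|/hltP]; by [left|right].
Qed.

End Composition.

Theorem mainTheorem4 (d : Order.disp_t) (R : realType) (M : oabGroupType d)
  (log : M -> M -> R) (hlog : transseries_field log)
  (T : M) (hT : log_atomic log T)
  (comp : (M -> R) -> (M -> R) -> M -> R) (hcomp : is_composition log T comp)
  (f : M -> R) (hf : LE log T comp f)
  (x y w : M -> R)
  (hx : LE log T comp x) (hxR : above_reals x)
  (hy : LE log T comp y) (hyR : above_reals y)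
  (hw : LE log T comp w)
  (hxw : hle (comp f x) w) (hwy : hle w (comp f y)) :
  exists z : M -> R,
    [/\ LE log T comp z, hle (hmin x y) z, hle z (hmax x y) & comp f z = w].
Proof.
have [F LF EF] := LE_hahn hlog hT hcomp hf; subst f.
have [x' Lx Ex] := LE_hahn hlog hT hcomp hx; subst x.
have [y' Ly Ey] := LE_hahn hlog hT hcomp hy; subst y.
have [w' Lw Ew] := LE_hahn hlog hT hcomp hw; subst w.
have ax : above x' by apply/aboveE.
have ay : above y' by apply/aboveE.
have E v : LEh hlog hT v -> above v -> comp (hv F) (hv v) = hv (cmp comp F v).
  by move=> Lv av; rewrite (hv_cmp hcomp (composable_LEh Lv av)) //; apply: LEh_X LF.
rewrite !E // in hxw hwy; move: hxw hwy => /hleP hxw /hleP hwy.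
have [z [Lz az hb Ez]] := ivp_LE hcomp LF Lx ax Ly ay Lw hxw hwy.
exists (hv z); split; [exact/(LE_LEh hlog hT hcomp)| | |by rewrite E // Ez].
- rewrite /hmin; case: asboolP => /hleP xy; apply/hleP; case: hb => /andP[h1 h2] //.
    exact: le_trans xy _.
  by move/negP: xy; rewrite -ltNge => /ltW xy; apply: le_trans xy _.
- rewrite /hmax; case: asboolP => /hleP xy; apply/hleP; case: hb => /andP[h1 h2] //.
    exact: le_trans xy.
  by move/negP: xy; rewrite -ltNge => /ltW xy; apply: le_trans xy.
Qed.
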